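(* There exists $C\ge1$ such that for all $\alpha\in[0,1]$ and all $A\in\Omega$, $$C^{-1}|A|_\alpha\le|A|_{\mathrm{gr}\alpha}+|A|_\bullet\le C|A|_\alpha,$$ where $\bullet$ is any one of $\mathrm{vee}\,\alpha$, $\triangle\alpha$, or $\mathrm{symm}\,\alpha$.
   Context: $E$ is a Banach space; $\mathbf T^2=[-\frac12,\frac12)^2$ with geodesic distance. $\mathcal X=\mathbf T^2\times\{v\in\mathbb R^2:|v|\le\frac14\}$ (oriented segments); for $\ell=(x,v)$, $\ell_i=x$, $\ell_f=x+v$, $|\ell|=|v|$, $\iota(\ell)=\{x+cv:c\in[0,1)\}$. $\ell,\bar\ell$ are joinable if $\bar x=x+v$ and $v=cw,\bar v=\bar cw$ for a unit $w$, $c,\bar c\in[-\frac14,\frac14]$, $|c+\bar c|\le\frac14$; then $\ell\sqcup\bar\ell=(x,(c+\bar c)w)$. $\Omega$ is the space of measurable $A:\mathcal X\to E$ with $A(\ell\sqcup\bar\ell)=A(\ell)+A(\bar\ell)$ for joinable pairs. $\ell,\bar\ell$ are far if $|\ell_i-\bar\ell_i|\vee|\ell_f-\bar\ell_f|>\frac14(|\ell|\wedge|\bar\ell|)$. $\rho(\ell,\bar\ell)=|\ell|+|\bar\ell|$ if far, otherwise $|\ell_i-\bar\ell_i|+|\ell_f-\bar\ell_f|+\mathrm{Area}(\ell,\bar\ell)^{1/2}$, where $\mathrm{Area}(\ell,\bar\ell)$ is the area of the convex hull of $\ell_i,\ell_f,\bar\ell_f,\bar\ell_i$. $|A|_\alpha=\sup_{\rho(\ell,\bar\ell)>0}|A(\ell)-A(\bar\ell)|/\rho(\ell,\bar\ell)^\alpha$;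 $|A|_{\mathrm{gr}\alpha}=\sup_{|\ell|>0}|A(\ell)|/|\ell|^\alpha$. $\ell,\bar\ell$ form a vee if they are not far, $|\ell|=|\bar\ell|$ and $\ell_i=\bar\ell_i$; $|A|_{\mathrm{vee}\,\alpha}=\sup|A(\ell)-A(\bar\ell)|/\mathrm{Area}(\ell,\bar\ell)^{\alpha/2}$ over distinct pairs forming a vee. A triangle is $P=(\ell^1,\ell^2,\ell^3)\in\mathcal X^3$ with $\ell^1_i=\ell^3_f$, $\ell^j_i=\ell^{j-1}_f$ ($j=2,3$), the sets $\iota(\ell^j)$ pairwise disjoint and their union of diameter $\le\frac14$; $\mathring P$ is the simply connected component of its complement, $|P|$ the Lebesgue measure of $\mathring P$, and for triangles $P_1,P_2$, $|P_1;P_2|=|\mathring P_1\triangle\mathring P_2|$ if they have the same orientation and $|P_1|+|P_2|$ otherwise. $A(\partial P)=\sum_jA(\ell^j)$; $|A|_{\triangle\alpha}=\sup_{|P|>0}|A(\partial P)|/|P|^{\alpha/2}$ and $|A|_{\mathrm{symm}\,\alpha}=\sup_{|P;\bar P|>0}|A(\partial P)-A(\partial\bar P)|/|P;\bar P|^{\alpha/2}$, suprema over triangles. *)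

(* Defs.v *)
From HB Require Import structures.
From mathcomp Require Import all_boot all_order all_algebra.
From mathcomp Require Import all_classical all_reals all_analysis.
Set Implicit Arguments. Unset Strict Implicit. Unset Printing Implicit Defensive.
Import Order.TTheory GRing.Theory Num.Theory.
Import numFieldNormedType.Exports.
Local Open Scope classical_set_scope.
Local Open Scope ring_scope.

(* Conventions: points of R^2 are pairs; the torus T^2 = [-1/2,1/2)^2 is
   represented by canonical representatives in that square. *)

Section Defs.
Variable R : realType.

Definition pt := (R * R)%type.
Definition padd (p q : pt) : pt := (p.1 + q.1, p.2 + q.2).
Definition psub (p q : pt) : pt := (p.1 - q.1, p.2 - q.2).
Definition pscale (c : R) (p : pt) : pt := (c * p.1, c * p.2).
Definition enorm (p : pt) : R := Num.sqrt (p.1 ^+ 2 + p.2 ^+ 2).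
Definition det2 (u v : pt) : R := u.1 * v.2 - u.2 * v.1.

Definition tred1 (a : R) : R := a - (Num.floor (a + 2^-1))%:~R.
Definition tred (p : pt) : pt := (tred1 p.1, tred1 p.2).
Definition in_T (p : pt) : Prop :=
  (- 2^-1 <= p.1 < 2^-1) /\ (- 2^-1 <= p.2 < 2^-1).
Definition tdist (p q : pt) : R := enorm (tred (psub p q)).

(* oriented segments l = (x, v) *)
Definition seg := (pt * pt)%type.
Definition in_X (l : seg) : Prop := in_T l.1 /\ enorm l.2 <= 4^-1.
Definition seg_i (l : seg) : pt := l.1.
Definition seg_f (l : seg) : pt := tred (padd l.1 l.2).
Definition seg_len (l : seg) : R := enorm l.2.
Definition iota (l : seg) : set pt :=
  [set tred (padd l.1 (pscale c l.2)) | c in [set c : R | 0 <= c < 1]].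

Definition additive_on_joins (E : normedModType R) (A : seg -> E) : Prop :=
  forall (l l' : seg) (w : pt) (c c' : R),
    in_X l -> in_X l' ->
    l'.1 = seg_f l -> enorm w = 1 ->
    l.2 = pscale c w -> l'.2 = pscale c' w ->
    `|c| <= 4^-1 -> `|c'| <= 4^-1 -> `|c + c'| <= 4^-1 ->
    A (l.1, pscale (c + c') w) = A l + A l'.

(* Borel measurability of A : X -> E (X as a subset of R^4 with its Borel
   = product sigma-algebra) *)
Definition borel_measurable_on_X (E : normedModType R) (A : seg -> E) : Prop :=
  forall U : set E, open U -> measurable ([set l | in_X l] `&` A @^-1` U).

Definition Omega (E : normedModType R) (A : seg -> E) : Prop :=
  additive_on_joins A /\ borel_measurable_on_X A.

Definition far (l l' : seg) : Prop :=
  4^-1 * Num.min (seg_len l) (seg_len l') <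
  Num.max (tdist (seg_i l) (seg_i l')) (tdist (seg_f l) (seg_f l')).

Definition leb2 : set pt -> \bar R :=
  ((@lebesgue_measure R) \x (@lebesgue_measure R))%E.

Definition hull4 (q1 q2 q3 q4 : pt) : set pt :=
  [set p | exists a b c d : R, 0 <= a /\ 0 <= b /\ 0 <= c /\ 0 <= d /\
     a + b + c + d = 1 /\
     p = padd (padd (pscale a q1) (pscale b q2))
              (padd (pscale c q3) (pscale d q4))].

(* Area of the convex hull of l_i, l_f, l'_f, l'_i, computed in the lift to
   R^2 in which l'_i is the lift of l'_i nearest to l_i *)
Definition seg_area (l l' : seg) : R :=
  let d := tred (psub l'.1 l.1) in
  let q1 := l.1 in
  let q2 := padd l.1 l.2 in
  let q4 := padd l.1 d in
  let q3 := padd q4 l'.2 in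
  fine (leb2 (hull4 q1 q2 q3 q4)).

Definition rho (l l' : seg) : R :=
  if `[< far l l' >] then seg_len l + seg_len l'
  else tdist (seg_i l) (seg_i l') + tdist (seg_f l) (seg_f l')
       + Num.sqrt (seg_area l l').

Definition vee (l l' : seg) : Prop :=
  ~ far l l' /\ seg_len l = seg_len l' /\ seg_i l = seg_i l'.

Definition holder_norm (E : normedModType R) (A : seg -> E) (a : R) : \bar R :=
  ereal_sup [set x | exists l l', in_X l /\ in_X l' /\ 0 < rho l l' /\
                     x = (`|A l - A l'| / (rho l l') `^ a)%:E].

Definition gr_norm (E : normedModType R) (A : seg -> E) (a : R) : \bar R :=
  ereal_sup [set x | exists l, in_X l /\ 0 < seg_len l /\
                     x = (`|A l| / (seg_len l) `^ a)%:E].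

Definition vee_norm (E : normedModType R) (A : seg -> E) (a : R) : \bar R :=
  ereal_sup [set x | exists l l', in_X l /\ in_X l' /\ l <> l' /\ vee l l' /\
                     x = (`|A l - A l'| / (seg_area l l') `^ (a / 2))%:E].

Definition is_triangle (l1 l2 l3 : seg) : Prop :=
  [/\ in_X l1 /\ in_X l2 /\ in_X l3,
      seg_i l1 = seg_f l3 /\ seg_i l2 = seg_f l1 /\ seg_i l3 = seg_f l2,
      iota l1 `&` iota l2 = set0 /\ iota l2 `&` iota l3 = set0 /\
        iota l1 `&` iota l3 = set0
    & forall p q, (iota l1 `|` iota l2 `|` iota l3) p ->
                  (iota l1 `|` iota l2 `|` iota l3) q -> tdist p q <= 4^-1].

(* interior of P: the bounded (simply connected) component of the complement
   of the boundary, obtained by lifting the triangle to R^2 with vertices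
   l1_i, l1_i + v1, l1_i + v1 + v2 and projecting its open interior to T^2 *)
Definition tri_interior (l1 l2 l3 : seg) : set pt :=
  let p1 := l1.1 in
  let p2 := padd p1 l1.2 in
  let p3 := padd p2 l2.2 in
  [set y | in_T y /\ exists k1 k2 : int,
     exists a b c : R, 0 < a /\ 0 < b /\ 0 < c /\ a + b + c = 1 /\
       (y.1 + k1%:~R, y.2 + k2%:~R) =
       padd (padd (pscale a p1) (pscale b p2)) (pscale c p3)].

Definition tri_area (l1 l2 l3 : seg) : R := fine (leb2 (tri_interior l1 l2 l3)).

Definition tri_orient (l1 l2 l3 : seg) : R := Num.sg (det2 l1.2 l2.2).

Definition tri_dist (l1 l2 l3 m1 m2 m3 : seg) : R :=
  if tri_orient l1 l2 l3 == tri_orient m1 m2 m3 then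
    fine (leb2 ((tri_interior l1 l2 l3 `\` tri_interior m1 m2 m3) `|`
                (tri_interior m1 m2 m3 `\` tri_interior l1 l2 l3)))
  else tri_area l1 l2 l3 + tri_area m1 m2 m3.

Definition A_bdry (E : normedModType R) (A : seg -> E) (l1 l2 l3 : seg) : E :=
  A l1 + A l2 + A l3.

Definition tri_norm (E : normedModType R) (A : seg -> E) (a : R) : \bar R :=
  ereal_sup [set x | exists l1 l2 l3, is_triangle l1 l2 l3 /\
     0 < tri_area l1 l2 l3 /\
     x = (`|A_bdry A l1 l2 l3| / (tri_area l1 l2 l3) `^ (a / 2))%:E].

Definition symm_norm (E : normedModType R) (A : seg -> E) (a : R) : \bar R :=
  ereal_sup [set x | exists l1 l2 l3 m1 m2 m3,
     is_triangle l1 l2 l3 /\ is_triangle m1 m2 m3 /\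
     0 < tri_dist l1 l2 l3 m1 m2 m3 /\
     x = (`|A_bdry A l1 l2 l3 - A_bdry A m1 m2 m3|
           / (tri_dist l1 l2 l3 m1 m2 m3) `^ (a / 2))%:E].

End Defs.

(* Main.v *)
Require Import Defs.
From HB Require Import structures.
From mathcomp Require Import all_boot all_order all_algebra.
From mathcomp Require Import all_classical all_reals all_analysis.
From mathcomp Require Import measurable_realfun zify ring lra.
Import Order.TTheory GRing.Theory Num.Theory.
Import numFieldNormedType.Exports.
Local Open Scope classical_set_scope.
Local Open Scope ring_scope.

Set Implicit Arguments.
Unset Strict Implicit.

(**
Lift segments to the plane and write a(p,q) for the value of A on the segment
from p to q, and D(p,q,r) for twice the signed area of the triangle p q r.
Everything is compared with two local conditions: the corner condition
|a(p,q) - a(p,r)| <= K (|q-r|^al + |D(p,q,r)|^(al/2)) and the triangle condition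
|a(p,q) + a(q,r) + a(r,p)| <= K |D(p,q,r)|^(al/2).

Growth and vee bounds give the corner condition after trimming the longer of the
two segments; growth and the triangle condition give it at once.  Conversely the
corner condition gives the triangle condition by cutting a triangle along the
altitude on its longest side, and gives the Hölder bound by halving two segments
that are not far apart and passing through the diagonals (halving keeps the
diagonals shorter than 1/4).

For two triangles P, Q of the same orientation with small symmetric difference
delta, let z be a vertex of Q at barycentric depth t outside P.  The points of P
at depth less than t that lie in Q are mapped into Q \ P by averaging with z, so
delta >= c t |P|.  Hence the matrix of barycentric coordinates of Q with respect
to P and its inverse both have entries >= - O(delta / |P|), which makes them
close, linearly in delta, to a permutation matrix, necessarily cyclic by
orientation.  The difference of the two circulations is then a sum of six
circulations around triangles of area O(delta).
*)

(** The constant is uniform in al because the exponents al and al/2 lie in [0,1]: a factor c >= 1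
    inside such a power costs at most c outside it. Geometry is therefore needed only up to
    constants. Areas are never computed exactly: a triangle has measure between |D|/4 and |D|, and
    passing between plane and torus costs a factor 9. Two obstacles shape the estimates. Additivity
    is available only along joins of length at most 1/4, so every auxiliary segment must be shown to
    be short, or be cut at its midpoint. And a point of the torus has many lifts, so lifts have to
    be matched; this always comes down to an integer of modulus less than 1 being 0. For the
    symmetric norm, linearity of the estimates in delta is essential: the target is delta^(al/2), so
    the six triangles must have area O(delta), and a weaker rate of closeness would spoil the
    exponent. The threshold 1/3 is the value that the largest of three coordinates of sum 1 must
    reach. *)

(** * Area of plane triangles up to a factor *)

Section PlaneMeasure.
Variable R : realType.
Local Notation pt := (pt R).
Local Notation mu := (@lebesgue_measure R).

(** The measure unfolds to an outer measure, monotone on all sets. Convex hulls and torus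
    projections can thus be compared without proving them measurable. *)
Lemma lebesgue_measure_mono (A B : set R) : A `<=` B -> (mu A <= mu B)%E.
Proof.
move=> AB; rewrite /lebesgue_measure /lebesgue_stieltjes_measure.
by rewrite /measure_extension; exact: le_outer_measure.
Qed.

(** The integral of a nonnegative function is a supremum over simple functions below it, so it is
    monotone even when the section function is not known to be measurable. *)
Lemma leb2_mono (A B : set pt) : A `<=` B -> (leb2 A <= leb2 B)%E.
Proof.
move=> AB; rewrite /leb2 /product_measure1.
rewrite !ge0_integralTE; try by move=> x; exact: measure_ge0.
apply: le_ereal_sup => _ [h hA <-]; exists h => // x.
apply: le_trans (hA x) _; apply: lebesgue_measure_mono.
by move=> y; rewrite /xsection /= !inE; exact: AB.
Qed.

Lemma leb2_ge0 (A : set pt) : (0 <= leb2 A)%E.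
Proof. exact: measure_ge0. Qed.

(** Cavalieri: every vertical section lies in an interval of length h. Only a multiple of an
    indicator is actually integrated, so g may be any function. *)
Lemma leb2_strip_le (B : set pt) (a b h : R) (g : R -> R) : a <= b -> 0 <= h ->
  (forall z, B z -> a <= z.1 <= b /\ g z.1 <= z.2 <= g z.1 + h) ->
  (leb2 B <= ((b - a) * h)%:E)%E.
Proof.
move=> ab h0 BP.
rewrite /leb2 /product_measure1.
have -> : ((b - a) * h)%:E =
    (\int[mu]_x (h * \1_(`[a, b]%classic : set R) x)%:E)%E.
  under eq_integral do rewrite EFinM.
  rewrite ge0_integralZl//=; last first.
    by apply/measurable_EFinP; exact: measurable_indic.
  rewrite integral_indic// setIT/= lebesgue_measure_itv/= lte_fin.
  case: ltP => [_|ba]; first by rewrite -EFinD -EFinM mulrC.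
  by rewrite mule0 (_ : b - a = 0) ?mul0r//; lra.
rewrite !ge0_integralTE; last 2 first.
- by move=> x; rewrite lee_fin mulr_ge0.
- by move=> x; exact: measure_ge0.
apply: le_ereal_sup => _ [k kB <-]; exists k => // x.
apply: le_trans (kB x) _; rewrite /= indicE.
case: (boolP (x \in _)) => [|].
  rewrite inE /= in_itv/= => xab.
  apply: (@le_trans _ _ (mu `[g x, g x + h]%classic)).
    apply: lebesgue_measure_mono => y; rewrite /xsection /= inE => Bxy.
    by rewrite in_itv/=; case: (BP _ Bxy).
  rewrite mulr1 lebesgue_measure_itv/= lte_fin.
  case: ltP => _; last by rewrite lee_fin.
  by rewrite -EFinD lee_fin; lra.
rewrite notin_setE /= in_itv/= => xab.
rewrite (_ : xsection B x = set0) ?measure0 ?mulr0//.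
apply/seteqP; split=> // y; rewrite /xsection /= inE => Bxy.
by case: (BP _ Bxy).
Qed.

Lemma leb2_strip_ge (B : set pt) (a b h : R) (g : R -> R) : a <= b -> 0 <= h ->
  (forall x y, a < x < b -> g x < y < g x + h -> B (x, y)) ->
  (((b - a) * h)%:E <= leb2 B)%E.
Proof.
move=> ab h0 BP.
rewrite /leb2 /product_measure1.
have -> : ((b - a) * h)%:E =
    (\int[mu]_x (h * \1_(`]a, b[%classic : set R) x)%:E)%E.
  under eq_integral do rewrite EFinM.
  rewrite ge0_integralZl//=; last first.
    by apply/measurable_EFinP; exact: measurable_indic.
  rewrite integral_indic// setIT/= lebesgue_measure_itv/= lte_fin.
  case: ltP => [_|ba]; first by rewrite -EFinD -EFinM mulrC.
  by rewrite mule0 (_ : b - a = 0) ?mul0r//; lra.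
rewrite !ge0_integralTE; last 2 first.
- by move=> x; exact: measure_ge0.
- by move=> x; rewrite lee_fin mulr_ge0.
apply: le_ereal_sup => _ [k kB <-]; exists k => // x.
apply: le_trans (kB x) _; rewrite /= indicE.
case: (boolP (x \in _)) => [|]; last by rewrite mulr0 measure_ge0.
rewrite inE /= in_itv/= => xab.
apply: (@le_trans _ _ (mu `]g x, g x + h[%classic)).
  rewrite mulr1 lebesgue_measure_itv/= lte_fin.
  case: ltP => [_|hx]; first by rewrite -EFinD lee_fin; lra.
  by rewrite lee_fin; lra.
apply: lebesgue_measure_mono => y /=; rewrite in_itv/= => yg.
by rewrite /xsection /= inE; exact: BP.
Qed.

Definition tri_det (p q r : pt) : R := det2 (psub q p) (psub r p).

Definition bary (p q r : pt) (a b c : R) : pt :=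
  padd (padd (pscale a p) (pscale b q)) (pscale c r).

Definition otri (p q r : pt) : set pt :=
  [set z | exists a b c : R, 0 < a /\ 0 < b /\ 0 < c /\ a + b + c = 1 /\
     z = bary p q r a b c].

Definition ctri (p q r : pt) : set pt :=
  [set z | exists a b c : R, 0 <= a /\ 0 <= b /\ 0 <= c /\ a + b + c = 1 /\
     z = bary p q r a b c].

Lemma otri_rot p q r : otri p q r = otri q r p.
Proof.
apply/seteqP; split => z [a [b [c [a0 [b0 [c0 [s ->]]]]]]].
  exists b, c, a; do !split => //; first lra.
  by rewrite /bary/padd/pscale/=; congr pair; ring.
exists c, a, b; do !split => //; first lra.
by rewrite /bary/padd/pscale/=; congr pair; ring.
Qed.

Lemma otri_swap p q r : otri p q r = otri q p r.
Proof.
apply/seteqP; split => z [a [b [c [a0 [b0 [c0 [s ->]]]]]]].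
  exists b, a, c; do !split => //; first lra.
  by rewrite /bary/padd/pscale/=; congr pair; ring.
exists b, a, c; do !split => //; first lra.
by rewrite /bary/padd/pscale/=; congr pair; ring.
Qed.

Lemma ctri_rot p q r : ctri p q r = ctri q r p.
Proof.
apply/seteqP; split => z [a [b [c [a0 [b0 [c0 [s ->]]]]]]].
  exists b, c, a; do !split => //; first lra.
  by rewrite /bary/padd/pscale/=; congr pair; ring.
exists c, a, b; do !split => //; first lra.
by rewrite /bary/padd/pscale/=; congr pair; ring.
Qed.

Lemma ctri_swap p q r : ctri p q r = ctri q p r.
Proof.
apply/seteqP; split => z [a [b [c [a0 [b0 [c0 [s ->]]]]]]].
  exists b, a, c; do !split => //; first lra.
  by rewrite /bary/padd/pscale/=; congr pair; ring.
exists b, a, c; do !split => //; first lra.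
by rewrite /bary/padd/pscale/=; congr pair; ring.
Qed.

Lemma tri_det_rot p q r : tri_det p q r = tri_det q r p.
Proof. by rewrite /tri_det /det2 /psub /=; ring. Qed.

Lemma tri_det_swap p q r : tri_det q p r = - tri_det p q r.
Proof. by rewrite /tri_det /det2 /psub /=; ring. Qed.

(* In the direction of its widest side, a triangle is a strip of height
   |det| / width, and it contains a strip of half that width and height. *)
Lemma sorted_triangle_measure (p q r : pt) : p.1 <= q.1 <= r.1 ->
  ((`|tri_det p q r| / 4)%:E <= leb2 (otri p q r))%E /\
  (leb2 (ctri p q r) <= `|tri_det p q r|%:E)%E.
Proof.
move=> /andP[pq qr].
case: (eqVneq p.1 r.1) => [pr|pr].
  have -> : tri_det p q r = 0.
    rewrite /tri_det /det2 /psub /= -pr (_ : q.1 = p.1); last by lra.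
    by ring.
  rewrite normr0 mul0r; split; first exact: leb2_ge0.
  pose m := Num.min p.2 (Num.min q.2 r.2).
  pose M := Num.max p.2 (Num.max q.2 r.2).
  have mp : m <= p.2 by rewrite /m ge_min lexx.
  have mq : m <= q.2 by rewrite /m !ge_min lexx orbT.
  have mr : m <= r.2 by rewrite /m !ge_min lexx !orbT.
  have Mp : p.2 <= M by rewrite /M le_max lexx.
  have Mq : q.2 <= M by rewrite /M !le_max lexx orbT.
  have Mr : r.2 <= M by rewrite /M !le_max lexx !orbT.
  have -> : 0%:E = ((p.1 - p.1) * (M - m))%:E by rewrite subrr mul0r.
  apply: (@leb2_strip_le _ _ _ _ (fun=> m)); [lra|lra|].
  move=> z [a [b [c [a0 [b0 [c0 [s ->]]]]]]].
  rewrite /bary/padd/pscale/=.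
  have -> : q.1 = p.1 by lra.
  rewrite -pr -!mulrDl s.
  split; first by lra.
  have -> : m + (M - m) = M by lra.
  have ea : a = 1 - b - c by lra.
  by apply/andP; split; nra.
have X0 : 0 < r.1 - p.1 by lra.
set X := r.1 - p.1 in X0.
set D := tri_det p q r.
pose g x := p.2 + (x - p.1) * (r.2 - p.2) / X.
have DE : D = (q.1 - p.1) * (r.2 - p.2) - (q.2 - p.2) * X by [].
(* [g] is the chord from p to r; the middle vertex lies at signed vertical distance [D / X] below
   it. *)
have q2E : q.2 = g q.1 - D / X.
  by rewrite /g DE; field; rewrite gt_eqF.
have gX : g r.1 = r.2 by rewrite /g /X; field; rewrite gt_eqF.
pose sg := (q.1 - p.1) / X.
have sg0 : 0 <= sg by rewrite divr_ge0 //; lra.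
have sg1 : sg <= 1 by rewrite ler_pdivrMr // /X; lra.
have q1E : q.1 = p.1 + sg * X by rewrite /sg; field; rewrite gt_eqF.
have gE s : g (p.1 + s * X) = p.2 + s * (r.2 - p.2).
  by rewrite /g; field; rewrite gt_eqF.
pose H := D / X.
have absH : `|H| = `|D| / X by rewrite /H normrM normfV (gtr0_norm X0).
split.
  (* For s between sg/2 and (1+sg)/2 both s/sg and (1-s)/(1-sg) exceed 1/2, so over this half of the
     width the vertical section is longer than |H|/2. *)
  have -> : `|D| / 4 = ((p.1 + (1 + sg) / 2 * X) - (p.1 + sg / 2 * X)) * (`|H| / 2).
    by rewrite absH; field; rewrite gt_eqF.
  apply: (@leb2_strip_ge _ _ _ _ (fun x => g x + Num.min 0 (- H / 2))).
  - by nra.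
  - by rewrite divr_ge0.
  move=> x y xI yI.
  pose s := (x - p.1) / X.
  have xE : x = p.1 + s * X by rewrite /s; field; rewrite gt_eqF.
  have s1 : sg / 2 < s by rewrite /s ltr_pdivlMr //; lra.
  have s2 : s < (1 + sg) / 2 by rewrite /s ltr_pdivrMr //; lra.
  have [b [b0 b1 yE]] : exists b, [/\ 0 < b, b < 1/2 & y = g x - b * H].
    move: yI; have [H0|H0] := leP 0 H.
      rewrite ger0_norm // min_r; last by lra.
      have [->|Hn0] := eqVneq H 0; first by lra.
      move=> yI; exists ((g x - y) / H); split.
      - by rewrite ltr_pdivlMr; lra.
      - by rewrite ltr_pdivrMr; lra.
      - by field.
    rewrite ltr0_norm // min_l; last by lra.
    move=> yI; exists ((y - g x) / - H); split.
    - by rewrite ltr_pdivlMr; lra.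
    - by rewrite ltr_pdivrMr; lra.
    - by field; rewrite lt_eqF.
  exists (1 - s - b * (1 - sg)), b, (s - b * sg).
  do !split => //; [nra|nra|lra|].
  rewrite /bary/padd/pscale/=; congr pair.
    by rewrite xE q1E /X; ring.
  by rewrite yE q2E xE q1E !gE -/H; ring.
have -> : `|D| = (r.1 - p.1) * `|H|.
  by rewrite absH -/X; field; rewrite gt_eqF.
apply: (@leb2_strip_le _ _ _ _ (fun x => g x + Num.min 0 (- H))) => //; first lra.
move=> z [a [b [c [a0 [b0 [c0 [s ->]]]]]]].
have aE : a = 1 - b - c by lra.
have -> : (bary p q r a b c).1 = p.1 + (b * sg + c) * X.
  by rewrite /bary/padd/pscale/= q1E aE /X; ring.
have -> : (bary p q r a b c).2 = g (p.1 + (b * sg + c) * X) - b * H.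
  by rewrite /bary/padd/pscale/= q2E q1E !gE aE -/H; ring.
have bs : b * sg <= b by rewrite ler_piMr.
have bs0 : 0 <= b * sg by rewrite mulr_ge0.
split.
  have -> : r.1 = p.1 + 1 * X by rewrite /X; ring.
  rewrite lerDl lerD2l ler_pM2r // mulr_ge0 ?(ltW X0) ?addr_ge0 //=.
  by lra.
have [H0|H0] := leP 0 H.
  rewrite ger0_norm // min_r; last by lra.
  by apply/andP; split; nra.
rewrite ltr0_norm // min_l; last by lra.
by apply/andP; split; nra.
Qed.

(** Sorting the vertices by abscissa changes neither the triangle nor |det|. The true area is
    |det|/2; each side loses a factor 2, absorbed in the final constant. *)
Lemma triangle_measure (p q r : pt) :
  ((`|tri_det p q r| / 4)%:E <= leb2 (otri p q r))%E /\
  (leb2 (ctri p q r) <= `|tri_det p q r|%:E)%E.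
Proof.
have [pq|qp] := leP p.1 q.1; have [qr|rq] := leP q.1 r.1;
  have [pr|rp] := leP p.1 r.1; try by exfalso; lra.
- by apply: sorted_triangle_measure; lra.
- have := @sorted_triangle_measure p r q.
  rewrite otri_rot ctri_rot tri_det_rot otri_swap ctri_swap tri_det_swap normrN.
  rewrite -otri_rot -ctri_rot -tri_det_rot.
  by apply; lra.
- have := @sorted_triangle_measure r p q.
  by rewrite otri_rot ctri_rot tri_det_rot; apply; lra.
- have := @sorted_triangle_measure q p r.
  by rewrite otri_swap ctri_swap tri_det_swap normrN; apply; lra.
- have := @sorted_triangle_measure q r p.
  by rewrite -otri_rot -ctri_rot -tri_det_rot; apply; lra.
- have := @sorted_triangle_measure r q p.
  rewrite otri_swap ctri_swap tri_det_swap normrN.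
  by rewrite -otri_rot -ctri_rot -tri_det_rot; apply; lra.
Qed.

End PlaneMeasure.

(** * Measure under homotheties, and measurability of open triangles *)

Section AffineInvariance.
Variable R : realType.
Local Notation pt := (pt R).
Local Notation mu := (@lebesgue_measure R).

Definition homothety1 (k u : R) (x : measurableTypeR R) : measurableTypeR R :=
  k * x + u.

Lemma measurable_homothety1 k u : measurable_fun setT (homothety1 k u).
Proof.
apply: measurable_funD; last exact: measurable_cst.
by apply: measurable_funM => //; exact: measurable_cst.
Qed.

Lemma lebesgue_measure_homothety (k u : R) (A : set R) : 0 < k -> measurable A ->
  mu A = (k%:E * mu (homothety1 k u @^-1` A))%E.
Proof.
move=> k0 mA.
pose m := mscale (NngNum (ltW k0)) (pushforward mu (homothety1 k u)).
rewrite (_ : (k%:E * _)%E = m (measurable_homothety1 k u) A)//.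
apply: lebesgue_measure_unique => // _ [[a b]] _ <-.
rewrite [RHS](_ : _ = (k%:E * mu (`]((a - u) / k)%R, ((b - u) / k)%R]%classic : set R))%E).
  rewrite !lebesgue_measure_itv/= !lte_fin.
  rewrite ltr_pM2r ?invr_gt0 // ltrBDr subrK.
  case: ltP => ab; last by rewrite mule0.
  by rewrite -!EFinD -EFinM; congr EFin; field; rewrite gt_eqF.
congr (_ * mu _)%E; apply/seteqP; split => x; rewrite /= !in_itv/= /homothety1;
  rewrite ltr_pdivrMr // ler_pdivlMr // => /andP[h1 h2]; lra.
Qed.

Definition homothety (k u v : R) (z : measurableTypeR R * measurableTypeR R) :
  measurableTypeR R * measurableTypeR R := (k * z.1 + u, k * z.2 + v).

Lemma measurable_homothety k u v : measurable_fun setT (homothety k u v).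
Proof.
apply/measurable_fun_pairP; split => /=.
- rewrite (_ : _ \o _ = homothety1 k u \o fst) //.
  by apply: measurableT_comp; [exact: measurable_homothety1|exact: measurable_fst].
- rewrite (_ : _ \o _ = homothety1 k v \o snd) //.
  by apply: measurableT_comp; [exact: measurable_homothety1|exact: measurable_snd].
Qed.

(** By uniqueness of the product measure it suffices to check rectangles. It is used with k = 1 for
    lattice translations and with k = 1/2 for averaging with a fixed point. *)
Lemma leb2_homothety (k u v : R) (B : set pt) : 0 < k -> measurable B ->
  leb2 B = ((k ^+ 2)%:E * leb2 (homothety k u v @^-1` B))%E.
Proof.
move=> k0 mB.
have k20 : 0 <= k ^+ 2 by rewrite exprn_ge0 // ltW.
pose m := mscale (NngNum k20)
  (pushforward (mu \x mu)%E (homothety k u v)).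
rewrite (_ : ((k ^+ 2)%:E * _)%E = m (measurable_homothety k u v) B)//.
apply: product_measure_unique => // X Y mX mY.
transitivity ((k ^+ 2)%:E *
  (mu \x mu) ((homothety1 k u @^-1` X) `*` (homothety1 k v @^-1` Y)))%E => //.
rewrite [X in (_ * X)%E = _]product_measure1E; last 2 first.
- by rewrite -[X in measurable X]setTI; exact: measurable_homothety1.
- by rewrite -[X in measurable X]setTI; exact: measurable_homothety1.
rewrite /= (lebesgue_measure_homothety u k0 mX) (lebesgue_measure_homothety v k0 mY).
by rewrite expr2 EFinM muleACA.
Qed.

Lemma measurable_homothety_preimage k u v (B : set pt) :
  measurable B -> measurable (homothety k u v @^-1` B : set pt).
Proof.
by move=> mB; rewrite -[X in measurable X]setTI; exact: measurable_homothety.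
Qed.

Lemma measurable_halfplane (a b c : R) :
  measurable [set z : pt | 0 < a * z.1 + b * z.2 + c].
Proof.
have mf : measurable_fun setT (fun z : pt => a * z.1 + b * z.2 + c).
  apply: measurable_funD; last exact: measurable_cst.
  apply: measurable_funD; apply: measurable_funM;
    try exact: measurable_cst; try exact: measurable_fst; exact: measurable_snd.
rewrite (_ : [set z : pt | _] = setT `&` (fun z : pt => a * z.1 + b * z.2 + c)
     @^-1` `]0, +oo[%classic); first by apply: mf => //; exact: measurable_itv.
by apply/seteqP; split => z; rewrite /= ?in_itv/= andbT; [split|case].
Qed.

Lemma measurable_vstrip (a b : R) : measurable [set z : pt | a <= z.1 < b].
Proof.
rewrite (_ : [set z : pt | _] = `[a, b[%classic `*` setT).
  exact: measurableX.
by apply/seteqP; split => z; rewrite /= in_itv/=; [split|case].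
Qed.

Lemma measurable_hstrip (a b : R) : measurable [set z : pt | a <= z.2 < b].
Proof.
rewrite (_ : [set z : pt | _] = setT `*` `[a, b[%classic).
  exact: measurableX.
by apply/seteqP; split => z; rewrite /= in_itv/=; [split|case].
Qed.

(** Cramer's rule: the barycentric coordinates are quotients of determinants. An open nondegenerate
    triangle thus becomes an intersection of three open half-planes. *)
Lemma otriP (p q r z : pt) : tri_det p q r != 0 ->
  otri p q r z <-> [/\ 0 < tri_det z q r / tri_det p q r,
     0 < tri_det p z r / tri_det p q r & 0 < tri_det p q z / tri_det p q r].
Proof.
move=> D0; split.
  move=> [a [b [c [a0 [b0 [c0 [s ->]]]]]]].
  have aE : a = 1 - b - c by lra.
  have -> : tri_det (bary p q r a b c) q r = a * tri_det p q r.
    by rewrite aE /tri_det/bary/det2/psub/padd/pscale/=; ring.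
  have -> : tri_det p (bary p q r a b c) r = b * tri_det p q r.
    by rewrite aE /tri_det/bary/det2/psub/padd/pscale/=; ring.
  have -> : tri_det p q (bary p q r a b c) = c * tri_det p q r.
    by rewrite aE /tri_det/bary/det2/psub/padd/pscale/=; ring.
  by rewrite !mulfK.
move=> [a0 b0 c0].
exists (tri_det z q r / tri_det p q r), (tri_det p z r / tri_det p q r),
  (tri_det p q z / tri_det p q r).
do !split => //.
  rewrite -!mulrDl (_ : _ + _ = tri_det p q r) ?mulfV //.
  by rewrite /tri_det/det2/psub/=; ring.
rewrite /bary/padd/pscale/=; case: z {a0 b0 c0} => z1 z2 /=.
move: D0; rewrite /tri_det/det2/psub/= => D0.
by congr pair; field.
Qed.

Lemma measurable_otri (p q r : pt) : tri_det p q r != 0 -> measurable (otri p q r).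
Proof.
move=> D0; set D := tri_det p q r in D0.
have hp (f : pt -> R) : (exists a b c : R, forall z,
    f z = a * z.1 + b * z.2 + c) -> measurable [set z : pt | 0 < f z].
  move=> [a' [b' [c' fE]]]; under eq_set do rewrite fE.
  exact: measurable_halfplane.
have -> : otri p q r = [set z | 0 < tri_det z q r / D] `&`
    [set z | 0 < tri_det p z r / D] `&` [set z | 0 < tri_det p q z / D].
  by apply/seteqP; split => z; [case/(otriP z D0)|
    case=> -[? ? ?]; apply/(otriP z D0)].
apply: measurableI; [apply: measurableI|]; apply: hp => //.
- exists ((q.2 - r.2) / D), ((r.1 - q.1) / D), ((q.1 * r.2 - q.2 * r.1) / D).
  by move=> z; rewrite /tri_det/det2/psub/=; field.
- exists ((r.2 - p.2) / D), ((p.1 - r.1) / D), ((r.1 * p.2 - r.2 * p.1) / D).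
  by move=> z; rewrite /tri_det/det2/psub/=; field.
- exists ((p.2 - q.2) / D), ((q.1 - p.1) / D), ((p.1 * q.2 - p.2 * q.1) / D).
  by move=> z; rewrite /tri_det/det2/psub/=; field.
Qed.

End AffineInvariance.

(** * Lifts, geodesic distance and areas on the torus *)

Section Torus.
Variable R : realType.
Local Notation pt := (pt R).

Lemma tred1_bnd (a : R) : - 2^-1 <= tred1 a < 2^-1.
Proof.
rewrite /tred1; have := floor_itv (a + 2^-1).
by rewrite intrD => /andP[h1 h2]; apply/andP; split; lra.
Qed.

Lemma tred1E (a : R) : exists k : int, tred1 a = a + k%:~R.
Proof. by exists (- Num.floor (a + 2^-1)); rewrite /tred1 mulrNz. Qed.

Lemma int_small_eq0 (k : int) : `|k%:~R : R| < 1 -> k = 0.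
Proof.
rewrite -intr_norm (_ : 1 = 1%:~R) // ltr_int => h.
by apply/eqP; rewrite -normr_eq0; lia.
Qed.

Lemma tred1_eq (a b : R) (k : int) :
  - 2^-1 <= b < 2^-1 -> b = a + k%:~R -> tred1 a = b.
Proof.
move=> bI bE; have [m mE] := tred1E a; have aI := tred1_bnd a.
have : m - k = 0.
  by apply: int_small_eq0; rewrite intrB ltr_norml; apply/andP; split; lra.
by move=> /subr0_eq mk; rewrite mE bE mk.
Qed.

Lemma tred1_id (a : R) : - 2^-1 <= a < 2^-1 -> tred1 a = a.
Proof. by move=> aI; apply: (@tred1_eq _ _ 0) => //; rewrite addr0. Qed.

Lemma tred1DZ (a : R) (k : int) : tred1 (a + k%:~R) = tred1 a.
Proof.
have [m mE] := tred1E a.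
apply: (@tred1_eq _ _ (m - k)); first exact: tred1_bnd.
by rewrite mE intrB; ring.
Qed.

Lemma norm_tred1_le (a : R) : `|tred1 a| <= `|a|.
Proof.
have h := tred1_bnd a.
have [a2|a2] := ltP `|a| 2^-1.
  rewrite tred1_id //; apply/andP.
  by move: a2; rewrite ltr_norml => /andP[? ?]; split; lra.
by apply: le_trans a2; rewrite ler_norml; lra.
Qed.

Lemma norm_tred1_small (a : R) : `|a| <= 2^-1 -> `|tred1 a| = `|a|.
Proof.
move=> ha; have [a2|a2] := eqVneq a 2^-1.
  (* The endpoint 1/2 is represented by -1/2, which has the same absolute value. *)
  rewrite (_ : tred1 a = - a) ?normrN //.
  by apply: (@tred1_eq _ _ (-1)); rewrite ?a2 ?mulrN1z; lra.
rewrite tred1_id //.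
by move: ha; rewrite ler_norml => /andP[? ?]; apply/andP; split; lra.
Qed.

Lemma norm_tred1N (a : R) : `|tred1 (- a)| = `|tred1 a|.
Proof.
have [k kE] := tred1E a.
have -> : - a = - tred1 a + k%:~R by rewrite kE; ring.
rewrite tred1DZ norm_tred1_small ?normrN //.
by have := tred1_bnd a; rewrite ler_norml; lra.
Qed.

Lemma tredE (p : pt) : exists k1 k2 : int,
  tred p = padd p (k1%:~R, k2%:~R).
Proof.
have [k1 E1] := tred1E p.1; have [k2 E2] := tred1E p.2.
by exists k1, k2; rewrite /tred /padd /= E1 E2.
Qed.

Lemma tred_in_T (p : pt) : in_T (tred p).
Proof. by split; exact: tred1_bnd. Qed.

Lemma tred_id (p : pt) : in_T p -> tred p = p.
Proof. by case: p => ? ? [? ?]; rewrite /tred /= !tred1_id. Qed.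

Lemma tredDZ (p : pt) (k1 k2 : int) :
  tred (padd p (k1%:~R, k2%:~R)) = tred p.
Proof. by rewrite /tred /padd /= !tred1DZ. Qed.

Lemma tred_addl (p q : pt) : tred (padd (tred p) q) = tred (padd p q).
Proof.
have [k1 [k2 ->]] := tredE p.
by rewrite -(tredDZ (padd p q) k1 k2); congr tred; rewrite /padd /=; congr pair; ring.
Qed.

Lemma tred_sub (p q : pt) : tred (psub (tred p) (tred q)) = tred (psub p q).
Proof.
have [k1 [k2 ->]] := tredE p; have [m1 [m2 ->]] := tredE q.
rewrite -(tredDZ (psub p q) (k1 - m1) (k2 - m2)); congr tred.
by rewrite /padd /psub /= !intrB; congr pair; ring.
Qed.

Lemma enorm_ge0 (p : pt) : 0 <= enorm p. Proof. exact: sqrtr_ge0. Qed.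

Lemma enorm_sqr (p : pt) : enorm p ^+ 2 = p.1 ^+ 2 + p.2 ^+ 2.
Proof. by rewrite sqr_sqrtr // addr_ge0 // sqr_ge0. Qed.

Lemma enorm_le (p : pt) (c : R) : 0 <= c ->
  (enorm p <= c) = (p.1 ^+ 2 + p.2 ^+ 2 <= c ^+ 2).
Proof. by move=> c0; rewrite -enorm_sqr ler_pXn2r // nnegrE ?enorm_ge0. Qed.

Lemma enormE (p : pt) (c : R) : 0 <= c -> p.1 ^+ 2 + p.2 ^+ 2 = c ^+ 2 ->
  enorm p = c.
Proof. by move=> c0; rewrite /enorm => ->; rewrite sqrtr_sqr ger0_norm. Qed.

Lemma enorm_mono (p q : pt) : `|p.1| <= `|q.1| -> `|p.2| <= `|q.2| ->
  enorm p <= enorm q.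
Proof.
move=> h1 h2; rewrite enorm_le ?enorm_ge0 // enorm_sqr.
by apply: lerD; rewrite -[leLHS]real_normK ?num_real // -[leRHS]real_normK ?num_real //;
  rewrite ler_pXn2r ?nnegrE.
Qed.

Lemma enorm_coord1 (p : pt) : `|p.1| <= enorm p.
Proof.
rewrite -[leLHS]ger0_norm // -sqrtr_sqr real_normK ?num_real //.
by rewrite ler_wsqrtr // lerDl sqr_ge0.
Qed.

Lemma enorm_coord2 (p : pt) : `|p.2| <= enorm p.
Proof.
rewrite -[leLHS]ger0_norm // -sqrtr_sqr real_normK ?num_real //.
by rewrite ler_wsqrtr // lerDr sqr_ge0.
Qed.

Lemma enorm_scale (c : R) (p : pt) : enorm (pscale c p) = `|c| * enorm p.
Proof.
apply: enormE; first by rewrite mulr_ge0 ?enorm_ge0.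
by rewrite [RHS]exprMn enorm_sqr real_normK ?num_real // /pscale /=; ring.
Qed.

Lemma enorm_add (p q : pt) : enorm (padd p q) <= enorm p + enorm q.
Proof.
have p0 := enorm_ge0 p; have q0 := enorm_ge0 q.
rewrite enorm_le ?addr_ge0 // [leRHS]sqrrD !enorm_sqr /padd /=.
have : p.1 * q.1 + p.2 * q.2 <= enorm p * enorm q.
  apply: le_trans (ler_norm _) _.
  rewrite -(@ler_pXn2r _ 2) ?nnegrE ?mulr_ge0 // [leRHS]exprMn !enorm_sqr.
  rewrite real_normK ?num_real //.
  have := sqr_ge0 (p.1 * q.2 - p.2 * q.1); nra.
nra.
Qed.

Lemma enorm_sub_sym (p q : pt) : enorm (psub p q) = enorm (psub q p).
Proof. by rewrite /enorm /psub /=; congr Num.sqrt; ring. Qed.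

Lemma enorm_opp (p : pt) : enorm (pscale (-1) p) = enorm p.
Proof. by rewrite enorm_scale normrN1 mul1r. Qed.

Lemma enorm_triangle (p q r : pt) :
  enorm (psub p r) <= enorm (psub p q) + enorm (psub q r).
Proof.
apply: le_trans (enorm_add _ _); rewrite le_eqVlt; apply/orP; left; apply/eqP.
by congr enorm; rewrite /psub /padd /=; congr pair; ring.
Qed.

Lemma enorm_eq0 (p : pt) : enorm p = 0 -> p = (0, 0).
Proof.
move=> p0; have := enorm_coord1 p; have := enorm_coord2 p; rewrite p0 !normr_le0.
by case: p {p0} => p1 p2 /= /eqP-> /eqP->.
Qed.

Lemma enorm0 : enorm ((0, 0) : pt) = 0.
Proof. by rewrite /enorm /= expr0n addr0 sqrtr0. Qed.

Lemma tdist_tred_le (p q : pt) : tdist (tred p) (tred q) <= enorm (psub p q).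
Proof.
by rewrite /tdist tred_sub; apply: enorm_mono; exact: norm_tred1_le.
Qed.

Lemma tdist_tred_small (p q : pt) :
  `|p.1 - q.1| <= 2^-1 -> `|p.2 - q.2| <= 2^-1 ->
  tdist (tred p) (tred q) = enorm (psub p q).
Proof.
move=> h1 h2; rewrite /tdist tred_sub; apply/eqP; rewrite eq_le.
by rewrite !enorm_mono ?norm_tred1_small.
Qed.

(** Projection of a plane set to the torus, written in the shape of [tri_interior] so that
    [tri_interiorE] holds by conversion. *)
Definition tproj (Z : set pt) : set pt :=
  [set y | in_T y /\ exists k1 k2 : int, Z (y.1 + k1%:~R, y.2 + k2%:~R)].

Lemma tri_interiorE (l1 l2 l3 : seg R) : tri_interior l1 l2 l3 =
  tproj (otri l1.1 (padd l1.1 l1.2) (padd (padd l1.1 l1.2) l2.2)).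
Proof. by []. Qed.

Lemma leb2_cover3 (A B1 B2 B3 : set pt) (c : R) :
  measurable B1 -> measurable B2 -> measurable B3 ->
  A `<=` B1 `|` B2 `|` B3 ->
  (leb2 B1 <= c%:E)%E -> (leb2 B2 <= c%:E)%E -> (leb2 B3 <= c%:E)%E ->
  (leb2 A <= (3 * c)%:E)%E.
Proof.
move=> m1 m2 m3 AB h1 h2 h3.
apply: (le_trans (leb2_mono AB)).
apply: (@le_trans _ _ (leb2 (B1 `|` B2) + leb2 B3)%E).
  by apply: measureU2 => //; exact: measurableU.
apply: (@le_trans _ _ (leb2 B1 + leb2 B2 + leb2 B3)%E).
  by apply: leeD => //; exact: measureU2.
rewrite (_ : (3 * c)%:E = (c%:E + c%:E + c%:E)%E).
  by apply: leeD => //; exact: leeD.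
by rewrite -!EFinD; congr EFin; ring.
Qed.

Lemma leb2_shift (u v : R) (B : set pt) : measurable B ->
  leb2 (homothety 1 u v @^-1` B) = leb2 B.
Proof.
move=> mB; rewrite (@leb2_homothety _ 1 u v B) //.
by rewrite expr1n mul1e.
Qed.

(** With the bound 3/2 only the lattice translates by -1, 0, 1 in each coordinate are relevant,
    which gives the factor 9 = 3 * 3 below. *)
Definition in_box (Z : set pt) : Prop :=
  forall z, Z z -> `|z.1| < 3 / 2 /\ `|z.2| < 3 / 2.

Lemma leb2_T_le1 : (leb2 (@in_T R : set pt) <= 1)%E.
Proof.
have -> : 1%E = ((2^-1 - (- 2^-1)) * 1 : R)%:E by congr EFin; lra.
apply: (@leb2_strip_le _ _ _ _ _ (fun=> - 2^-1)); [lra|lra|].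
by move=> z [h1 h2]; split; lra.
Qed.

Lemma leb2_tproj_le1 (Z : set pt) : (leb2 (tproj Z) <= 1)%E.
Proof. by apply: le_trans leb2_T_le1; apply: leb2_mono => z []. Qed.

(** The part of Z in each of nine unit cells, translated to the fundamental square, lies in the
    projection and hence has measure at most c. *)
Lemma leb2_le_tproj (Z : set pt) (c : R) : measurable Z -> in_box Z ->
  (leb2 (tproj Z) <= c%:E)%E -> (leb2 Z <= (9 * c)%:E)%E.
Proof.
move=> mZ bZ cZ.
pose V (i : R) := [set z : pt | i - 2^-1 <= z.1 < i + 2^-1].
pose H (i : R) := [set z : pt | i - 2^-1 <= z.2 < i + 2^-1].
have mV i : measurable (V i) by exact: measurable_vstrip.
have mH i : measurable (H i) by exact: measurable_hstrip.
have cell (i j : int) : (leb2 (Z `&` V i%:~R `&` H j%:~R) <= c%:E)%E.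
  rewrite -(leb2_shift i%:~R j%:~R); last by do 2 apply: measurableI => //.
  apply: le_trans cZ; apply: leb2_mono => z [[] /=].
  rewrite /V /H /= !mul1r => Zz h1 h2; split; first by split; lra.
  by exists i, j; move: Zz; rewrite /homothety !mul1r.
have -> : 9 * c = 3 * (3 * c) by ring.
have three (x : R) : `|x| < 3 / 2 -> [\/ (-1) - 2^-1 <= x < -1 + 2^-1,
    0 - 2^-1 <= x < 0 + 2^-1 | 1 - 2^-1 <= x < 1 + 2^-1].
  rewrite ltr_norml => /andP[x1 x2].
  have [h|h] := ltP x (- 2^-1); first by apply: Or31; lra.
  by have [h'|h'] := ltP x (2^-1); [apply: Or32; lra|apply: Or33; lra].
have row (i : int) : (leb2 (Z `&` V i%:~R) <= (3 * c)%:E)%E.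
  apply: (@leb2_cover3 _ (Z `&` V i%:~R `&` H (-1)%:~R)
    (Z `&` V i%:~R `&` H 0%:~R) (Z `&` V i%:~R `&` H 1%:~R)) => //;
    try by do 2 apply: measurableI => //.
  move=> z [Zz Vz]; have [_ /three] := bZ _ Zz.
  by case=> h; [left; left|left; right|right].
apply: (@leb2_cover3 _ (Z `&` V (-1)%:~R) (Z `&` V 0%:~R) (Z `&` V 1%:~R)) => //;
  try by apply: measurableI => //.
move=> z Zz; have [/three + _] := bZ _ Zz.
by case=> h; [left; left|left; right|right].
Qed.

(** Conversely, the projection is covered by nine translates of Z. *)
Lemma tproj_leb2_le (Z : set pt) (c : R) : measurable Z -> in_box Z ->
  (leb2 Z <= c%:E)%E -> (leb2 (tproj Z) <= (9 * c)%:E)%E.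
Proof.
move=> mZ bZ cZ.
pose S (i j : R) := homothety 1 i j @^-1` Z : set pt.
have mS i j : measurable (S i j) by exact: measurable_homothety_preimage.
have cS i j : (leb2 (S i j) <= c%:E)%E by rewrite leb2_shift.
have -> : 9 * c = 3 * (3 * c) by ring.
have three (x : R) (k : int) : - 2^-1 <= x < 2^-1 -> `|x + k%:~R| < 3 / 2 ->
    [\/ k = -1, k = 0 | k = 1].
  rewrite ltr_norml => xI /andP[h1 h2].
  have : -2 < (k%:~R : R) < 2 by lra.
  rewrite (_ : -2 = (- Posz 2)%:~R) // (_ : 2 = (Posz 2)%:~R) // !ltr_int => /andP[].
  move=> ? ?; have [->|[->|->]] : k = -1 \/ k = 0 \/ k = 1 by lia.
  - exact: Or31.
  - exact: Or32.
  - exact: Or33.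
pose U i := S i (-1)%:~R `|` S i 0%:~R `|` S i 1%:~R.
have mU i : measurable (U i) by do 2 apply: measurableU => //.
have cU i : (leb2 (U i) <= (3 * c)%:E)%E.
  by apply: (@leb2_cover3 _ (S i (-1)%:~R) (S i 0%:~R) (S i 1%:~R)).
apply: (@leb2_cover3 _ (U (-1)%:~R) (U 0%:~R) (U 1%:~R)) => //.
move=> y [[y1 y2] [k1 [k2 Zy]]].
have [/= b1 b2] := bZ _ Zy.
have UZ : U k1%:~R y.
  have SZ : S k1%:~R k2%:~R y by rewrite /S /homothety /= !mul1r.
  by case: (three _ _ y2 b2) => e; rewrite e in SZ; [left; left|left; right|right].
by case: (three _ _ y1 b1) => e; rewrite e in UZ; [left; left|left; right|right].
Qed.

End Torus.

(** * Powers with exponent in [0,1] *)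

Section Powers.
Variable R : realType.
Implicit Types x y c e : R.

Lemma powR_le e x y : 0 <= e -> 0 <= x -> x <= y -> x `^ e <= y `^ e.
Proof.
by move=> e0 x0 xy; apply: ge0_ler_powR; rewrite ?nnegrE // (le_trans x0).
Qed.

(** Since c^e <= c for c >= 1, the constant does not depend on e; all uniformity in al comes from
    here. *)
Lemma powR_le_scale e c x y : 0 <= e <= 1 -> 1 <= c -> 0 <= x -> 0 <= y ->
  x <= c * y -> x `^ e <= c * y `^ e.
Proof.
move=> /andP[e0 e1] c1 x0 y0 xcy.
apply: le_trans (powR_le e0 x0 xcy) _.
rewrite powRM //; last by apply: le_trans c1.
by rewrite ler_wpM2r ?powR_ge0 // ler1_powR.
Qed.

Lemma powR_half e x : 0 <= x -> x `^ (e / 2) = Num.sqrt x `^ e.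
Proof. by move=> x0; rewrite mulrC powRrM powR12_sqrt. Qed.

Lemma powR_sqr_half e x : 0 <= x -> (x ^+ 2) `^ (e / 2) = x `^ e.
Proof. by move=> x0; rewrite powR_half ?sqr_ge0 // sqrtr_sqr ger0_norm. Qed.

End Powers.

(** * Convex hulls of four points *)

Section Hulls.
Variable R : realType.
Local Notation pt := (pt R).

(** [seg_area] applies [fine], which would turn an infinite measure into 0. The square of half-side
    M contains the hull. *)
Lemma hull4_finite (q1 q2 q3 q4 : pt) : leb2 (hull4 q1 q2 q3 q4) \is a fin_num.
Proof.
rewrite ge0_fin_numE ?leb2_ge0 //.
pose M := `|q1.1| + `|q2.1| + `|q3.1| + `|q4.1|
  + (`|q1.2| + `|q2.2| + `|q3.2| + `|q4.2|).
have M0 : 0 <= M by rewrite /M !addr_ge0.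
apply: (@le_lt_trans _ _ ((M - - M) * (M + M))%:E); last exact: ltry.
apply: (@leb2_strip_le _ _ _ _ _ (fun=> - M)); [lra|lra|].
move=> _ [a [b [c [d [a0 [b0 [c0 [d0 [s ->]]]]]]]]].
have w (x y z t : R) : `|x| <= M -> `|y| <= M -> `|z| <= M -> `|t| <= M ->
    - M <= a * x + b * y + (c * z + d * t) <= M.
  rewrite !ler_norml => /andP[x1 x2] /andP[y1 y2] /andP[z1 z2] /andP[t1 t2].
  have e N : N = a * N + b * N + (c * N + d * N).
    by rewrite -!mulrDl addrA s mul1r.
  apply/andP; split; [rewrite [leLHS](e (- M))|rewrite [leRHS](e M)];
    by rewrite !lerD // ler_wpM2l.
have [h1 h2 h3 h4] : [/\ `|q1.1| <= M, `|q2.1| <= M, `|q3.1| <= M & `|q4.1| <= M].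
  have := normr_ge0 q1.1; have := normr_ge0 q2.1; have := normr_ge0 q3.1.
  have := normr_ge0 q4.1; have := normr_ge0 q1.2; have := normr_ge0 q2.2.
  have := normr_ge0 q3.2; have := normr_ge0 q4.2.
  by rewrite /M; split; lra.
have [k1 k2 k3 k4] : [/\ `|q1.2| <= M, `|q2.2| <= M, `|q3.2| <= M & `|q4.2| <= M].
  have := normr_ge0 q1.1; have := normr_ge0 q2.1; have := normr_ge0 q3.1.
  have := normr_ge0 q4.1; have := normr_ge0 q1.2; have := normr_ge0 q2.2.
  have := normr_ge0 q3.2; have := normr_ge0 q4.2.
  by rewrite /M; split; lra.
have := w _ _ _ _ h1 h2 h3 h4; have := w _ _ _ _ k1 k2 k3 k4.
by rewrite /padd /pscale /=; set X := _ + _; set Y := _ + _; split; lra.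
Qed.

Lemma hull4_convex (q1 q2 q3 q4 u1 u2 u3 : pt) (x y z : R) :
  hull4 q1 q2 q3 q4 u1 -> hull4 q1 q2 q3 q4 u2 -> hull4 q1 q2 q3 q4 u3 ->
  0 <= x -> 0 <= y -> 0 <= z -> x + y + z = 1 ->
  hull4 q1 q2 q3 q4 (bary u1 u2 u3 x y z).
Proof.
move=> [a1 [b1 [c1 [d1 [? [? [? [? [s1 ->]]]]]]]]].
move=> [a2 [b2 [c2 [d2 [? [? [? [? [s2 ->]]]]]]]]].
move=> [a3 [b3 [c3 [d3 [? [? [? [? [s3 ->]]]]]]]]] x0 y0 z0 s.
exists (x * a1 + y * a2 + z * a3), (x * b1 + y * b2 + z * b3),
  (x * c1 + y * c2 + z * c3), (x * d1 + y * d2 + z * d3).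
have pos a b c : 0 <= a -> 0 <= b -> 0 <= c -> 0 <= x * a + y * b + z * c.
  by move=> *; rewrite !addr_ge0 ?mulr_ge0.
split; first exact: pos.
split; first exact: pos.
split; first exact: pos.
split; first exact: pos.
split.
  transitivity (x * (a1 + b1 + c1 + d1) + y * (a2 + b2 + c2 + d2)
    + z * (a3 + b3 + c3 + d3)); first by ring.
  by rewrite s1 s2 s3 !mulr1.
by rewrite /bary/padd/pscale/=; congr pair; ring.
Qed.

Lemma tri_det_le_hull4 (q1 q2 q3 q4 u1 u2 u3 : pt) :
  hull4 q1 q2 q3 q4 u1 -> hull4 q1 q2 q3 q4 u2 -> hull4 q1 q2 q3 q4 u3 ->
  `|tri_det u1 u2 u3| <= 4 * fine (leb2 (hull4 q1 q2 q3 q4)).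
Proof.
move=> h1 h2 h3; rewrite mulrC -ler_pdivrMr // -lee_fin.
rewrite fineK ?hull4_finite //.
apply: le_trans (triangle_measure u1 u2 u3).1 _.
apply: leb2_mono => w [x [y [z [x0 [y0 [z0 [s ->]]]]]]].
by apply: hull4_convex => //; exact: ltW.
Qed.

(** With a repeated vertex the hull is a closed triangle; this is the shape of [seg_area] for two
    segments with the same initial point. *)
Lemma hull4_le_tri_det (p q r : pt) :
  fine (leb2 (hull4 p q r p)) <= `|tri_det p q r|.
Proof.
rewrite -lee_fin fineK ?hull4_finite //.
apply: le_trans (triangle_measure p q r).2; apply: leb2_mono.
move=> _ [a [b [c [d [? [? [? [? [s ->]]]]]]]]].
exists (a + d), b, c; split; first by rewrite addr_ge0.
do 3 split => //; first by lra.
by rewrite /bary/padd/pscale/=; congr pair; ring.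
Qed.

Lemma hull4_vertex (q1 q2 q3 q4 : pt) :
  [/\ hull4 q1 q2 q3 q4 q1, hull4 q1 q2 q3 q4 q2, hull4 q1 q2 q3 q4 q3
    & hull4 q1 q2 q3 q4 q4].
Proof.
split.
- exists 1, 0, 0, 0; do !split => //; [lra|].
  by case: q1 => ? ?; rewrite /padd/pscale/=; congr pair; ring.
- exists 0, 1, 0, 0; do !split => //; [lra|].
  by case: q2 => ? ?; rewrite /padd/pscale/=; congr pair; ring.
- exists 0, 0, 1, 0; do !split => //; [lra|].
  by case: q3 => ? ?; rewrite /padd/pscale/=; congr pair; ring.
- exists 0, 0, 0, 1; do !split => //; [lra|].
  by case: q4 => ? ?; rewrite /padd/pscale/=; congr pair; ring.
Qed.

Definition midpoint (p q : pt) : pt := pscale 2^-1 (padd p q).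

Lemma hull4_midpoint (q1 q2 q3 q4 u v : pt) : hull4 q1 q2 q3 q4 u ->
  hull4 q1 q2 q3 q4 v -> hull4 q1 q2 q3 q4 (midpoint u v).
Proof.
move=> hu hv.
have -> : midpoint u v = bary u v u 2^-1 2^-1 0.
  by rewrite /midpoint/bary/padd/pscale/=; congr pair; ring.
by apply: hull4_convex => //; lra.
Qed.

End Hulls.

(** * Increments of A along lifted segments *)

Section Increments.
Variables (R : realType) (E : normedModType R) (A : seg R -> E).
Local Notation pt := (pt R).
Implicit Types p q r : pt.

Definition incr p q : E := A (tred p, psub q p).

Definition circulation p q r : E := incr p q + incr q r + incr r p.

Definition gr_bound (al K : R) := forall p q, enorm (psub q p) <= 4^-1 ->
  `|incr p q| <= K * enorm (psub q p) `^ al.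

Definition corner_bound (al K : R) := forall p q r,
  enorm (psub q p) <= 4^-1 -> enorm (psub r p) <= 4^-1 ->
  `|incr p q - incr p r| <=
    K * (enorm (psub q r) `^ al + `|tri_det p q r| `^ (al / 2)).

Definition tri_bound (al K : R) := forall p q r,
  enorm (psub q p) <= 4^-1 -> enorm (psub r q) <= 4^-1 ->
  enorm (psub p r) <= 4^-1 ->
  `|circulation p q r| <= K * `|tri_det p q r| `^ (al / 2).

Definition vee_bound (al K : R) := forall l l' : seg R, in_X l -> in_X l' ->
  l <> l' -> vee l l' -> `|A l - A l'| <= K * seg_area l l' `^ (al / 2).

Definition holder_bound (al K : R) := forall l l' : seg R, in_X l -> in_X l' ->
  0 < rho l l' -> `|A l - A l'| <= K * rho l l' `^ al.

Lemma padd_psub p q : padd p (psub q p) = q.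
Proof. by case: q => ? ?; rewrite /padd/psub/=; congr pair; ring. Qed.

Lemma psub_padd p q : psub (padd p q) p = q.
Proof. by case: q => ? ?; rewrite /padd/psub/=; congr pair; ring. Qed.

Lemma psub_self p : psub p p = (0, 0).
Proof. by rewrite /psub/= !subrr. Qed.

Lemma psub_eq0 p q : psub p q = (0, 0) -> p = q.
Proof.
case: p => ? ?; case: q => ? ?; rewrite /psub /= => -[/eqP + /eqP].
by rewrite !subr_eq0 => /eqP-> /eqP->.
Qed.

Lemma incr_in_X p q : enorm (psub q p) <= 4^-1 -> in_X (tred p, psub q p).
Proof. by split => //; exact: tred_in_T. Qed.

Lemma seg_f_incr p q : seg_f (tred p, psub q p) = tred q.
Proof. by rewrite /seg_f /= tred_addl padd_psub. Qed.

Lemma seg_incr (l : seg R) : in_X l -> A l = incr l.1 (padd l.1 l.2).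
Proof. by case: l => x v [xT _]; rewrite /incr /= tred_id // psub_padd. Qed.

Hypothesis hA : additive_on_joins A.

Lemma incr_along (p q r w : pt) (c c' : R) : enorm w = 1 ->
  psub q p = pscale c w -> psub r q = pscale c' w ->
  `|c| <= 4^-1 -> `|c'| <= 4^-1 -> `|c + c'| <= 4^-1 ->
  incr p r = incr p q + incr q r.
Proof.
move=> w1 qp rq hc hc' hcc'.
have n1 : enorm (psub q p) <= 4^-1 by rewrite qp enorm_scale w1 mulr1.
have n2 : enorm (psub r q) <= 4^-1 by rewrite rq enorm_scale w1 mulr1.
rewrite /incr -(hA (incr_in_X n1) (incr_in_X n2) _ w1 qp rq hc hc' hcc');
  last by rewrite seg_f_incr.
congr (A (_, _)).
have -> : psub r p = padd (psub q p) (psub r q).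
  by rewrite /psub/padd/=; congr pair; ring.
by rewrite qp rq /padd/pscale/=; congr pair; ring.
Qed.

(** Joinability allows coefficients of either sign along one unit vector, so the order of the three
    points on their line does not matter. *)
Lemma incr_collinear (p q r : pt) : tri_det p q r = 0 ->
  enorm (psub q p) <= 4^-1 -> enorm (psub r q) <= 4^-1 ->
  enorm (psub r p) <= 4^-1 -> incr p r = incr p q + incr q r.
Proof.
move=> D0 qp rq rp.
suff [w [c [c' [w1 e1 e2]]]] : exists w c c', [/\ enorm w = 1,
    psub q p = pscale c w & psub r q = pscale c' w].
  have e3 : psub r p = pscale (c + c') w.
    have -> : psub r p = padd (psub q p) (psub r q).
      by rewrite /psub/padd/=; congr pair; ring.
    by rewrite e1 e2 /padd/pscale/=; congr pair; ring.
  move: qp rq rp; rewrite e1 e2 e3 !enorm_scale w1 !mulr1 => qp rq rp.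
  exact: (incr_along w1 e1 e2).
have unit (u : pt) : enorm u != 0 ->
    enorm (pscale (enorm u)^-1 u) = 1 /\
    u = pscale (enorm u) (pscale (enorm u)^-1 u).
  move=> u0; split.
    by rewrite enorm_scale ger0_norm ?invr_ge0 ?enorm_ge0 // mulVf.
  by case: u u0 => u1 u2 u0; rewrite /pscale/=; congr pair; field.
(* If p = q the direction comes from the second side; if all three points coincide, any unit vector
   will do. *)
have [/eqP qp0|qp0] := boolP (enorm (psub q p) == 0).
  have qE := psub_eq0 (enorm_eq0 qp0).
  have [/eqP rq0|rq0] := boolP (enorm (psub r q) == 0).
    exists (1, 0), 0, 0; split.
    - by apply: enormE => //=; ring.
    - by rewrite (enorm_eq0 qp0) /pscale/=; congr pair; ring.
    - by rewrite (enorm_eq0 rq0) /pscale/=; congr pair; ring.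
  have [u1 u2] := unit _ rq0.
  exists (pscale (enorm (psub r q))^-1 (psub r q)), 0, (enorm (psub r q)).
  split => //; rewrite (enorm_eq0 qp0) /pscale/=; congr pair; ring.
have [u1 u2] := unit _ qp0.
exists (pscale (enorm (psub q p))^-1 (psub q p)), (enorm (psub q p)).
pose u := psub q p; pose v := psub r q.
(* The signed length of the projection of v on u; by [D'], v equals this projection. *)
exists ((v.1 * u.1 + v.2 * u.2) / enorm u); split => //.
have D' : u.1 * v.2 - u.2 * v.1 = 0.
  by rewrite -D0 /u/v/tri_det/det2/psub/=; ring.
rewrite -/u in qp0 *; rewrite -/v; clearbody u v.
have uu : enorm u ^+ 2 = u.1 ^+ 2 + u.2 ^+ 2 := enorm_sqr u.
have scal (x : R) (i : R) : x = (v.1 * u.1 + v.2 * u.2) / (enorm u ^+ 2) * i ->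
    x = (v.1 * u.1 + v.2 * u.2) / enorm u * ((enorm u)^-1 * i).
  by move=> ->; field.
have uu0 : u.1 ^+ 2 + u.2 ^+ 2 != 0 by rewrite -uu expf_neq0.
rewrite [LHS]surjective_pairing /pscale/=; congr pair; apply: scal; rewrite uu;
  apply: (mulfI uu0).
  transitivity ((v.1 * u.1 + v.2 * u.2) * u.1 - u.2 * (u.1 * v.2 - u.2 * v.1)).
    by ring.
  by rewrite D'; field.
transitivity ((v.1 * u.1 + v.2 * u.2) * u.2 + u.1 * (u.1 * v.2 - u.2 * v.1)).
  by ring.
by rewrite D'; field.
Qed.

Lemma incr_self p : incr p p = 0.
Proof.
have n : enorm (psub p p) <= 4^-1 by rewrite psub_self enorm0 invr_ge0.
have D : tri_det p p p = 0 by rewrite /tri_det/det2/psub/=; ring.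
by have /eqP := incr_collinear D n n n; rewrite -subr_eq0 opprD addNKr oppr_eq0 => /eqP.
Qed.

Lemma incr_opp p q : enorm (psub q p) <= 4^-1 -> incr q p = - incr p q.
Proof.
move=> n.
have n' : enorm (psub p q) <= 4^-1 by rewrite enorm_sub_sym.
have n0 : enorm (psub p p) <= 4^-1 by rewrite psub_self enorm0 invr_ge0.
have D : tri_det p q p = 0 by rewrite /tri_det/det2/psub/=; ring.
apply/eqP; rewrite -addr_eq0 addrC -(incr_collinear D n n' n0).
by rewrite incr_self.
Qed.

Lemma circulation_rot p q r : circulation p q r = circulation q r p.
Proof. by rewrite /circulation -[LHS]addrA addrC. Qed.

End Increments.

(** * Corner, triangle, vee and Hölder bounds *)

Section NormComparisons.
Variables (R : realType) (E : normedModType R) (A : seg R -> E).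
Local Notation pt := (pt R).
Implicit Types p q r : pt.
Hypothesis hA : additive_on_joins A.
Variable al : R.
Hypothesis al01 : 0 <= al <= 1.

Local Notation incr := (incr A).
Local Notation circulation := (circulation A).

Let al0 : 0 <= al. Proof. by case/andP: al01. Qed.
Let alh : 0 <= al / 2 <= 1. Proof. by case/andP: al01 => h1 h2; lra. Qed.
Let alh0 : 0 <= al / 2. Proof. by case/andP: alh. Qed.

(** The difference of the two increments is a circulation minus the increment along the third side,
    and growth pays for that side. *)
Lemma corner_bound_of_tri (KG KT : R) : 0 <= KG -> 0 <= KT ->
  gr_bound A al KG -> tri_bound A al KT -> corner_bound A al (2 * KG + KT).
Proof.
move=> KG0 KT0 hG hT p q r qp rp.
have P0 : 0 <= enorm (psub q r) `^ al by exact: powR_ge0.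
have Q0 : 0 <= `|tri_det p q r| `^ (al / 2) by exact: powR_ge0.
set P := enorm _ `^ al in P0 *; set Q := `|_| `^ _ in Q0 *.
have [qr|qr] := leP (enorm (psub r q)) 4^-1.
  have -> : incr p q - incr p r = circulation p q r - incr q r.
    by rewrite /circulation (incr_opp hA rp) [RHS]addrAC addrK.
  apply: le_trans (ler_normB _ _) _.
  have h1 : `|circulation p q r| <= KT * Q.
    by apply: hT => //; rewrite enorm_sub_sym.
  have h2 : `|incr q r| <= KG * P by rewrite /P enorm_sub_sym; exact: hG.
  nra.
(* Here the third side is too long to be a segment, but it is longer than the other two, so growth
   alone suffices. *)
have le p' q' : enorm (psub q' p') <= 4^-1 -> `|incr p' q'| <= KG * P.
  move=> h; apply: le_trans (hG _ _ h) _; apply: ler_wpM2l => //.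
  apply: powR_le; rewrite ?enorm_ge0 //; apply: le_trans h _.
  by rewrite enorm_sub_sym; exact: ltW.
apply: le_trans (ler_normB _ _) _.
have := le _ _ qp; have := le _ _ rp; nra.
Qed.

(** Over the longest side, of length L, one has |D| <= L^2, so the altitude |D|/L is at most
    |D|^(1/2) and the distance term of the corner bound is absorbed in its determinant term. The
    foot f lies between p and q, which keeps all segments short. Each of the two corners, at p and
    at q, costs 2K. *)
Lemma tri_bound_longest (K : R) p q r : 0 <= K -> corner_bound A al K ->
  enorm (psub q p) <= 4^-1 -> enorm (psub r q) <= enorm (psub q p) ->
  enorm (psub p r) <= enorm (psub q p) ->
  `|circulation p q r| <= 4 * K * `|tri_det p q r| `^ (al / 2).
Proof.
move=> K0 hC qp rq pr.
have [/eqP L0|Ln0] := boolP (enorm (psub q p) == 0).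
  have qE := psub_eq0 (enorm_eq0 L0).
  have rE : r = q.
    apply: psub_eq0; apply: enorm_eq0; apply/eqP; rewrite eq_le enorm_ge0 andbT.
    by rewrite -L0.
  rewrite /circulation rE qE !(incr_self hA) !addr0 normr0.
  by rewrite !mulr_ge0 // powR_ge0.
have L0 : 0 < enorm (psub q p) by rewrite lt_def Ln0 enorm_ge0.
set L := enorm (psub q p) in L0 Ln0 *.
set D := tri_det p q r.
pose u := psub q p; pose v := psub r p.
pose s := (v.1 * u.1 + v.2 * u.2) / L ^+ 2.
pose f := padd p (pscale s u).
have L2 : L ^+ 2 = u.1 ^+ 2 + u.2 ^+ 2 by exact: enorm_sqr.
have L2p : 0 < L ^+ 2 by rewrite exprn_gt0.
have rp2 : v.1 ^+ 2 + v.2 ^+ 2 <= L ^+ 2.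
  by move: pr; rewrite enorm_sub_sym enorm_le // ltW.
have rq2 : (v.1 - u.1) ^+ 2 + (v.2 - u.2) ^+ 2 <= L ^+ 2.
  move: rq; rewrite enorm_le ?enorm_ge0 //; apply: le_trans.
  by rewrite /u /v /psub /= le_eqVlt; apply/orP; left; apply/eqP; ring.
have DE : D = u.1 * v.2 - u.2 * v.1 by [].
have s0 : 0 <= s.
  rewrite divr_ge0 ?(ltW L2p) //; move: rq2; rewrite L2.
  have := sqr_ge0 v.1; have := sqr_ge0 v.2; clearbody u v; lra.
have s1 : s <= 1.
  rewrite ler_pdivrMr // mul1r; move: rp2; rewrite L2.
  have := sqr_ge0 (v.1 - u.1); have := sqr_ge0 (v.2 - u.2).
  clearbody u v; lra.
have DL : `|D| <= L ^+ 2.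
  rewrite -(@ler_pXn2r _ 2) ?nnegrE ?(ltW L2p) // real_normK ?num_real //.
  have -> : D ^+ 2 = L ^+ 2 * (v.1 ^+ 2 + v.2 ^+ 2) - (v.1 * u.1 + v.2 * u.2) ^+ 2.
    by rewrite DE L2; ring.
  apply: (@le_trans _ _ (L ^+ 2 * (v.1 ^+ 2 + v.2 ^+ 2))).
    by rewrite gerBl sqr_ge0.
  by rewrite [leRHS]expr2 ler_pM2l.
have fr : enorm (psub f r) ^+ 2 <= `|D|.
  have -> : enorm (psub f r) ^+ 2 = `|D| ^+ 2 / L ^+ 2.
    rewrite enorm_sqr real_normK ?num_real // DE.
    have -> : psub f r = psub (pscale s u) v.
      by rewrite /f /v /psub/padd/pscale/=; congr pair; ring.
    rewrite /s; move: L2p; rewrite L2 => /lt0r_neq0.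
    by clear s f s0 s1; clearbody u v; rewrite /psub/pscale/= => ?; field.
  by rewrite ler_pdivrMr // expr2 ler_wpM2l.
have pf : psub f p = pscale s u by rewrite psub_padd.
have fq : psub f q = pscale (s - 1) u.
  by rewrite /f /u /psub/padd/pscale/=; congr pair; ring.
have npf : enorm (psub f p) <= 4^-1.
  rewrite pf enorm_scale ger0_norm //.
  by apply: le_trans qp; rewrite ler_piMl // enorm_ge0.
have nfq : enorm (psub f q) <= 4^-1.
  rewrite fq enorm_scale ler0_norm ?subr_le0 // opprB.
  by apply: le_trans qp; rewrite ler_piMl ?enorm_ge0 // gerBl.
have Dpf : tri_det p f r = s * D.
  by rewrite /D /tri_det pf /det2/pscale /u/=; ring.
have Dqf : tri_det q f r = (s - 1) * D.
  by rewrite /D /tri_det fq /det2/pscale/psub /u/psub/=; ring.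
have split_pq : incr p q = incr p f - incr q f.
  rewrite -(incr_opp hA nfq); apply: (incr_collinear hA) => //.
    by rewrite tri_det_rot tri_det_rot tri_det_swap /tri_det pf /det2/pscale/=; ring.
  by rewrite enorm_sub_sym.
have -> : circulation p q r = (incr p f - incr p r) - (incr q f - incr q r).
  have rp4 : enorm (psub r p) <= 4^-1 by rewrite enorm_sub_sym (le_trans pr).
  rewrite /circulation split_pq (incr_opp hA rp4) opprB.
  by rewrite -(addrA (incr p f)) [- incr q f + _]addrC [LHS]addrAC.
have Q0 : 0 <= `|D| `^ (al / 2) by exact: powR_ge0.
set Q := `|D| `^ _ in Q0 *.
have frQ : enorm (psub f r) `^ al <= Q.
  by rewrite -powR_sqr_half ?enorm_ge0 //; apply: powR_le; rewrite ?sqr_ge0.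
have corner x t : enorm (psub f x) <= 4^-1 -> enorm (psub r x) <= 4^-1 ->
    `|t| <= 1 -> tri_det x f r = t * D -> `|incr x f - incr x r| <= 2 * K * Q.
  move=> h1 h2 t1 Dt; apply: le_trans (hC _ _ _ h1 h2) _.
  rewrite [2 * K]mulrC -mulrA ler_wpM2l // mulr_natl mulr2n lerD // Dt.
  by apply: powR_le => //; rewrite normrM ler_piMl.
apply: le_trans (ler_normB _ _) _.
have c1 : `|incr p f - incr p r| <= 2 * K * Q.
  apply: (corner _ s) => //; first by rewrite enorm_sub_sym (le_trans pr).
  by rewrite ger0_norm.
have c2 : `|incr q f - incr q r| <= 2 * K * Q.
  apply: (corner _ (s - 1)) => //; first by rewrite (le_trans rq).
  by rewrite ler_norml; apply/andP; split; lra.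
have -> : 4 * K * Q = 2 * K * Q + 2 * K * Q by ring.
exact: lerD.
Qed.

Lemma tri_bound_of_corner (K : R) : 0 <= K -> corner_bound A al K ->
  tri_bound A al (4 * K).
Proof.
move=> K0 hC p q r qp rq pr.
have [h1|h1] := leP (enorm (psub r q)) (enorm (psub q p)).
  have [h2|h2] := leP (enorm (psub p r)) (enorm (psub q p)).
    exact: tri_bound_longest.
  rewrite circulation_rot circulation_rot tri_det_rot tri_det_rot.
  by apply: tri_bound_longest => //; [lra|lra].
have [h2|h2] := leP (enorm (psub p r)) (enorm (psub r q)).
  rewrite circulation_rot tri_det_rot.
  by apply: tri_bound_longest => //; lra.
rewrite circulation_rot circulation_rot tri_det_rot tri_det_rot.
by apply: tri_bound_longest => //; lra.
Qed.

Lemma tdist_self p : tdist p p = 0.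
Proof.
rewrite /tdist psub_self /tred /= !tred1_id ?enorm0 //; lra.
Qed.

Lemma tdist_sym p q : tdist p q = tdist q p.
Proof.
rewrite /tdist; apply/eqP; rewrite eq_le !enorm_mono // /tred /psub /=;
  by rewrite -norm_tred1N opprB.
Qed.

Lemma seg_area_vertex (x v w : pt) :
  seg_area (x, v) (x, w) = fine (leb2 (hull4 x (padd x v) (padd x w) x)).
Proof.
rewrite /seg_area /=.
have -> : tred (psub x x) = (0, 0).
  by rewrite psub_self tred_id //; split => /=; lra.
suff -> : padd x (0, 0) = x by [].
by case: x => ? ?; rewrite /padd /= !addr0.
Qed.

Lemma tri_det_vertex (x v w : pt) :
  tri_det x (padd x v) (padd x w) = det2 v w.
Proof. by rewrite /tri_det !psub_padd. Qed.

(** Let e = |q - r|. Trimming leaves a tail of length at most e, which costs KG, and two segments of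
    equal length U whose ends are at most 2e apart. If these are far, then U <= 8e and growth costs
    2 * 8 KG; otherwise they form a vee. Hence 17 = 16 + 1. *)
Lemma corner_bound_of_vee (KG KV : R) : 0 <= KG -> 0 <= KV ->
  gr_bound A al KG -> vee_bound A al KV -> corner_bound A al (17 * KG + KV).
Proof.
move=> KG0 KV0 hG hV p q r.
wlog UW : q r / enorm (psub q p) <= enorm (psub r p).
  move=> th qp rp.
  have [h|/ltW h] := leP (enorm (psub q p)) (enorm (psub r p)); first exact: th.
  rewrite distrC enorm_sub_sym tri_det_rot tri_det_swap normrN.
  by rewrite 2!tri_det_rot; exact: th.
move=> qp rp.
set e := enorm (psub q r).
have e0 : 0 <= e by exact: enorm_ge0.
have P0 : 0 <= e `^ al by exact: powR_ge0.
set D := tri_det p q r.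
have Q0 : 0 <= `|D| `^ (al / 2) by exact: powR_ge0.
have [/eqP W0|Wn0] := boolP (enorm (psub r p) == 0).
  have rE := psub_eq0 (enorm_eq0 W0).
  have qE : q = p.
    apply: psub_eq0; apply: enorm_eq0; apply/eqP; rewrite eq_le enorm_ge0 andbT.
    by rewrite -W0.
  rewrite rE qE subrr normr0 mulr_ge0 //; first by lra.
  by rewrite addr_ge0 // powR_ge0.
have U0 : 0 <= enorm (psub q p) by exact: enorm_ge0.
set U := enorm (psub q p) in UW U0 *; set W := enorm (psub r p) in UW Wn0 *.
have W0 : 0 < W by rewrite lt_def Wn0 enorm_ge0.
pose t := U / W.
have t0 : 0 <= t by rewrite divr_ge0 // ltW.
have t1 : t <= 1 by rewrite ler_pdivrMr // mul1r.
pose r' := padd p (pscale t (psub r p)).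
have r'p : psub r' p = pscale t (psub r p) by rewrite psub_padd.
have nr'p : enorm (psub r' p) = U.
  by rewrite r'p enorm_scale ger0_norm // /t mulfVK.
have rr' : enorm (psub r r') = W - U.
  have -> : psub r r' = pscale (1 - t) (psub r p).
    by rewrite /r' /psub/padd/pscale/=; congr pair; ring.
  by rewrite enorm_scale ger0_norm ?subr_ge0 // mulrBl mul1r /t mulfVK.
have WUe : W - U <= e.
  rewrite lerBlDl /W; apply: le_trans (enorm_triangle r q p) _.
  by rewrite /e enorm_sub_sym addrC.
have qr' : enorm (psub q r') <= 2 * e.
  apply: le_trans (enorm_triangle q r r') _; rewrite rr' -/e; lra.
have nr'p4 : enorm (psub r' p) <= 4^-1 by rewrite nr'p.
have nrr'4 : enorm (psub r r') <= 4^-1 by rewrite rr'; rewrite -/W in rp; lra.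
have tail : incr p r = incr p r' + incr r' r.
  apply: (incr_collinear hA) => //.
  by rewrite /tri_det r'p /det2/pscale/=; ring.
have htail : `|incr r' r| <= KG * e `^ al.
  apply: le_trans (hG _ _ nrr'4) _; rewrite ler_wpM2l //.
  by apply: powR_le => //; rewrite ?enorm_ge0 // rr'.
suff main : `|incr p q - incr p r'| <= 16 * KG * e `^ al + KV * `|D| `^ (al / 2).
  rewrite tail opprD addrA; apply: le_trans (ler_normB _ _) _.
  by apply: le_trans (lerD main htail) _; nra.
(* The vee bound concerns distinct segments only. *)
have [->|qr'n] := pselect (q = r').
  by rewrite subrr normr0 addr_ge0 // ?mulr_ge0.
pose l : seg R := (tred p, psub q p); pose l' : seg R := (tred p, psub r' p).
have lX : in_X l by exact: incr_in_X.
have lX' : in_X l' by exact: incr_in_X.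
have [hfar|nfar] := pselect (far l l').
  have Ue : U <= 8 * e.
    move: hfar; rewrite /far /seg_len /= nr'p -/U minxx /seg_i /= tdist_self.
    rewrite /l /l' !seg_f_incr max_r; last exact: enorm_ge0.
    move=> h; have := lt_le_trans h (tdist_tred_le q r'); lra.
  have UP : U `^ al <= 8 * e `^ al by apply: powR_le_scale => //; lra.
  apply: le_trans (ler_normB _ _) _.
  have h1 := hG _ _ qp; have h2 := hG _ _ nr'p4; rewrite nr'p in h2.
  rewrite -/U in h1.
  have : KG * U `^ al <= KG * (8 * e `^ al) by rewrite ler_wpM2l.
  have : 0 <= KV * `|D| `^ (al / 2) by rewrite mulr_ge0.
  lra.
have v : vee l l' by split => //; split => //; rewrite /seg_len /= nr'p.
have ll' : l <> l'.
  move=> -[e1 e2]; apply: qr'n; rewrite -(padd_psub p q) -(padd_psub p r').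
  by rewrite /psub e1 e2.
apply: le_trans (hV _ _ lX lX' ll' v) _.
apply: (@le_trans _ _ (KV * `|D| `^ (al / 2))); last first.
  by rewrite lerDr !mulr_ge0.
rewrite ler_wpM2l //; apply: powR_le => //.
  by rewrite seg_area_vertex fine_ge0 // leb2_ge0.
rewrite seg_area_vertex; apply: le_trans (hull4_le_tri_det _ _ _) _.
rewrite tri_det_vertex r'p.
have -> : det2 (psub q p) (pscale t (psub r p)) = t * D.
  by rewrite /D /tri_det /det2 /pscale /=; ring.
by rewrite normrM ger0_norm // ler_piMl.
Qed.

(** In an isosceles triangle with legs |v| and base e, det^2 = e^2 (|v|^2 - e^2/4). Not being far
    gives e <= |v|/4, so e^2 <= |det| <= 4 S. The base is thus at most twice the root of the area,
    and the area is positive, so quotients by it in the vee norm are genuine. *)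
Lemma vee_rho_le (l l' : seg R) : in_X l -> in_X l' -> l <> l' -> vee l l' ->
  [/\ 0 < seg_area l l', 0 < rho l l' & rho l l' <= 3 * Num.sqrt (seg_area l l')].
Proof.
case: l => x v; case: l' => x' w lX lX' ll' [nfar [len ini]].
rewrite /seg_i /= in ini; subst x'.
rewrite /seg_len /= in len.
have [xT vl] := lX; have [_ wl] := lX'; rewrite /= in xT vl wl.
set S := seg_area _ _.
have S0 : 0 <= S by rewrite /S seg_area_vertex fine_ge0 // leb2_ge0.
have detS : `|det2 v w| <= 4 * S.
  rewrite /S seg_area_vertex -(tri_det_vertex x).
  have [h1 h2 h3 _] := hull4_vertex x (padd x v) (padd x w) x.
  exact: tri_det_le_hull4.
have vw2 : enorm (psub v w) <= 2^-1.
  have -> : psub v w = padd v (pscale (-1) w).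
    by rewrite /psub/padd/pscale/=; congr pair; ring.
  by apply: le_trans (enorm_add _ _) _; rewrite enorm_opp; lra.
have e0 := enorm_ge0 (psub v w).
set e := enorm (psub v w) in vw2 e0 *.
have fE : tdist (seg_f (x, v)) (seg_f (x, w)) = e.
  rewrite /seg_f /= tdist_tred_small.
  - by congr enorm; rewrite /psub/padd/=; congr pair; ring.
  - rewrite /padd /= (_ : _ - _ = (psub v w).1); last by rewrite /psub /=; ring.
    exact: le_trans (enorm_coord1 _) _.
  - rewrite /padd /= (_ : _ - _ = (psub v w).2); last by rewrite /psub /=; ring.
    exact: le_trans (enorm_coord2 _) _.
have el : e <= 4^-1 * enorm v.
  rewrite leNgt; apply/negP => h; apply: nfar.
  rewrite /far /seg_len /= -len minxx /seg_i /= tdist_self fE max_r //.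
have rhoE : rho (x, v) (x, w) = e + Num.sqrt S.
  rewrite /rho; case: asboolP => // _.
  by rewrite /seg_i /= tdist_self add0r fE.
have e_gt0 : 0 < e.
  rewrite lt_def e0 andbT; apply/eqP => /enorm_eq0/psub_eq0 vwE.
  by apply: ll'; rewrite vwE.
have e2S : e ^+ 2 <= 4 * S.
  apply: le_trans detS.
  rewrite -(@ler_pXn2r _ 2) ?nnegrE ?sqr_ge0 // real_normK ?num_real //.
  have E2 : e ^+ 2 = (v.1 - w.1) ^+ 2 + (v.2 - w.2) ^+ 2 by exact: enorm_sqr.
  have n1 := enorm_sqr v; have n2 := enorm_sqr w.
  have -> : det2 v w ^+ 2 = e ^+ 2 * (enorm v ^+ 2 - e ^+ 2 / 4).
    have dotE : v.1 * w.1 + v.2 * w.2 = enorm v ^+ 2 - e ^+ 2 / 2.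
      by move: n1 n2; rewrite E2 -len; nra.
    have -> : det2 v w ^+ 2 = enorm v ^+ 2 * enorm w ^+ 2
        - (v.1 * w.1 + v.2 * w.2) ^+ 2 by rewrite n1 n2 /det2; ring.
    by rewrite dotE -len; field.
  rewrite [leLHS]expr2 ler_wpM2l ?sqr_ge0 //.
  by have := enorm_ge0 v; nra.
have eS : e <= 2 * Num.sqrt S.
  rewrite -(@ler_pXn2r _ 2) ?nnegrE ?mulr_ge0 ?sqrtr_ge0 //.
  by rewrite [leRHS]exprMn [in leRHS]sqr_sqrtr //; apply: le_trans e2S _; lra.
have s0 := sqrtr_ge0 S.
have e20 : 0 < e ^+ 2 by rewrite exprn_gt0.
by rewrite rhoE; split; lra.
Qed.

Lemma vee_bound_of_holder (K : R) : 0 <= K -> holder_bound A al K ->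
  vee_bound A al (3 * K).
Proof.
move=> K0 hH l l' lX lX' ll' v.
have [S0 r0 rS] := vee_rho_le lX lX' ll' v.
apply: le_trans (hH _ _ lX lX' r0) _.
rewrite powR_half ?(ltW S0) // [3 * K]mulrC -mulrA ler_wpM2l //.
by apply: powR_le_scale => //; rewrite ?ler1n ?sqrtr_ge0 ?(ltW r0).
Qed.

Lemma holder_bound_of_corner (KG KC : R) : 0 <= KG -> 0 <= KC ->
  gr_bound A al KG -> corner_bound A al KC ->
  holder_bound A al (2 * KG + 12 * KC).
Proof.
move=> KG0 KC0 hG hC l l' lX lX' _.
have hGl k : in_X k -> `|A k| <= KG * seg_len k `^ al.
  move=> kX; rewrite seg_incr // /seg_len -{2}(psub_padd k.1 k.2).
  by apply: hG; rewrite psub_padd; case: kX.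
have [hfar|nfar] := pselect (far l l').
  have -> : rho l l' = seg_len l + seg_len l' by rewrite /rho; case: asboolP.
  have s0 : 0 <= seg_len l by exact: enorm_ge0.
  have s0' : 0 <= seg_len l' by exact: enorm_ge0.
  apply: le_trans (ler_normB _ _) _.
  have g1 : seg_len l `^ al <= (seg_len l + seg_len l') `^ al.
    by apply: powR_le => //; rewrite lerDl.
  have g2 : seg_len l' `^ al <= (seg_len l + seg_len l') `^ al.
    by apply: powR_le => //; rewrite lerDr.
  have := hGl _ lX; have := hGl _ lX'.
  have := ler_wpM2l KG0 g1; have := ler_wpM2l KG0 g2.
  have : 0 <= KC * (seg_len l + seg_len l') `^ al by rewrite mulr_ge0 ?powR_ge0.
  lra.
have rhoE : rho l l' = tdist (seg_i l) (seg_i l') + tdist (seg_f l) (seg_f l')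
       + Num.sqrt (seg_area l l') by rewrite /rho; case: asboolP.
have [xT vl] := lX; have [xT' vl'] := lX'.
pose d := tred (psub l'.1 l.1).
pose x := l.1; pose y := padd x l.2; pose x2 := padd x d; pose y2 := padd x2 l'.2.
have x2T : tred x2 = l'.1.
  have [k1 [k2 dE]] := tredE (psub l'.1 l.1).
  rewrite /x2 /d dE (_ : padd _ _ = padd l'.1 (k1%:~R, k2%:~R)).
    by rewrite tredDZ tred_id.
  by rewrite /x /padd/psub/=; congr pair; ring.
have Al : A l = incr x y by exact: seg_incr.
have Al' : A l' = incr x2 y2.
  by rewrite /NormComparisons.incr /incr x2T psub_padd; case: (l').
have T1E : tdist (seg_i l) (seg_i l') = enorm (psub x2 x).
  by rewrite tdist_sym /x2 psub_padd.
have fE' : seg_f l' = tred y2 by rewrite /seg_f -x2T tred_addl.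
have T2E0 : tdist (seg_f l) (seg_f l') = enorm (tred (psub y y2)).
  by rewrite fE' /tdist tred_sub.
(* Not being far bounds both distances by a quarter of a length that is itself at most 1/4. *)
have [T1s T2s] : enorm (psub x2 x) <= 16^-1 /\ enorm (tred (psub y y2)) <= 16^-1.
  have : Num.max (enorm (psub x2 x)) (enorm (tred (psub y y2))) <= 16^-1.
    rewrite -T1E -T2E0; apply: (@le_trans _ _ (4^-1 * Num.min (seg_len l) (seg_len l'))).
      by rewrite leNgt; apply/negP.
    have : Num.min (seg_len l) (seg_len l') <= 4^-1 by rewrite ge_min vl.
    lra.
  by rewrite ge_max => /andP[].
(* The lift of [l'] is chosen at its initial point. Its final point is then also the lift nearest to
   [y], since the integer ambiguity is at most 1/16 + 1/4 + 1/16 + 1/4 < 1. *)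
have T2E : tdist (seg_f l) (seg_f l') = enorm (psub y y2).
  rewrite T2E0; have [k1 [k2 kE]] := tredE (psub y y2).
  have small (z w u t : R) (k : int) : t = z - w - u + k%:~R -> `|t| <= 16^-1 ->
      `|z| <= 4^-1 -> `|w| <= 16^-1 -> `|u| <= 4^-1 -> k = 0.
    move=> tE ? ? ? ?; apply: (@int_small_eq0 R).
    have -> : k%:~R = t - z + w + u by rewrite tE; ring.
    apply: le_lt_trans (ler_normD _ _) _.
    have := ler_normD (t - z) w; have := ler_normB t z; lra.
  have dn : enorm d <= 16^-1 by move: T1s; rewrite /x2 psub_padd.
  have k10 : k1 = 0.
    apply: (@small l.2.1 d.1 l'.2.1 (tred (psub y y2)).1).
    - by rewrite kE /y /y2 /x2 /padd /psub /=; ring.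
    - exact: le_trans (enorm_coord1 _) _.
    - exact: le_trans (enorm_coord1 _) _.
    - exact: le_trans (enorm_coord1 _) _.
    - exact: le_trans (enorm_coord1 _) _.
  have k20 : k2 = 0.
    apply: (@small l.2.2 d.2 l'.2.2 (tred (psub y y2)).2).
    - by rewrite kE /y /y2 /x2 /padd /psub /=; ring.
    - exact: le_trans (enorm_coord2 _) _.
    - exact: le_trans (enorm_coord2 _) _.
    - exact: le_trans (enorm_coord2 _) _.
    - exact: le_trans (enorm_coord2 _) _.
  by rewrite kE k10 k20 /padd /= !addr0.
rewrite T2E0 in T2E; rewrite T2E in T2s T2E0.
pose S := seg_area l l'.
have SE : S = fine (leb2 (hull4 x y y2 x2)) by [].
have S0 : 0 <= S by rewrite SE fine_ge0 // leb2_ge0.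
have sS0 := sqrtr_ge0 S.
have T10 := enorm_ge0 (psub x2 x); have T20 := enorm_ge0 (psub y y2).
set r := rho l l'.
have rE : r = enorm (psub x2 x) + enorm (psub y y2) + Num.sqrt S.
  by rewrite /r rhoE T1E T2E0.
have r0 : 0 <= r by lra.
pose m := midpoint x y; pose m2 := midpoint x2 y2.
have mm2 : enorm (psub m m2) <= 2^-1 * (enorm (psub x2 x) + enorm (psub y y2)).
  have -> : psub m m2 = pscale 2^-1 (padd (psub x x2) (psub y y2)).
    by rewrite /m /m2 /midpoint/psub/padd/pscale/=; congr pair; ring.
  rewrite enorm_scale ger0_norm // ler_pM2l // (enorm_sub_sym x2).
  exact: enorm_add.
have mx : enorm (psub m x) <= 8^-1.
  have -> : psub m x = pscale 2^-1 l.2.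
    by rewrite /m /midpoint /y /psub/padd/pscale/=; congr pair; field.
  by rewrite enorm_scale ger0_norm //; lra.
have ym : enorm (psub y m) <= 8^-1.
  have -> : psub y m = pscale 2^-1 l.2.
    by rewrite /m /midpoint /y /psub/padd/pscale/=; congr pair; field.
  by rewrite enorm_scale ger0_norm //; lra.
have mx2 : enorm (psub m2 x2) <= 8^-1.
  have -> : psub m2 x2 = pscale 2^-1 l'.2.
    by rewrite /m2 /midpoint /y2 /psub/padd/pscale/=; congr pair; field.
  by rewrite enorm_scale ger0_norm //; lra.
have ym2 : enorm (psub y2 m2) <= 8^-1.
  have -> : psub y2 m2 = pscale 2^-1 l'.2.
    by rewrite /m2 /midpoint /y2 /psub/padd/pscale/=; congr pair; field.
  by rewrite enorm_scale ger0_norm //; lra.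
have m2x : enorm (psub m2 x) <= 4^-1.
  have := enorm_triangle m2 m x; rewrite (enorm_sub_sym m2 m); lra.
have y2m : enorm (psub y2 m) <= 4^-1.
  have := enorm_triangle y2 y m; rewrite (enorm_sub_sym y2 y); lra.
have yx : enorm (psub y x) <= 4^-1 by rewrite psub_padd.
have y2x2 : enorm (psub y2 x2) <= 4^-1 by rewrite psub_padd.
have [hx hy hy2 hx2] := hull4_vertex x y y2 x2.
have hm : hull4 x y y2 x2 m by exact: hull4_midpoint.
have hm2 : hull4 x y y2 x2 m2 by exact: hull4_midpoint.
(* The distance term costs r^al. The determinant is at most 4 S, so its root is at most 2r and costs
   2 r^al; hence 3 per corner and 12 for the four corners below. *)
have corner u1 u2 u3 : hull4 x y y2 x2 u1 -> hull4 x y y2 x2 u2 ->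
    hull4 x y y2 x2 u3 -> enorm (psub u2 u1) <= 4^-1 ->
    enorm (psub u3 u1) <= 4^-1 -> enorm (psub u2 u3) <= r ->
    `|incr u1 u2 - incr u1 u3| <= 3 * KC * r `^ al.
  move=> h1 h2 h3 n2 n3 n23; apply: le_trans (hC _ _ _ n2 n3) _.
  have e1 : enorm (psub u2 u3) `^ al <= r `^ al.
    by apply: powR_le => //; exact: enorm_ge0.
  have e2 : `|tri_det u1 u2 u3| `^ (al / 2) <= 2 * r `^ al.
    rewrite powR_half //; apply: powR_le_scale => //; first lra.
    apply: (@le_trans _ _ (2 * Num.sqrt S)); last by lra.
    rewrite -(@ler_pXn2r _ 2) ?nnegrE ?mulr_ge0 ?sqrtr_ge0 // exprMn !sqr_sqrtr //.
    apply: le_trans (tri_det_le_hull4 h1 h2 h3) _; rewrite -SE; lra.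
  rewrite [3 * KC]mulrC -mulrA ler_wpM2l //; lra.
(* The diagonals x m2 and m y2 are each traversed in both directions and cancel. *)
have -> : A l - A l' = (incr x m - incr x m2) - (incr m2 x - incr m2 x2)
    + ((incr m y - incr m y2) - (incr y2 m - incr y2 m2)).
  have xy : incr x y = incr x m + incr m y.
    apply: (incr_collinear hA) => //; [|lra|lra].
    by rewrite /m /midpoint /tri_det /det2 /psub/pscale/padd/=; field.
  have xy2 : incr x2 y2 = incr x2 m2 + incr m2 y2.
    apply: (incr_collinear hA) => //; [|lra|lra].
    by rewrite /m2 /midpoint /tri_det /det2 /psub/pscale/padd/=; field.
  have o1 : incr m2 x = - incr x m2 by exact: incr_opp.
  have o2 : incr m2 x2 = - incr x2 m2 by apply: incr_opp => //; lra.
  have o3 : incr y2 m = - incr m y2 by exact: incr_opp.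
  have o4 : incr y2 m2 = - incr m2 y2 by apply: incr_opp => //; lra.
  rewrite Al Al' xy xy2 o1 o2 o3 o4 !opprD !opprK.
  rewrite !addrA !subrK -!addrA; congr (_ + _).
  by rewrite addrCA.
have c1 : `|incr x m - incr x m2| <= 3 * KC * r `^ al by apply: corner => //; lra.
have c2 : `|incr m2 x - incr m2 x2| <= 3 * KC * r `^ al.
  by apply: corner => //; rewrite ?(enorm_sub_sym _ m2) ?(enorm_sub_sym x x2); lra.
have c3 : `|incr m y - incr m y2| <= 3 * KC * r `^ al by apply: corner => //; lra.
have c4 : `|incr y2 m - incr y2 m2| <= 3 * KC * r `^ al.
  by apply: corner => //; rewrite ?(enorm_sub_sym _ y2); lra.
apply: le_trans (ler_normD _ _) _.
apply: le_trans (lerD (ler_normB _ _) (ler_normB _ _)) _.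
have : 0 <= KG * r `^ al by rewrite mulr_ge0 ?powR_ge0.
lra.
Qed.

End NormComparisons.

(** * Triangles on the torus and their plane lifts *)

Section Triangles.
Variable R : realType.
Local Notation pt := (pt R).
Implicit Types p q r : pt.

Lemma enorm_sub_seg (z p q : pt) (c L : R) : 0 <= c <= 1 ->
  enorm (psub z p) <= L -> enorm (psub z q) <= L ->
  enorm (psub z (padd p (pscale c (psub q p)))) <= L.
Proof.
move=> /andP[c0 c1] hp hq.
have -> : psub z (padd p (pscale c (psub q p))) =
    padd (pscale (1 - c) (psub z p)) (pscale c (psub z q)).
  by rewrite /padd/psub/pscale/=; congr pair; ring.
apply: le_trans (enorm_add _ _) _; rewrite !enorm_scale !ger0_norm ?subr_ge0 //.
have -> : L = (1 - c) * L + c * L by ring.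
by apply: lerD; apply: ler_wpM2l; rewrite ?subr_ge0.
Qed.

Definition tri_seg p q : seg R := (tred p, psub q p).

Lemma iota_tri_seg p q y : Defs.iota (tri_seg p q) y ->
  exists2 c, 0 <= c < 1 & y = tred (padd p (pscale c (psub q p))).
Proof. by move=> [c c01 <-]; exists c => //; rewrite tred_addl. Qed.

Lemma tred_eq_near p q : enorm (psub p q) < 1 -> tred p = tred q -> p = q.
Proof.
move=> pq; have [k1 [k2 ->]] := tredE p; have [m1 [m2 ->]] := tredE q.
case: p q pq => p1 p2 [q1 q2] pq; rewrite /padd /= => -[e1 e2].
have k1E : m1 - k1 = 0.
  apply: (@int_small_eq0 R); apply: le_lt_trans pq.
  rewrite intrB (_ : _ - _ = p1 - q1); first exact: (enorm_coord1 (psub (p1, p2) (q1, q2))).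
  by lra.
have k2E : m2 - k2 = 0.
  apply: (@int_small_eq0 R); apply: le_lt_trans pq.
  rewrite intrB (_ : _ - _ = p2 - q2); first exact: (enorm_coord2 (psub (p1, p2) (q1, q2))).
  by lra.
move/subr0_eq: k1E e1 => ->; move/subr0_eq: k2E e2 => -> /addIr -> /addIr ->.
by [].
Qed.

(** Distance is convex along sides, so the diameter is attained at vertices. A common point of two
    consecutive sides would force parameter 1, which the half-open [iota] excludes. *)
Lemma is_triangle_lift p q r : tri_det p q r != 0 ->
  enorm (psub q p) <= 4^-1 -> enorm (psub r q) <= 4^-1 ->
  enorm (psub p r) <= 4^-1 ->
  is_triangle (tri_seg p q) (tri_seg q r) (tri_seg r p).
Proof.
move=> D0 qp rq pr.
have n0 (x : pt) : enorm (psub x x) <= 4^-1 by rewrite psub_self enorm0.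
have [pq qr rp] : [/\ enorm (psub p q) <= 4^-1, enorm (psub q r) <= 4^-1 &
    enorm (psub r p) <= 4^-1] by split; rewrite enorm_sub_sym.
pose V x := [\/ x = p, x = q | x = r].
have VV x y : V x -> V y -> enorm (psub x y) <= 4^-1.
  by case=> ->; case=> ->.
have diam x y z t c c' : V x -> V y -> V z -> V t -> 0 <= c < 1 -> 0 <= c' < 1 ->
    enorm (psub (padd x (pscale c (psub y x))) (padd z (pscale c' (psub t z))))
      <= 4^-1.
  move=> vx vy vz vt /andP[c0 c1] /andP[c0' c1'].
  by apply: enorm_sub_seg; rewrite ?c0' ?(ltW c1') // enorm_sub_sym;
    apply: enorm_sub_seg; rewrite ?c0 ?(ltW c1) //; exact: VV.
have [vp vq vr] : [/\ V p, V q & V r].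
  by split; [exact: Or31|exact: Or32|exact: Or33].
have disj x y z : V x -> V y -> V z -> tri_det x y z != 0 ->
    Defs.iota (tri_seg x y) `&` Defs.iota (tri_seg y z) = set0.
  move=> vx vy vz Dn0; apply/seteqP; split => // w [].
  move=> /iota_tri_seg [c c01 ->] /iota_tri_seg [c' c01' e].
  have {}e : padd x (pscale c (psub y x)) = padd y (pscale c' (psub z y)).
    apply: tred_eq_near e; apply: le_lt_trans (diam _ _ _ _ _ _ _ _ _ _ c01 c01') _ => //.
    by rewrite invf_lt1 // ltr1n.
  have : (1 - c) * tri_det x y z = 0.
    have -> : (1 - c) * tri_det x y z =
      det2 (psub (padd y (pscale c' (psub z y))) (padd x (pscale c (psub y x))))
        (psub z y).
      by rewrite /tri_det/det2/padd/psub/pscale/=; ring.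
    by rewrite e psub_self /det2 /= !mul0r subrr.
  move/eqP; rewrite mulf_eq0 (negbTE Dn0) orbF subr_eq0 => /eqP c1.
  by move: c01; rewrite -c1 ltxx andbF.
split.
- by split; [|split]; split => //; exact: tred_in_T.
- by rewrite /seg_i /= !seg_f_incr.
- split; first exact: disj.
  split; first by apply: disj => //; rewrite -tri_det_rot.
  by rewrite setIC; apply: disj => //; rewrite tri_det_rot.
have on_edges y : (Defs.iota (tri_seg p q) `|` Defs.iota (tri_seg q r) `|` Defs.iota (tri_seg r p)) y ->
    exists x z c, [/\ V x, V z, 0 <= c < 1 & y = tred (padd x (pscale c (psub z x)))].
  move=> [[]|] /iota_tri_seg [c c01 ->].
  - by exists p, q, c.
  - by exists q, r, c.
  - by exists r, p, c.
move=> y y' /on_edges[x [z [c [vx vz c01 ->]]]] /on_edges[x' [z' [c' [vx' vz' c01' ->]]]].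
exact: le_trans (tdist_tred_le _ _) (diam _ _ _ _ _ _ _ _ _ _ _ _).
Qed.

(** The lift closes up in the plane: the sum of the three side vectors is an integer vector of
    length at most 3/4, hence 0. *)
Lemma is_triangle_unlift (l1 l2 l3 : seg R) : is_triangle l1 l2 l3 ->
  let p := l1.1 in let q := padd p l1.2 in let r := padd q l2.2 in
  [/\ l1 = tri_seg p q, l2 = tri_seg q r & l3 = tri_seg r p].
Proof.
move=> [[X1 [X2 X3]] [e1 [e2 e3]] _ _] p q r.
move: X1 X2 X3 e1 e2 e3; rewrite /seg_i.
case: l1 @p @q @r => x1 v1; case: l2 => x2 v2; case: l3 => x3 v3 /=.
move=> [T1 n1] [T2 n2] [T3 n3]; rewrite /seg_f /=.
rewrite /= in T1 n1 T2 n2 T3 n3.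
move=> e1 e2 e3; rewrite /tri_seg tred_id //.
set q := padd x1 v1; set r := padd q v2.
have e3' : x3 = tred r by rewrite e3 e2 tred_addl.
split; first by rewrite /q psub_padd.
  by rewrite -/q in e2; rewrite e2 /r psub_padd.
rewrite -e3'; congr pair; apply: psub_eq0.
have E : tred (padd r v3) = tred x1.
  by rewrite (tred_id T1) [RHS]e1 e3' tred_addl.
have near : enorm (psub (padd r v3) x1) < 1.
  rewrite (_ : psub _ _ = padd (padd v1 v2) v3); last first.
    by rewrite /r /q /padd/psub/=; congr pair; ring.
  apply: le_lt_trans (enorm_add _ _) _.
  apply: le_lt_trans (lerD (enorm_add _ _) (lexx _)) _; lra.
by rewrite -(tred_eq_near near E) /psub/padd/=; congr pair; ring.
Qed.

Lemma is_triangle_sides (l1 l2 l3 : seg R) : is_triangle l1 l2 l3 ->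
  let p := l1.1 in let q := padd p l1.2 in let r := padd q l2.2 in
  [/\ enorm (psub q p) <= 4^-1, enorm (psub r q) <= 4^-1
    & enorm (psub p r) <= 4^-1].
Proof.
move=> tri; have [X1 [X2 X3]] : in_X l1 /\ in_X l2 /\ in_X l3 by case: tri.
case: (is_triangle_unlift tri) => _ _ E3 p q r.
split; rewrite ?psub_padd; [by case: X1|by case: X2|].
by case: X3 => _; rewrite {1}E3.
Qed.

Lemma triangle_box p (v w : pt) : in_T p -> enorm v <= 4^-1 -> enorm w <= 4^-1 ->
  in_box (otri p (padd p v) (padd (padd p v) w)).
Proof.
move=> [p1 p2] hv hw _ [a [b [c [a0 [b0 [c0 [s ->]]]]]]].
have aE : a = 1 - b - c by lra.
have coord (x y z : R) : - 2^-1 <= x < 2^-1 -> `|y| <= 4^-1 -> `|z| <= 4^-1 ->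
    `|x + (b + c) * y + c * z| < 3 / 2.
  move=> /andP[x1 x2]; rewrite !ler_norml => /andP[y1 y2] /andP[z1 z2].
  have bc : 0 <= b + c <= 1 by lra.
  rewrite ltr_norml; apply/andP; split; nra.
have -> : bary p (padd p v) (padd (padd p v) w) a b c =
    (p.1 + (b + c) * v.1 + c * w.1, p.2 + (b + c) * v.2 + c * w.2).
  by rewrite aE /bary/padd/pscale/=; congr pair; ring.
split => /=; apply: coord => //.
- exact: le_trans (enorm_coord1 v) hv.
- exact: le_trans (enorm_coord1 w) hw.
- exact: le_trans (enorm_coord2 v) hv.
- exact: le_trans (enorm_coord2 w) hw.
Qed.

Lemma tri_area_ge0 (l1 l2 l3 : seg R) : 0 <= tri_area l1 l2 l3.
Proof. by rewrite fine_ge0 // leb2_ge0. Qed.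

Lemma tri_area_fin (l1 l2 l3 : seg R) :
  (tri_area l1 l2 l3)%:E = leb2 (tri_interior l1 l2 l3).
Proof.
rewrite fineK // ge0_fin_numE ?leb2_ge0 //.
by rewrite tri_interiorE (le_lt_trans (leb2_tproj_le1 _)) // ltry.
Qed.

(** 36 = 4 * 9: a factor 4 from [triangle_measure] and 9 from the cells of the torus. *)
Lemma tri_det_le_area (l1 l2 l3 : seg R) : in_X l1 -> in_X l2 ->
  `|det2 l1.2 l2.2| <= 36 * tri_area l1 l2 l3.
Proof.
move=> [T1 n1] [_ n2].
have [->|D0] := eqVneq (det2 l1.2 l2.2) 0.
  by rewrite normr0 mulr_ge0 // tri_area_ge0.
have DE : tri_det l1.1 (padd l1.1 l1.2) (padd (padd l1.1 l1.2) l2.2) = det2 l1.2 l2.2.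
  by rewrite /tri_det/det2/psub/padd/=; ring.
have h := (triangle_measure l1.1 (padd l1.1 l1.2) (padd (padd l1.1 l1.2) l2.2)).1.
have mO : measurable (otri l1.1 (padd l1.1 l1.2) (padd (padd l1.1 l1.2) l2.2)).
  by apply: measurable_otri; rewrite DE.
have := leb2_le_tproj mO (triangle_box T1 n1 n2) (c := tri_area l1 l2 l3).
rewrite tri_area_fin tri_interiorE lexx => /(_ isT) h2.
by have := le_trans h h2; rewrite lee_fin DE; lra.
Qed.

Lemma tri_area_le_det (l1 l2 l3 : seg R) : in_X l1 -> in_X l2 ->
  det2 l1.2 l2.2 != 0 -> tri_area l1 l2 l3 <= 9 * `|det2 l1.2 l2.2|.
Proof.
move=> [T1 n1] [_ n2] D0.
have DE : tri_det l1.1 (padd l1.1 l1.2) (padd (padd l1.1 l1.2) l2.2) = det2 l1.2 l2.2.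
  by rewrite /tri_det/det2/psub/padd/=; ring.
have h := (triangle_measure l1.1 (padd l1.1 l1.2) (padd (padd l1.1 l1.2) l2.2)).2.
have mO : measurable (otri l1.1 (padd l1.1 l1.2) (padd (padd l1.1 l1.2) l2.2)).
  by apply: measurable_otri; rewrite DE.
rewrite -lee_fin tri_area_fin tri_interiorE.
apply: tproj_leb2_le mO (triangle_box T1 n1 n2) _.
rewrite -DE; apply: le_trans h; apply: leb2_mono.
move=> z [a [b [c [a0 [b0 [c0 [s ->]]]]]]].
by exists a, b, c; do !split => //; exact: ltW.
Qed.

Lemma tri_seg_det p q r : det2 (tri_seg p q).2 (tri_seg q r).2 = tri_det p q r.
Proof. by rewrite /tri_seg /tri_det/det2/psub/=; ring. Qed.

End Triangles.

(** * Triangle and symmetric norms against the triangle bound *)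

Lemma tri_dist_rev (R : realType) (p q r : pt R) : tri_det p q r != 0 ->
  tri_dist (tri_seg p q) (tri_seg q r) (tri_seg r p)
    (tri_seg p r) (tri_seg r q) (tri_seg q p) =
  tri_area (tri_seg p q) (tri_seg q r) (tri_seg r p) +
  tri_area (tri_seg p r) (tri_seg r q) (tri_seg q p).
Proof.
move=> D0; rewrite /tri_dist /tri_orient !tri_seg_det.
have -> : tri_det p r q = - tri_det p q r by rewrite /tri_det /det2; ring.
rewrite sgrN; case: eqP => // e; exfalso; move/eqP: D0; apply.
by apply/eqP; rewrite -sgr_eq0 -eqNr -e.
Qed.

Lemma powR_half_sum_le (R : realType) (e K D c S1 S2 : R) : 0 <= e <= 1 ->
  0 <= K -> 0 <= c -> 0 < D -> 0 <= S2 -> D <= 36 * S1 -> S1 <= 9 * D ->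
  S2 <= 9 * D -> (0 < S1 + S2 -> c *+ 2 <= K * (S1 + S2) `^ e) ->
  c <= 18 * K * D `^ e.
Proof.
move=> e01 K0 c0 D0 S20 DS1 S1D S2D h.
have {}h := h (ltac:(lra)).
have pw : (S1 + S2) `^ e <= 18 * D `^ e by apply: powR_le_scale => //; lra.
have := ler_wpM2l K0 pw; move: h; rewrite mulr2n; lra.
Qed.

Section TriangleNorms.
Variables (R : realType) (E : normedModType R) (A : seg R -> E).
Local Notation pt := (pt R).
Implicit Types p q r : pt.
Hypothesis hA : additive_on_joins A.
Variable al : R.
Hypothesis al01 : 0 <= al <= 1.
Local Notation circulation := (circulation A).

Let al0 : 0 <= al. Proof. by case/andP: al01. Qed.
Let alh : 0 <= al / 2 <= 1. Proof. by case/andP: al01 => h1 h2; lra. Qed.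

Definition tri_norm_bound (K : R) := forall l1 l2 l3 : seg R,
  is_triangle l1 l2 l3 -> 0 < tri_area l1 l2 l3 ->
  `|A_bdry A l1 l2 l3| <= K * tri_area l1 l2 l3 `^ (al / 2).

Definition symm_norm_bound (K : R) := forall l1 l2 l3 m1 m2 m3 : seg R,
  is_triangle l1 l2 l3 -> is_triangle m1 m2 m3 ->
  0 < tri_dist l1 l2 l3 m1 m2 m3 ->
  `|A_bdry A l1 l2 l3 - A_bdry A m1 m2 m3|
    <= K * tri_dist l1 l2 l3 m1 m2 m3 `^ (al / 2).

Lemma A_bdry_tri_seg p q r :
  A_bdry A (tri_seg p q) (tri_seg q r) (tri_seg r p) = circulation p q r.
Proof. by []. Qed.

Lemma A_bdry_lift (l1 l2 l3 : seg R) : is_triangle l1 l2 l3 ->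
  A_bdry A l1 l2 l3 =
  circulation l1.1 (padd l1.1 l1.2) (padd (padd l1.1 l1.2) l2.2).
Proof.
by move=> /is_triangle_unlift[E1 E2 E3]; rewrite -A_bdry_tri_seg -E1 -E2 -E3.
Qed.

Lemma circulation_collinear p q r : tri_det p q r = 0 ->
  enorm (psub q p) <= 4^-1 -> enorm (psub r q) <= 4^-1 ->
  enorm (psub p r) <= 4^-1 -> circulation p q r = 0.
Proof.
move=> D0 qp rq pr.
rewrite /circulation -(incr_collinear hA D0) //; last by rewrite enorm_sub_sym.
by rewrite (incr_opp hA (p := p) (q := r)) ?subrr // enorm_sub_sym.
Qed.

Lemma circulation_rev p q r :
  enorm (psub q p) <= 4^-1 -> enorm (psub r q) <= 4^-1 ->
  enorm (psub p r) <= 4^-1 -> circulation p r q = - circulation p q r.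
Proof.
move=> qp rq pr.
rewrite /circulation (incr_opp hA pr) (incr_opp hA rq) (incr_opp hA qp) -!opprD.
by congr (- _); rewrite [LHS]addrC addrA addrAC.
Qed.

Lemma tri_norm_bound_of (K : R) : 0 <= K -> tri_bound A al K ->
  tri_norm_bound (36 * K).
Proof.
move=> K0 hT l1 l2 l3 tri area0.
have [X1 [X2 X3]] : in_X l1 /\ in_X l2 /\ in_X l3 by case: tri.
have hD := tri_det_le_area l3 X1 X2.
have [n1 n2 n3] := is_triangle_sides tri.
rewrite (A_bdry_lift tri).
move: hD n1 n2 n3; set p := l1.1; set q := padd _ _; set r := padd _ _.
rewrite (_ : det2 l1.2 l2.2 = tri_det p q r); last first.
  by rewrite /r /q /tri_det/det2/psub/padd/=; ring.
move=> hD n1 n2 n3.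
apply: le_trans (hT _ _ _ n1 n2 n3) _.
rewrite [36 * K]mulrC -mulrA ler_wpM2l //.
by apply: powR_le_scale hD => //; [rewrite ler1n|exact: ltW].
Qed.

Lemma tri_bound_of_tri_norm (K : R) : 0 <= K -> tri_norm_bound K ->
  tri_bound A al (9 * K).
Proof.
move=> K0 hT p q r qp rq pr.
have [D0|D0] := eqVneq (tri_det p q r) 0.
  by rewrite circulation_collinear // normr0 !mulr_ge0 // powR_ge0.
have tri := is_triangle_lift D0 qp rq pr.
have [X1 [X2 X3]] : in_X (tri_seg p q) /\ in_X (tri_seg q r) /\ in_X (tri_seg r p).
  by case: tri.
have a0 : 0 < tri_area (tri_seg p q) (tri_seg q r) (tri_seg r p).
  have := tri_det_le_area (tri_seg r p) X1 X2; rewrite tri_seg_det.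
  have : 0 < `|tri_det p q r| by rewrite normr_gt0.
  lra.
have := hT _ _ _ tri a0; rewrite A_bdry_tri_seg => h; apply: le_trans h _.
rewrite [9 * K]mulrC -mulrA ler_wpM2l //.
apply: powR_le_scale => //; [by rewrite ler1n|exact: ltW|].
by rewrite -tri_seg_det; apply: tri_area_le_det => //; rewrite tri_seg_det.
Qed.

(** Compare a triangle with its own reversal: the circulations differ by twice one of them, and
    opposite orientations make the distance the sum of two areas, each at most 9 |D|. *)
Lemma tri_bound_of_symm_norm (K : R) : 0 <= K -> symm_norm_bound K ->
  tri_bound A al (18 * K).
Proof.
move=> K0 hS p q r qp rq pr.
have [D0|D0] := eqVneq (tri_det p q r) 0.
  by rewrite circulation_collinear // normr0 !mulr_ge0 // powR_ge0.
have Dr : tri_det p r q = - tri_det p q r.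
  by rewrite /tri_det /det2; ring.
have D0' : tri_det p r q != 0 by rewrite Dr oppr_eq0.
have [pq qr rp] : [/\ enorm (psub p q) <= 4^-1, enorm (psub q r) <= 4^-1 &
    enorm (psub r p) <= 4^-1] by split; rewrite enorm_sub_sym.
have tri := is_triangle_lift D0 qp rq pr.
have tri' := is_triangle_lift D0' rp qr pq.
have [X1 [X2 X3]] : in_X (tri_seg p q) /\ in_X (tri_seg q r) /\ in_X (tri_seg r p).
  by case: tri.
have [Y1 [Y2 Y3]] : in_X (tri_seg p r) /\ in_X (tri_seg r q) /\ in_X (tri_seg q p).
  by case: tri'.
have a1 := tri_det_le_area (tri_seg r p) X1 X2.
have a2 := @tri_area_le_det _ _ _ (tri_seg r p) X1 X2.
have b2 := @tri_area_le_det _ _ _ (tri_seg q p) Y1 Y2.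
rewrite tri_seg_det in a1 a2; rewrite tri_seg_det Dr oppr_eq0 normrN in b2.
have {}a2 := a2 D0; have {}b2 := b2 D0.
have b0 := tri_area_ge0 (tri_seg p r) (tri_seg r q) (tri_seg q p).
have Dgt0 : 0 < `|tri_det p q r| by rewrite normr_gt0.
have dE := tri_dist_rev D0.
have := hS _ _ _ _ _ _ tri tri'.
rewrite dE !A_bdry_tri_seg (circulation_rev qp rq pr) opprK -mulr2n normrMn.
exact: (powR_half_sum_le alh K0).
Qed.

End TriangleNorms.

(** * Nearly nonnegative inverse matrices *)

Section NearPermutation.
Variable R : realType.
Implicit Types g : R.

(** Each of a2 n2 and a3 n3 is at least -g(1+2g), so a1 n1 <= 2g(1+2g) <= 3g; division by a1 >= 1/3
    gives 9g. *)
Lemma small_entry g (a1 a2 a3 n1 n2 n3 : R) : 0 <= g <= 100^-1 ->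
  -g <= a1 -> -g <= a2 -> -g <= a3 -> a1 + a2 + a3 = 1 ->
  -g <= n1 -> -g <= n2 <= 1 + 2 * g -> -g <= n3 <= 1 + 2 * g ->
  a1 * n1 + a2 * n2 + a3 * n3 = 0 -> 3^-1 <= a1 -> n1 <= 9 * g.
Proof.
move=> /andP[g0 g1] h1 h2 h3 s k1 /andP[k2 k2'] /andP[k3 k3'] e a13.
have prod (x y : R) : -g <= x <= 1 + 2 * g -> -g <= y <= 1 + 2 * g ->
    - (g * (1 + 2 * g)) <= x * y.
  move=> /andP[x1 x2] /andP[y1 y2].
  have [x0|x0] := leP 0 x; have [y0|y0] := leP 0 y.
  - have := mulr_ge0 x0 y0; nra.
  - have := ler_wpM2l x0 y1; nra.
  - have := ler_wpM2l y0 x1; nra.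
  - have : 0 <= x * y by nra.
    nra.
have e2 : - (g * (1 + 2 * g)) <= a2 * n2 by apply: prod; lra.
have e3 : - (g * (1 + 2 * g)) <= a3 * n3 by apply: prod; lra.
have e1 : a1 * n1 <= 3 * g.
  have : g * g <= g * 100^-1 by rewrite ler_wpM2l.
  lra.
have [n0|n0] := leP n1 0; first by lra.
have := ler_wpM2r (ltW n0) a13; lra.
Qed.

(* Two mutually inverse matrices with rows of sum 1 and entries bounded below
   by -g are both within O(g) of a permutation matrix and its inverse. *)
Section Matrix.
Variables (g : R) (m n : nat -> nat -> R).
Hypothesis g01 : 0 <= g <= 100^-1.
Hypothesis ms : forall i, (i < 3)%N -> m i 0 + m i 1 + m i 2 = 1.
Hypothesis ns : forall i, (i < 3)%N -> n i 0 + n i 1 + n i 2 = 1.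
Hypothesis mg : forall i j, (i < 3)%N -> (j < 3)%N -> -g <= m i j.
Hypothesis ng : forall i j, (i < 3)%N -> (j < 3)%N -> -g <= n i j.
Hypothesis mn : forall i j, (i < 3)%N -> (j < 3)%N ->
  m i 0 * n 0 j + m i 1 * n 1 j + m i 2 * n 2 j = (i == j)%:R.

Lemma matrix_entry_le i j : (i < 3)%N -> (j < 3)%N -> n i j <= 1 + 2 * g.
Proof.
move=> i3 j3; have := ns i3.
have := ng i3 (isT : 0 < 3)%N; have := ng i3 (isT : 1 < 3)%N.
have := ng i3 (isT : 2 < 3)%N.
by case: j j3 => [|[|[|]]] //= _; lra.
Qed.

(** For j different from i the (i,j) entry of the product vanishes, so [small_entry] applies to
    [n k j]; the row sum then leaves at least 1 - 18g at place i. *)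
Lemma matrix_small_row i k : (i < 3)%N -> (k < 3)%N -> 3^-1 <= m i k ->
  (forall j, (j < 3)%N -> j <> i -> `|n k j| <= 9 * g) /\ 1 - 18 * g <= n k i.
Proof.
move=> i3 k3 mik.
have g0 : 0 <= g by case/andP: g01.
have small j : (j < 3)%N -> j <> i -> n k j <= 9 * g.
  move=> j3 ji; have e := mn i3 j3.
  have {}e : m i 0 * n 0 j + m i 1 * n 1 j + m i 2 * n 2 j = 0.
    by rewrite e; case: eqP => // ij; case: ji.
  have s := ms i3.
  have b l : (l < 3)%N -> -g <= n l j <= 1 + 2 * g.
    by move=> l3; rewrite ng // matrix_entry_le.
  case: k k3 mik => [|[|[|]]] //= _ mik.
  - by apply: (@small_entry g (m i 0) (m i 1) (m i 2) _ (n 1 j) (n 2 j)) => //;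
      rewrite ?b ?mg ?ng.
  - apply: (@small_entry g (m i 1) (m i 0) (m i 2) _ (n 0 j) (n 2 j)) => //;
      rewrite ?b ?mg ?ng //; lra.
  - apply: (@small_entry g (m i 2) (m i 0) (m i 1) _ (n 0 j) (n 1 j)) => //;
      rewrite ?b ?mg ?ng //; lra.
split.
  move=> j j3 ji; rewrite ler_norml small // andbT.
  by have := ng k3 j3; lra.
have := ns k3.
case: i i3 small {mik} => [|[|[|]]] //= _ small.
- have := small 1%N isT (fun e => ltac:(discriminate e)).
  have := small 2%N isT (fun e => ltac:(discriminate e)); lra.
- have := small 0%N isT (fun e => ltac:(discriminate e)).
  have := small 2%N isT (fun e => ltac:(discriminate e)); lra.
- have := small 0%N isT (fun e => ltac:(discriminate e)).
  have := small 1%N isT (fun e => ltac:(discriminate e)); lra.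
Qed.

End Matrix.

(** Near the transposition of the last two indices the term -a11 a23 a32 dominates. As g <= 1/100,
    large entries are at least 82/100 and small ones at most 9/100. *)
Lemma det_transposition_lt0 g (a11 a12 a13 a21 a22 a23 a31 a32 a33 : R) :
  0 <= g <= 100^-1 -> 1 - 18 * g <= a11 -> `|a12| <= 9 * g -> `|a13| <= 9 * g ->
  `|a21| <= 9 * g -> `|a22| <= 9 * g -> 1 - 18 * g <= a23 -> `|a31| <= 9 * g ->
  1 - 18 * g <= a32 -> `|a33| <= 9 * g -> a11 <= 2 -> a23 <= 2 -> a32 <= 2 ->
  a11 * (a22 * a33 - a23 * a32) - a12 * (a21 * a33 - a23 * a31)
  + a13 * (a21 * a32 - a22 * a31) < 0.
Proof.
move=> /andP[g0 g1] h11 h12 h13 h21 h22 h23 h31 h32 h33 k11 k23 k32.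
pose s : R := 9 / 100.
have le9 (x : R) : `|x| <= 9 * g -> `|x| <= s by rewrite /s; lra.
move/le9: h12 => h12; move/le9: h13 => h13; move/le9: h21 => h21.
move/le9: h22 => h22; move/le9: h31 => h31; move/le9: h33 => h33.
have pr (x y b c : R) : `|x| <= b -> `|y| <= c -> `|x * y| <= b * c.
  by move=> hx hy; rewrite normrM ler_pM.
have b2 (x : R) : 1 - 18 * g <= x -> x <= 2 -> `|x| <= 2.
  by move=> ? ?; rewrite ler_norml; apply/andP; split; lra.
have q1 : `|a22 * a33| <= s * s by exact: pr.
have q2 : 82 / 100 * (82 / 100) <= a23 * a32 by apply: ler_pM; lra.
have q3 : `|a21 * a33| <= s * s by exact: pr.
have q4 : `|a23 * a31| <= 2 * s by apply: pr => //; exact: b2.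
have q5 : `|a21 * a32| <= s * 2 by apply: pr => //; exact: b2.
have q6 : `|a22 * a31| <= s * s by exact: pr.
have r2 : `|a12 * (a21 * a33 - a23 * a31)| <= s * (s * s + 2 * s).
  by apply: pr => //; apply: le_trans (ler_normB _ _) _; exact: lerD.
have r3 : `|a13 * (a21 * a32 - a22 * a31)| <= s * (s * 2 + s * s).
  by apply: pr => //; apply: le_trans (ler_normB _ _) _; exact: lerD.
have r1 : a11 * (a22 * a33 - a23 * a32) <= 82 / 100 * (s * s - 82 / 100 * (82 / 100)).
  move: q1; rewrite ler_norml => /andP[_ q1].
  have : 82 / 100 * (82 / 100) - s * s <= a23 * a32 - a22 * a33 by lra.
  have c0 : 0 <= 82 / 100 * (82 / 100) - s * s by rewrite /s; lra.
  move=> q7; have h82 : 82 / 100 <= a11 by lra.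
  have d0 : 0 <= 82 / 100 :> R by lra.
  have := ler_pM d0 c0 h82 q7; lra.
move: r2 r3; rewrite !ler_norml => /andP[r2 _] /andP[_ r3].
move: r1 r2 r3; rewrite /s; lra.
Qed.

(** The nearby permutation fixes index 0 because n00 is large; of the two that remain, the sign of
    the determinant rules out the transposition. *)
Lemma near_identity g (m n : nat -> nat -> R) : 0 <= g <= 100^-1 ->
  (forall i, (i < 3)%N -> m i 0 + m i 1 + m i 2 = 1) ->
  (forall i, (i < 3)%N -> n i 0 + n i 1 + n i 2 = 1) ->
  (forall i j, (i < 3)%N -> (j < 3)%N -> -g <= m i j) ->
  (forall i j, (i < 3)%N -> (j < 3)%N -> -g <= n i j) ->
  (forall i j, (i < 3)%N -> (j < 3)%N ->
    m i 0 * n 0 j + m i 1 * n 1 j + m i 2 * n 2 j = (i == j)%:R) ->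
  (forall i j, (i < 3)%N -> (j < 3)%N ->
    n i 0 * m 0 j + n i 1 * m 1 j + n i 2 * m 2 j = (i == j)%:R) ->
  3^-1 <= n 0 0 ->
  0 <= m 0 0 * (m 1 1 * m 2 2 - m 1 2 * m 2 1)
    - m 0 1 * (m 1 0 * m 2 2 - m 1 2 * m 2 0)
    + m 0 2 * (m 1 0 * m 2 1 - m 1 1 * m 2 0) ->
  forall i j, (i < 3)%N -> (j < 3)%N -> i <> j ->
    `|m i j| <= 9 * g /\ `|n i j| <= 9 * g.
Proof.
move=> g01 ms ns mg ng mn nm n00 det0.
have [g0 g1] := andP g01.
have N2M i k := @matrix_small_row g n m g01 ns ms ng mg nm i k.
have M2N i k := @matrix_small_row g m n g01 ms ns mg ng mn i k.
have big x : 1 - 18 * g <= x -> 3^-1 <= x by lra.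
have nbig x : `|x| <= 9 * g -> ~ 1 - 18 * g <= x.
  by rewrite ler_norml => /andP[_ ?] ?; lra.
have max3 i : (i < 3)%N -> [\/ 3^-1 <= n i 0, 3^-1 <= n i 1 | 3^-1 <= n i 2].
  move=> /ns s; have [h|h] := leP 3^-1 (n i 0); first exact: Or31.
  have [h'|h'] := leP 3^-1 (n i 1); first exact: Or32.
  by apply: Or33; lra.
have [m0 m00] := N2M 0%N 0%N isT isT n00.
have [n0 _] := M2N 0%N 0%N isT isT (big _ m00).
(* Large entries in rows 0 and i of this column would put row 0 of m near two different unit
   vectors. *)
have not0 i : (i < 3)%N -> i <> 0%N -> ~ 3^-1 <= n i 0.
  move=> i3 i0 h; have [h' _] := N2M i 0%N i3 isT h.
  by apply: nbig m00; apply: h' => // e; apply: i0.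
case: (max3 1%N isT) => h1; first by have := not0 1%N isT (ltac:(discriminate)) h1.
  have [m1 m11] := N2M 1%N 1%N isT isT h1.
  have [n1 _] := M2N 1%N 1%N isT isT (big _ m11).
  case: (max3 2%N isT) => h2; first by have := not0 2%N isT (ltac:(discriminate)) h2.
    have [h' _] := N2M 2%N 1%N isT isT h2.
    by case: (nbig _ (h' 1%N isT (ltac:(discriminate)))).
  have [m2 m22] := N2M 2%N 2%N isT isT h2.
  have [n2 _] := M2N 2%N 2%N isT isT (big _ m22).
  move=> i j i3 j3 ij; have ji : j <> i by move=> e; apply: ij.
  by case: i i3 ij ji => [|[|[|]]] //= _ ij ji; split; auto.
have [m2 m21] := N2M 1%N 2%N isT isT h1.
case: (max3 2%N isT) => h2; first by have := not0 2%N isT (ltac:(discriminate)) h2.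
  have [m1 m12] := N2M 2%N 1%N isT isT h2.
  exfalso; move: det0; apply/negP; rewrite -ltNge.
  have le2 i j : (i < 3)%N -> (j < 3)%N -> m i j <= 2.
    by move=> i3 j3; have := @matrix_entry_le g m ms mg i j i3 j3; lra.
  apply: (@det_transposition_lt0 g) => //; try exact: le2.
  - exact: m0.
  - exact: m0.
  - exact: m1.
  - exact: m1.
  - exact: m2.
  - exact: m2.
have [h' _] := N2M 2%N 2%N isT isT h2.
by case: (nbig _ (h' 1%N isT (ltac:(discriminate)))).
Qed.

End NearPermutation.

(** * Symmetric difference and barycentric depth *)

Section Barycentric.
Variable R : realType.
Local Notation pt := (pt R).
Implicit Types p q r z : pt.

(** The barycentric coordinate at the first vertex; rotating the triangle gives the other two. *)
Definition coef p q r z : R := tri_det z q r / tri_det p q r.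

Lemma sum_coef p q r z : tri_det p q r != 0 ->
  coef p q r z + coef q r p z + coef r p q z = 1.
Proof.
move=> D0; rewrite /coef -(tri_det_rot p q r) (tri_det_rot r p q) -!mulrDl.
rewrite (_ : _ + _ = tri_det p q r) ?mulfV //.
by rewrite /tri_det/det2/psub/=; ring.
Qed.

Lemma coef_bary p q r (u v w : pt) (a b c : R) : a + b + c = 1 ->
  coef p q r (bary u v w a b c) = a * coef p q r u + b * coef p q r v + c * coef p q r w.
Proof.
move=> s; rewrite /coef !mulrA -!mulrDl; congr (_ / _).
have -> : a = 1 - b - c by lra.
by rewrite /tri_det/bary/det2/psub/padd/pscale/=; ring.
Qed.

Lemma bary_coef p q r z : tri_det p q r != 0 ->
  z = bary p q r (coef p q r z) (coef q r p z) (coef r p q z).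
Proof.
rewrite /coef -(tri_det_rot p q r) (tri_det_rot r p q).
case: z => z1 z2; rewrite /bary/tri_det/det2/psub/padd/pscale/= => D0.
by congr pair; field.
Qed.

Lemma coef_self p q r : tri_det p q r != 0 -> coef p q r p = 1.
Proof. by move=> D0; rewrite /coef mulfV. Qed.

Lemma coef_other1 p q r : coef p q r q = 0.
Proof. by rewrite /coef /tri_det/det2/psub/=; ring. Qed.

Lemma coef_other2 p q r : coef p q r r = 0.
Proof. by rewrite /coef /tri_det/det2/psub/=; ring. Qed.

(* Averaging with the exterior point z maps the part of Y covered by Q into
   Q \ P, so |P sym.diff Q| controls |Y|, which is of order t |P|. *)
Lemma symdiff_ge_depth (p1 p2 p3 q1 q2 q3 z : pt) (d : R) :
  tri_det p1 p2 p3 != 0 -> tri_det q1 q2 q3 != 0 -> ctri q1 q2 q3 z ->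
  (leb2 ((otri p1 p2 p3 `\` otri q1 q2 q3) `|`
         (otri q1 q2 q3 `\` otri p1 p2 p3)) <= d%:E)%E ->
  coef p1 p2 p3 z < 0 ->
  Num.min (- coef p1 p2 p3 z) 1 * `|tri_det p1 p2 p3| <= 20 * d.
Proof.
move=> D1 D2 zQ hd zlt0.
set P := otri p1 p2 p3 in hd *; set Q := otri q1 q2 q3 in hd *.
(* Capping the depth at 1 keeps the point [p1'] below on the side p1 p2. *)
set t : R := Num.min _ _.
have t1 : t <= 1 by rewrite /t ge_min lexx orbT.
have tz : t <= - coef p1 p2 p3 z by rewrite /t ge_min lexx.
have t0 : 0 < t by rewrite /t lt_min ltr01 andbT oppr_gt0.
clearbody t.
pose p1' := bary p1 p2 p3 t (1 - t) 0.
have D1' : tri_det p1' p2 p3 = t * tri_det p1 p2 p3.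
  by rewrite /p1' /tri_det/bary/det2/psub/padd/pscale/=; ring.
pose Y := otri p1' p2 p3.
have mY : measurable Y by apply: measurable_otri; rewrite D1' mulf_neq0 // gt_eqF.
have mP : measurable P by exact: measurable_otri.
have mQ : measurable Q by exact: measurable_otri.
have YP x : Y x -> P x /\ coef p1 p2 p3 x < t.
  move=> [a [b [c [a0 [b0 [c0 [s ->]]]]]]].
  have -> : bary p1' p2 p3 a b c = bary p1 p2 p3 (a * t) (b + a * (1 - t)) c.
    by rewrite /p1' /bary/padd/pscale/=; congr pair; ring.
  have at0 : 0 < a * t by rewrite mulr_gt0.
  have s' : a * t + (b + a * (1 - t)) + c = 1 by rewrite -[RHS]s; ring.
  split.
    exists (a * t), (b + a * (1 - t)), c; do !split => //.
    by rewrite ltr_pwDl // mulr_ge0 ?subr_ge0 // ltW.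
  rewrite coef_bary // coef_self // coef_other1 coef_other2 !mulr0 !addr0 mulr1.
  by rewrite gtr_pMl //; lra.
have hY := (triangle_measure p1' p2 p3).1; rewrite D1' -/Y in hY.
have mPQ : measurable (P `\` Q) by exact: measurableD.
have mQP : measurable (Q `\` P) by exact: measurableD.
have hPQ : (leb2 (P `\` Q) <= d%:E)%E.
  by apply: le_trans hd; apply: leb2_mono => x; left.
have hQP : (leb2 (Q `\` P) <= d%:E)%E.
  by apply: le_trans hd; apply: leb2_mono => x; right.
(* The midpoint with z: a point of coordinate less than t goes to a point of negative coordinate,
   outside P. Areas shrink by 4. *)
pose phi := homothety 2^-1 (2^-1 * z.1) (2^-1 * z.2).
have hphi : (leb2 (phi @^-1` (Q `\` P)) <= (4 * d)%:E)%E.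
  have -> : leb2 (phi @^-1` (Q `\` P)) = (4%:E * leb2 (Q `\` P))%E.
    rewrite (@leb2_homothety _ 2^-1 (2^-1 * z.1) (2^-1 * z.2) (Q `\` P)) //.
    by rewrite muleA -EFinM (_ : 4 * 2^-1 ^+ 2 = 1) ?mul1e //; field.
  by rewrite EFinM; apply: lee_wpmul2l.
have YQ : Y `&` Q `<=` phi @^-1` (Q `\` P).
  move=> x [/YP[_ xt] Qx].
  have phiE : phi x = bary x z x 2^-1 2^-1 0.
    by rewrite /phi /homothety /bary/padd/pscale/=; congr pair; ring.
  split.
    rewrite phiE; case: zQ => [a [b [c [a0 [b0 [c0 [s ->]]]]]]].
    case: Qx => [a' [b' [c' [a0' [b0' [c0' [s' ->]]]]]]].
    exists (2^-1 * (a + a')), (2^-1 * (b + b')), (2^-1 * (c + c')).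
    do 4 (split; first lra).
    by rewrite /bary/padd/pscale/=; congr pair; ring.
  rewrite phiE => /(otriP _ D1)[+ _ _]; rewrite -/(coef p1 p2 p3 _).
  by rewrite coef_bary; lra.
(* 5 = 1 + 4: d for the part of Y outside Q and 4d for the part inside. Since |Y| >= t |D| / 4, this
   yields 20 d. *)
have : (leb2 Y <= (5 * d)%:E)%E.
  apply: (@le_trans _ _ (leb2 ((P `\` Q) `|` phi @^-1` (Q `\` P)))).
    apply: leb2_mono => x Yx; have [Px _] := YP _ Yx.
    by have [Qx|Qx] := pselect (Q x); [right; exact: YQ|left].
  apply: (@le_trans _ _ (leb2 (P `\` Q) + leb2 (phi @^-1` (Q `\` P)))%E).
    by apply: measureU2 => //; exact: measurable_homothety_preimage.
  have -> : (5 * d)%:E = (d%:E + (4 * d)%:E)%E by rewrite -EFinD; congr EFin; ring.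
  exact: leeD.
move=> /(le_trans hY); rewrite lee_fin normrM (gtr0_norm t0); lra.
Qed.

Lemma symdiff_ge_tri_det (p1 p2 p3 q1 q2 q3 : pt) (d : R) :
  tri_det p1 p2 p3 != 0 -> tri_det q1 q2 q3 != 0 ->
  (leb2 ((otri p1 p2 p3 `\` otri q1 q2 q3) `|`
         (otri q1 q2 q3 `\` otri p1 p2 p3)) <= d%:E)%E ->
  `|tri_det p1 p2 p3| <= 4 * (`|tri_det q1 q2 q3| + d).
Proof.
move=> D1 D2 hd; have h1 := (triangle_measure p1 p2 p3).1.
have h2 := (triangle_measure q1 q2 q3).2.
set P := otri p1 p2 p3 in hd h1 *; set Q := otri q1 q2 q3 in hd *.
have mP : measurable P by exact: measurable_otri.
have mQ : measurable Q by exact: measurable_otri.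
have h3 : (leb2 P <= (`|tri_det q1 q2 q3| + d)%:E)%E.
  apply: (@le_trans _ _ (leb2 (Q `|` (P `\` Q)))).
    apply: leb2_mono => x Px.
    by have [Qx|Qx] := pselect (Q x); [left|right].
  apply: (@le_trans _ _ (leb2 Q + leb2 (P `\` Q))%E).
    by apply: measureU2 => //; exact: measurableD.
  rewrite EFinD; apply: leeD.
    apply: le_trans h2; apply: leb2_mono => x [a [b [c [a0 [b0 [c0 [s ->]]]]]]].
    by exists a, b, c; do !split => //; exact: ltW.
  by apply: le_trans hd; apply: leb2_mono => x; left.
by have := le_trans h1 h3; rewrite lee_fin; lra.
Qed.

End Barycentric.

(** * Matching the vertices of two close triangles *)

Section CloseTriangles.
Variable R : realType.
Local Notation pt := (pt R).
Implicit Types p q r z : pt.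

Definition depth_le (g : R) p q r z : Prop :=
  [/\ - g <= coef p q r z, - g <= coef q r p z & - g <= coef r p q z].

Lemma coef_comp (p1 p2 p3 u v w z : pt) : tri_det u v w != 0 ->
  coef u v w z * coef p1 p2 p3 u + coef v w u z * coef p1 p2 p3 v
  + coef w u v z * coef p1 p2 p3 w = coef p1 p2 p3 z.
Proof.
by move=> D0; rewrite [in RHS](bary_coef z D0) coef_bary // sum_coef.
Qed.

(** Row i holds the coordinates of the i-th q in the triangle of the p's. Exchanging the triangles
    inverts the matrix, by [coef_comp]. *)
Let mat (p1 p2 p3 q1 q2 q3 : pt) (i j : nat) : R :=
  let z := nth q1 [:: q1; q2; q3] i in
  nth 0 [:: coef p1 p2 p3 z; coef p2 p3 p1 z; coef p3 p1 p2 z] j.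

Let mat_sum p1 p2 p3 q1 q2 q3 i : tri_det p1 p2 p3 != 0 -> (i < 3)%N ->
  mat p1 p2 p3 q1 q2 q3 i 0 + mat p1 p2 p3 q1 q2 q3 i 1
  + mat p1 p2 p3 q1 q2 q3 i 2 = 1.
Proof. by move=> D0 _; exact: sum_coef. Qed.

Let mat_ge p1 p2 p3 q1 q2 q3 g i j : depth_le g p1 p2 p3 q1 ->
  depth_le g p1 p2 p3 q2 -> depth_le g p1 p2 p3 q3 -> (i < 3)%N -> (j < 3)%N ->
  - g <= mat p1 p2 p3 q1 q2 q3 i j.
Proof.
by move=> [? ? ?] [? ? ?] [? ? ?]; case: i => [|[|[|]]] // _;
  case: j => [|[|[|]]].
Qed.

Let mat_mul p1 p2 p3 q1 q2 q3 i j : tri_det p1 p2 p3 != 0 ->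
  tri_det q1 q2 q3 != 0 -> (i < 3)%N -> (j < 3)%N ->
  mat p1 p2 p3 q1 q2 q3 i 0 * mat q1 q2 q3 p1 p2 p3 0 j +
  mat p1 p2 p3 q1 q2 q3 i 1 * mat q1 q2 q3 p1 p2 p3 1 j +
  mat p1 p2 p3 q1 q2 q3 i 2 * mat q1 q2 q3 p1 p2 p3 2 j = (i == j)%:R.
Proof.
move=> D1 D2 i3 j3.
have D2' : tri_det q2 q3 q1 != 0 by rewrite -tri_det_rot.
have D2'' : tri_det q3 q1 q2 != 0 by rewrite tri_det_rot.
case: j j3 => [|[|[|]]] // _; rewrite /mat /= coef_comp //;
  case: i i3 => [|[|[|]]] // _ /=;
  by rewrite ?coef_self ?coef_other1 ?coef_other2.
Qed.

Lemma close_vertices_aligned (p1 p2 p3 q1 q2 q3 : pt) (g : R) :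
  0 <= g <= 100^-1 -> 0 < tri_det p1 p2 p3 * tri_det q1 q2 q3 ->
  depth_le g p1 p2 p3 q1 -> depth_le g p1 p2 p3 q2 -> depth_le g p1 p2 p3 q3 ->
  depth_le g q1 q2 q3 p1 -> depth_le g q1 q2 q3 p2 -> depth_le g q1 q2 q3 p3 ->
  3^-1 <= coef q1 q2 q3 p1 ->
  [/\ `|coef p2 p3 p1 q1| <= 9 * g /\ `|coef p3 p1 p2 q1| <= 9 * g,
      `|coef p1 p2 p3 q2| <= 9 * g /\ `|coef p3 p1 p2 q2| <= 9 * g,
      `|coef p1 p2 p3 q3| <= 9 * g /\ `|coef p2 p3 p1 q3| <= 9 * g &
      [/\ `|coef q3 q1 q2 p1| <= 9 * g, `|coef q1 q2 q3 p2| <= 9 * g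
        & `|coef q2 q3 q1 p3| <= 9 * g]].
Proof.
move=> g01 DD P1 P2 P3 Q1 Q2 Q3 n00.
have [D1 D2] : tri_det p1 p2 p3 != 0 /\ tri_det q1 q2 q3 != 0.
  by apply/andP; rewrite -negb_or -mulf_eq0 gt_eqF.
(* The determinant of the coordinate matrix is the quotient of the signed areas, positive for equal
   orientations. *)
have det0 : 0 <= coef p1 p2 p3 q1 * (coef p2 p3 p1 q2 * coef p3 p1 p2 q3
      - coef p3 p1 p2 q2 * coef p2 p3 p1 q3)
    - coef p2 p3 p1 q1 * (coef p1 p2 p3 q2 * coef p3 p1 p2 q3
      - coef p3 p1 p2 q2 * coef p1 p2 p3 q3)
    + coef p3 p1 p2 q1 * (coef p1 p2 p3 q2 * coef p2 p3 p1 q3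
      - coef p2 p3 p1 q2 * coef p1 p2 p3 q3).
  rewrite [leRHS](_ : _ = tri_det p1 p2 p3 * tri_det q1 q2 q3 / tri_det p1 p2 p3 ^+ 2).
    by rewrite divr_ge0 ?sqr_ge0 // ltW.
  rewrite /coef -(tri_det_rot p1 p2 p3) (tri_det_rot p3 p1 p2).
  move: D1; rewrite /tri_det/det2/psub/= => D1; by field.
have := @near_identity R g (mat p1 p2 p3 q1 q2 q3) (mat q1 q2 q3 p1 p2 p3) g01
  (fun i => @mat_sum p1 p2 p3 q1 q2 q3 i D1) (fun i => @mat_sum q1 q2 q3 p1 p2 p3 i D2)
  (fun i j => @mat_ge p1 p2 p3 q1 q2 q3 g i j P1 P2 P3)
  (fun i j => @mat_ge q1 q2 q3 p1 p2 p3 g i j Q1 Q2 Q3)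
  (fun i j => @mat_mul p1 p2 p3 q1 q2 q3 i j D1 D2)
  (fun i j => @mat_mul q1 q2 q3 p1 p2 p3 i j D2 D1) n00 det0 => h.
split.
- by split; [have := h 0%N 1%N|have := h 0%N 2%N]; case.
- by split; [have := h 1%N 0%N|have := h 1%N 2%N]; case.
- by split; [have := h 2%N 0%N|have := h 2%N 1%N]; case.
- by split; [have := h 0%N 2%N|have := h 1%N 0%N|have := h 2%N 1%N]; case.
Qed.

Lemma depth_le_rot g p q r z : depth_le g p q r z -> depth_le g q r p z.
Proof. by case. Qed.

Lemma coef_max p q r z : tri_det p q r != 0 ->
  [\/ 3^-1 <= coef p q r z, 3^-1 <= coef q r p z | 3^-1 <= coef r p q z].
Proof.
move=> /(sum_coef z).
move: (coef p q r z) (coef q r p z) (coef r p q z) => a b c s.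
have [h|h] := leP 3^-1 a; first exact: Or31.
have [h'|h'] := leP 3^-1 b; first exact: Or32.
by apply: Or33; lra.
Qed.

Lemma depth_of_symdiff (p1 p2 p3 q1 q2 q3 z : pt) (d g : R) :
  tri_det p1 p2 p3 != 0 -> tri_det q1 q2 q3 != 0 -> ctri q1 q2 q3 z ->
  (leb2 ((otri p1 p2 p3 `\` otri q1 q2 q3) `|`
         (otri q1 q2 q3 `\` otri p1 p2 p3)) <= d%:E)%E ->
  0 <= g < 1 -> 20 * d <= g * `|tri_det p1 p2 p3| -> depth_le g p1 p2 p3 z.
Proof.
move=> D1 D2 zQ hd g01 dg.
have one (a b c : pt) : tri_det a b c != 0 -> otri a b c = otri p1 p2 p3 ->
    tri_det a b c = tri_det p1 p2 p3 -> - g <= coef a b c z.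
  move=> D O DE; rewrite leNgt; apply/negP => lt.
  have zlt0 : coef a b c z < 0 by case/andP: g01 => ? ?; lra.
  have D0 : 0 < `|tri_det p1 p2 p3| by rewrite normr_gt0.
  have := @symdiff_ge_depth R a b c q1 q2 q3 z d D D2 zQ.
  rewrite O DE => /(_ hd zlt0) h.
  (* As g < 1, the minimum is not its cap 1, so the depth itself is at most g. *)
  have : Num.min (- coef a b c z) 1 <= g.
    by have := le_trans h dg; rewrite ler_pM2r.
  by clear hd; rewrite ge_min => /orP[]; case/andP: g01 => ? ? ?; lra.
split; apply: one => //.
- by rewrite -tri_det_rot.
- by rewrite -otri_rot.
- by rewrite -tri_det_rot.
- by rewrite tri_det_rot.
- by rewrite otri_rot.
- by rewrite tri_det_rot.
Qed.

Lemma ctri_vertex (p q r : pt) : [/\ ctri p q r p, ctri p q r q & ctri p q r r].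
Proof.
split.
- exists 1, 0, 0; do !split => //; first lra.
  by case: p => ? ?; rewrite /bary/padd/pscale/=; congr pair; ring.
- exists 0, 1, 0; do !split => //; first lra.
  by case: q => ? ?; rewrite /bary/padd/pscale/=; congr pair; ring.
- exists 0, 0, 1; do !split => //; first lra.
  by case: r => ? ?; rewrite /bary/padd/pscale/=; congr pair; ring.
Qed.

Lemma coef_close (p q r z : pt) (s L : R) : tri_det p q r != 0 ->
  enorm (psub q p) <= L -> enorm (psub r p) <= L ->
  `|coef q r p z| <= s -> `|coef r p q z| <= s -> enorm (psub z p) <= 2 * s * L.
Proof.
move=> D0 qp rp hb hc.
have -> : psub z p = padd (pscale (coef q r p z) (psub q p))
    (pscale (coef r p q z) (psub r p)).
  rewrite {1}(bary_coef z D0); have := sum_coef z D0.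
  move: (coef p q r z) (coef q r p z) (coef r p q z) => a b c e.
  have -> : a = 1 - b - c by lra.
  by rewrite /bary/psub/padd/pscale/=; congr pair; ring.
apply: le_trans (enorm_add _ _) _; rewrite !enorm_scale.
have -> : 2 * s * L = s * L + s * L by ring.
by apply: lerD; apply: ler_pM => //; exact: enorm_ge0.
Qed.

End CloseTriangles.

(** * Circulations with sides up to 1/2 *)

Section LongIncrements.
Variables (R : realType) (E : normedModType R) (A : seg R -> E).
Local Notation pt := (pt R).
Implicit Types p q r : pt.
Hypothesis hA : additive_on_joins A.
Variable al : R.
Hypothesis al01 : 0 <= al <= 1.
Local Notation incr := (incr A).
Local Notation circulation := (circulation A).

Let alh : 0 <= al / 2 <= 1. Proof. by case/andP: al01 => h1 h2; lra. Qed.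

(* Increment along a segment of length up to 1/2, cut at its midpoint. *)
Definition lincr p q : E := incr p (midpoint p q) + incr (midpoint p q) q.

(** A segment from a vertex of one triangle to a vertex of a nearby one may be longer than 1/4, out
    of reach of [circulation]. *)
Definition lcirculation p q r : E := lincr p q + lincr q r + lincr r p.

Lemma midpoint_sym p q : midpoint p q = midpoint q p.
Proof. by rewrite /midpoint/padd/pscale/=; congr pair; ring. Qed.

Lemma midpoint_half p q : enorm (psub q p) <= 2^-1 ->
  enorm (psub (midpoint p q) p) <= 4^-1 /\ enorm (psub q (midpoint p q)) <= 4^-1.
Proof.
have -> : psub (midpoint p q) p = pscale 2^-1 (psub q p).
  by rewrite /midpoint/psub/padd/pscale/=; congr pair; field.
have -> : psub q (midpoint p q) = pscale 2^-1 (psub q p).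
  by rewrite /midpoint/psub/padd/pscale/=; congr pair; field.
rewrite enorm_scale ger0_norm // => h.
by rewrite (_ : 4^-1 = 2^-1 * 2^-1); [rewrite ler_pM2l|field].
Qed.

Lemma lincr_opp p q : enorm (psub q p) <= 2^-1 -> lincr q p = - lincr p q.
Proof.
move=> /midpoint_half[h1 h2].
rewrite /lincr (midpoint_sym q p) (incr_opp hA h1) (incr_opp hA h2).
by rewrite opprD addrC.
Qed.

Lemma lincrE p q : enorm (psub q p) <= 4^-1 -> lincr p q = incr p q.
Proof.
move=> h; have h' : enorm (psub q p) <= 2^-1 by lra.
have [h1 h2] := midpoint_half h'.
rewrite /lincr -(incr_collinear hA) //.
by rewrite /midpoint /tri_det /det2 /psub/pscale/padd/=; field.
Qed.

Lemma subdivision_sum (V : zmodType) (a1 a2 b1 b2 c1 c2 x y z : V) :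
  (a1 + x + a2) + (b1 + b2 + y) + (c1 + c2 + z) + (- y - z - x)
  = (a1 + b1) + (b2 + c1) + (c2 + a2).
Proof.
rewrite -!opprD; apply/eqP; rewrite subr_eq; apply/eqP.
by rewrite [LHS](AC (3*3*3) ((1*4)*(5*7)*(8*3)*(6*9*2))).
Qed.

(** The three midpoints cut the triangle into four with half the sides and a quarter of the
    determinant; the inner increments cancel. *)
Lemma lcirculation_bound (K : R) p q r : 0 <= K -> tri_bound A al K ->
  enorm (psub q p) <= 2^-1 -> enorm (psub r q) <= 2^-1 ->
  enorm (psub p r) <= 2^-1 ->
  `|lcirculation p q r| <= 4 * K * `|tri_det p q r| `^ (al / 2).
Proof.
move=> K0 hT qp rq pr.
have [a1 a2] := midpoint_half qp; have [b1 b2] := midpoint_half rq.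
have [c1 c2] := midpoint_half pr.
set u := midpoint p q in a1 a2; set v := midpoint q r in b1 b2.
set w := midpoint r p in c1 c2.
have half (x y z : pt) : enorm (psub y x) <= 2^-1 ->
    enorm (psub (midpoint y z) (midpoint x z)) <= 4^-1.
  have -> : psub (midpoint y z) (midpoint x z) = pscale 2^-1 (psub y x).
    by rewrite /midpoint/psub/padd/pscale/=; congr pair; field.
  rewrite enorm_scale ger0_norm // => h.
  by rewrite (_ : 4^-1 = 2^-1 * 2^-1); [rewrite ler_pM2l|field].
have uv : enorm (psub v u) <= 4^-1.
  by rewrite /u /v (midpoint_sym q r); apply: half; rewrite enorm_sub_sym.
have vw : enorm (psub w v) <= 4^-1.
  by rewrite /v /w (midpoint_sym r p); apply: half; rewrite enorm_sub_sym.
have wu : enorm (psub u w) <= 4^-1.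
  by rewrite /w /u (midpoint_sym p q); apply: half; rewrite enorm_sub_sym.
have -> : lcirculation p q r = circulation p u w + circulation u q v
    + (circulation v r w) + circulation u v w.
  rewrite /circulation.
  rewrite (incr_opp hA (p := v) (q := u)) 1?enorm_sub_sym //.
  rewrite (incr_opp hA (p := w) (q := v)) 1?enorm_sub_sym //.
  rewrite (incr_opp hA (p := u) (q := w)) 1?enorm_sub_sym //.
  by rewrite subdivision_sum.
have D4 (x : R) : x = tri_det p q r / 4 -> `|x| `^ (al / 2) <= `|tri_det p q r| `^ (al / 2).
  move=> ->; apply: powR_le => //; first by case/andP: alh.
  by rewrite normrM [`|4^-1|]ger0_norm // ler_piMr // invf_le1 // ler1n.
have bnd x y z : enorm (psub y x) <= 4^-1 -> enorm (psub z y) <= 4^-1 ->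
    enorm (psub x z) <= 4^-1 -> tri_det x y z = tri_det p q r / 4 ->
    `|circulation x y z| <= K * `|tri_det p q r| `^ (al / 2).
  move=> h1 h2 h3 e; apply: le_trans (hT _ _ _ h1 h2 h3) _.
  by rewrite ler_wpM2l // D4.
have e1 : `|circulation p u w| <= K * `|tri_det p q r| `^ (al / 2).
  apply: bnd => //; first by rewrite enorm_sub_sym.
  by rewrite /u /w /midpoint/tri_det/det2/psub/padd/pscale/=; field.
have e2 : `|circulation u q v| <= K * `|tri_det p q r| `^ (al / 2).
  apply: bnd => //; first by rewrite enorm_sub_sym.
  by rewrite /u /v /midpoint/tri_det/det2/psub/padd/pscale/=; field.
have e3 : `|circulation v r w| <= K * `|tri_det p q r| `^ (al / 2).
  apply: bnd => //; first by rewrite enorm_sub_sym.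
  by rewrite /w /v /midpoint/tri_det/det2/psub/padd/pscale/=; field.
have e4 : `|circulation u v w| <= K * `|tri_det p q r| `^ (al / 2).
  apply: bnd => //.
  by rewrite /w /v /u /midpoint/tri_det/det2/psub/padd/pscale/=; field.
apply: le_trans (ler_normD _ _) _.
apply: le_trans (lerD (ler_normD _ _) e4) _.
apply: le_trans (lerD (lerD (ler_normD _ _) e3) (lexx _)) _.
apply: le_trans (lerD (lerD (lerD e1 e2) (lexx _)) (lexx _)) _.
by rewrite le_eqVlt; apply/orP; left; apply/eqP; ring.
Qed.

End LongIncrements.

(** * Difference of circulations of two plane triangles *)

Section SymmetricBound.
Variables (R : realType) (E : normedModType R) (A : seg R -> E).
Local Notation pt := (pt R).
Implicit Types p q r : pt.
Hypothesis hA : additive_on_joins A.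
Variable al : R.
Hypothesis al01 : 0 <= al <= 1.
Local Notation incr := (incr A).
Local Notation circulation := (circulation A).
Local Notation lincr := (lincr A).
Local Notation lcirculation := (lcirculation A).

Let alh : 0 <= al / 2 <= 1. Proof. by case/andP: al01 => h1 h2; lra. Qed.
Let alh0 : 0 <= al / 2. Proof. by case/andP: alh. Qed.

Definition small_sides p q r : Prop :=
  [/\ enorm (psub q p) <= 4^-1, enorm (psub r q) <= 4^-1
    & enorm (psub p r) <= 4^-1].

Lemma small_sides_rot p q r : small_sides p q r -> small_sides q r p.
Proof. by case. Qed.

Lemma quad_sum (V : zmodType) (P Q u u' w : V) :
  (P + u' - w) + (w - Q - u) = (P - Q) + (u' - u).
Proof. by rewrite -(addrA w) [LHS]addrA subrK addrACA. Qed.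

Lemma telescope3 (V : zmodType) (P1 P2 P3 Q1 Q2 Q3 u1 u2 u3 : V) :
  ((P1 - Q1) + (u2 - u1)) + ((P2 - Q2) + (u3 - u2)) + ((P3 - Q3) + (u1 - u3))
  = (P1 + P2 + P3) - (Q1 + Q2 + Q3).
Proof.
rewrite [LHS](AC (2*2*2) ((1*3*5)*(2*4*6)))/= [X in _ + X = _](_ : _ = 0).
  by rewrite addr0 !opprD [LHS](AC (2*2*2) ((1*3*5)*(2*4*6))).
by rewrite [u2 - u1 + _]addrC subrKA subrKA subrr.
Qed.

(** The quadrilateral p p' q' q is cut along the diagonal p q'. *)
Lemma lquad p q p' q' :
  enorm (psub q p') <= 2^-1 -> enorm (psub q' p) <= 2^-1 ->
  enorm (psub q' q) <= 2^-1 -> enorm (psub q p) <= 2^-1 ->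
  lcirculation p p' q' + lcirculation p q' q =
  (lincr p p' - lincr q q') + (lincr p' q' - lincr p q).
Proof.
move=> qp' q'p q'q qp.
rewrite /lcirculation (lincr_opp hA q'p) (lincr_opp hA q'q) (lincr_opp hA qp).
exact: quad_sum.
Qed.

(** The region between the two boundaries is cut into three quadrilaterals; the connecting
    increments from p_i to q_i telescope around the cycle. *)
Lemma circulation_diff_quads p1 p2 p3 q1 q2 q3 :
  small_sides p1 p2 p3 -> small_sides q1 q2 q3 ->
  (forall p q, p \in [:: p1; p2; p3] -> q \in [:: q1; q2; q3] ->
     enorm (psub q p) <= 2^-1) ->
  circulation p1 p2 p3 - circulation q1 q2 q3 =
  (lcirculation p1 p2 q2 + lcirculation p1 q2 q1) +
  (lcirculation p2 p3 q3 + lcirculation p2 q3 q2) +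
  (lcirculation p3 p1 q1 + lcirculation p3 q1 q3).
Proof.
move=> [a1 a2 a3] [b1 b2 b3] pq.
have w (x : R) : x <= 4^-1 -> x <= 2^-1 by lra.
have i1 : p1 \in [:: p1; p2; p3] by rewrite !inE eqxx.
have i2 : p2 \in [:: p1; p2; p3] by rewrite !inE eqxx orbT.
have i3 : p3 \in [:: p1; p2; p3] by rewrite !inE eqxx !orbT.
have j1 : q1 \in [:: q1; q2; q3] by rewrite !inE eqxx.
have j2 : q2 \in [:: q1; q2; q3] by rewrite !inE eqxx orbT.
have j3 : q3 \in [:: q1; q2; q3] by rewrite !inE eqxx !orbT.
rewrite (lquad (pq _ _ i2 j1) (pq _ _ i1 j2) (w _ b1) (pq _ _ i1 j1)).
rewrite (lquad (pq _ _ i3 j2) (pq _ _ i2 j3) (w _ b2) (pq _ _ i2 j2)).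
rewrite (lquad (pq _ _ i1 j3) (pq _ _ i3 j1) (w _ b3) (pq _ _ i3 j3)).
rewrite telescope3 /circulation.
by rewrite (lincrE hA a1) (lincrE hA a2) (lincrE hA a3) (lincrE hA b1)
  (lincrE hA b2) (lincrE hA b3).
Qed.

Section WithBound.
Variable K : R.
Hypotheses (K0 : 0 <= K) (hT : tri_bound A al K).

(** Each of the six triangles has a side of P or Q as base and its third vertex in the other
    triangle, so its determinant is an off-diagonal coordinate, at most 9g, times that of P or Q.
    The factor 24 is 6 * 4. *)
Lemma circulation_diff_aligned p1 p2 p3 q1 q2 q3 (g X : R) :
  0 <= g <= 100^-1 -> 0 < tri_det p1 p2 p3 * tri_det q1 q2 q3 ->
  depth_le g p1 p2 p3 q1 -> depth_le g p1 p2 p3 q2 -> depth_le g p1 p2 p3 q3 ->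
  depth_le g q1 q2 q3 p1 -> depth_le g q1 q2 q3 p2 -> depth_le g q1 q2 q3 p3 ->
  3^-1 <= coef q1 q2 q3 p1 ->
  small_sides p1 p2 p3 -> small_sides q1 q2 q3 ->
  9 * g * `|tri_det p1 p2 p3| <= X -> 9 * g * `|tri_det q1 q2 q3| <= X ->
  `|circulation p1 p2 p3 - circulation q1 q2 q3| <= 24 * K * X `^ (al / 2).
Proof.
move=> g01 DD P1 P2 P3 Q1 Q2 Q3 n00 sP sQ X1 X2.
have [[b21 b31] [b12 b32] [b13 b23] [c31 c12 c23]] :=
  close_vertices_aligned g01 DD P1 P2 P3 Q1 Q2 Q3 n00.
have [D1 D2] : tri_det p1 p2 p3 != 0 /\ tri_det q1 q2 q3 != 0.
  by apply/andP; rewrite -negb_or -mulf_eq0 gt_eqF.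
have [g0 g1] := andP g01.
have [a1 a2 a3] := sP.
have [a1' a2' a3'] : [/\ enorm (psub p1 p2) <= 4^-1, enorm (psub p2 p3) <= 4^-1
    & enorm (psub p3 p1) <= 4^-1] by split; rewrite enorm_sub_sym.
(* Matched vertices differ by at most 2 * 9g * 1/4, so any vertex of one triangle is within 1/2 of
   any vertex of the other. *)
have gs : 2 * (9 * g) * 4^-1 <= 4^-1.
  by have := ler_wpM2l (ler0n R 9) g1; lra.
have k1 : enorm (psub q1 p1) <= 4^-1.
  by apply: le_trans (coef_close D1 a1 a3' b21 b31) gs.
have k2 : enorm (psub q2 p2) <= 4^-1.
  have D1' : tri_det p2 p3 p1 != 0 by rewrite -tri_det_rot.
  by apply: le_trans (coef_close D1' a2 a1' b32 b12) gs.
have k3 : enorm (psub q3 p3) <= 4^-1.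
  have D1' : tri_det p3 p1 p2 != 0 by rewrite tri_det_rot.
  by apply: le_trans (coef_close D1' a3 a2' b13 b23) gs.
have near (p p' q : pt) : enorm (psub q p') <= 4^-1 -> enorm (psub p' p) <= 4^-1 ->
    enorm (psub q p) <= 2^-1.
  by move=> h1 h2; apply: le_trans (enorm_triangle q p' p) _; lra.
have same (p : pt) : enorm (psub p p) <= 4^-1 by rewrite psub_self enorm0.
have pq p q : p \in [:: p1; p2; p3] -> q \in [:: q1; q2; q3] ->
    enorm (psub q p) <= 2^-1.
  rewrite !inE => /or3P[] /eqP -> /or3P[] /eqP ->.
  - exact: near k1 (same _).
  - exact: near k2 a1.
  - exact: near k3 a3'.
  - exact: near k1 a1'.
  - exact: near k2 (same _).
  - exact: near k3 a2.
  - exact: near k1 a3.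
  - exact: near k2 a2'.
  - exact: near k3 (same _).
rewrite (circulation_diff_quads sP sQ pq).
have w (x : R) : x <= 4^-1 -> x <= 2^-1 by lra.
have one (x y z : pt) (D c : R) : enorm (psub y x) <= 2^-1 ->
    enorm (psub z y) <= 2^-1 -> enorm (psub x z) <= 2^-1 ->
    9 * g * `|D| <= X -> `|c| <= 9 * g -> `|tri_det x y z| = `|c * D| ->
    `|lcirculation x y z| <= 4 * K * X `^ (al / 2).
  move=> h1 h2 h3 DX c9 e; apply: le_trans (lcirculation_bound hA al01 K0 hT h1 h2 h3) _.
  rewrite ler_wpM2l ?mulr_ge0 //; apply: powR_le => //.
  by rewrite e normrM; apply: le_trans DX; rewrite ler_wpM2r.
have i1 : p1 \in [:: p1; p2; p3] by rewrite !inE eqxx.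
have i2 : p2 \in [:: p1; p2; p3] by rewrite !inE eqxx orbT.
have i3 : p3 \in [:: p1; p2; p3] by rewrite !inE eqxx !orbT.
have j1 : q1 \in [:: q1; q2; q3] by rewrite !inE eqxx.
have j2 : q2 \in [:: q1; q2; q3] by rewrite !inE eqxx orbT.
have j3 : q3 \in [:: q1; q2; q3] by rewrite !inE eqxx !orbT.
have [b1 b2 b3] := sQ.
have detp (x y z t : pt) : tri_det z x y != 0 ->
    `|tri_det x y t| = `|coef z x y t * tri_det z x y|.
  by move=> D0; rewrite /coef divfK // -tri_det_rot.
have detq (x y z t : pt) : tri_det z x y != 0 ->
    `|tri_det t y x| = `|coef z x y t * tri_det z x y|.
  move=> D0; rewrite /coef divfK // -normrN; congr `| _ |.
  by rewrite /tri_det/det2/psub/=; ring.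
have rotP1 : tri_det p3 p1 p2 = tri_det p1 p2 p3 by rewrite tri_det_rot.
have rotP2 : tri_det p2 p3 p1 = tri_det p1 p2 p3 by rewrite -tri_det_rot.
have rotQ1 : tri_det q3 q1 q2 = tri_det q1 q2 q3 by rewrite tri_det_rot.
have rotQ2 : tri_det q2 q3 q1 = tri_det q1 q2 q3 by rewrite -tri_det_rot.
have e1 : `|lcirculation p1 p2 q2| <= 4 * K * X `^ (al / 2).
  apply: (one _ _ _ (tri_det p3 p1 p2) (coef p3 p1 p2 q2)) => //;
    rewrite ?rotP1 //; [exact: w|exact: pq|by rewrite enorm_sub_sym; exact: pq|].
  by rewrite -rotP1 -detp // rotP1.
have e2 : `|lcirculation p1 q2 q1| <= 4 * K * X `^ (al / 2).
  apply: (one _ _ _ (tri_det q3 q1 q2) (coef q3 q1 q2 p1)) => //;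
    rewrite ?rotQ1 //; [exact: pq|by rewrite enorm_sub_sym; exact: w|
      by rewrite enorm_sub_sym; exact: pq|].
  by rewrite -rotQ1 -detq // rotQ1.
have e3 : `|lcirculation p2 p3 q3| <= 4 * K * X `^ (al / 2).
  apply: (one _ _ _ (tri_det p1 p2 p3) (coef p1 p2 p3 q3)) => //;
    [exact: w|exact: pq|by rewrite enorm_sub_sym; exact: pq|exact: detp].
have e4 : `|lcirculation p2 q3 q2| <= 4 * K * X `^ (al / 2).
  apply: (one _ _ _ (tri_det q1 q2 q3) (coef q1 q2 q3 p2)) => //;
    [exact: pq|by rewrite enorm_sub_sym; exact: w|
     by rewrite enorm_sub_sym; exact: pq|exact: detq].
have e5 : `|lcirculation p3 p1 q1| <= 4 * K * X `^ (al / 2).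
  apply: (one _ _ _ (tri_det p2 p3 p1) (coef p2 p3 p1 q1)) => //;
    rewrite ?rotP2 //; [exact: w|exact: pq|by rewrite enorm_sub_sym; exact: pq|].
  by rewrite -rotP2 -detp // rotP2.
have e6 : `|lcirculation p3 q1 q3| <= 4 * K * X `^ (al / 2).
  apply: (one _ _ _ (tri_det q2 q3 q1) (coef q2 q3 q1 p3)) => //;
    rewrite ?rotQ2 //; [exact: pq|by rewrite enorm_sub_sym; exact: w|
      by rewrite enorm_sub_sym; exact: pq|].
  by rewrite -rotQ2 -detq // rotQ2.
have add2 (x y : E) c : `|x| <= c -> `|y| <= c -> `|x + y| <= c + c.
  by move=> h1 h2; apply: le_trans (ler_normD _ _) _; exact: lerD.
apply: le_trans (ler_normD _ _) _.
apply: le_trans (lerD (ler_normD _ _) (add2 _ _ _ e5 e6)) _.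
apply: le_trans (lerD (lerD (add2 _ _ _ e1 e2) (add2 _ _ _ e3 e4)) (lexx _)) _.
by rewrite le_eqVlt; apply/orP; left; apply/eqP; ring.
Qed.

(** Some coordinate of p1 in Q is at least 1/3. Rotating Q brings it to the first place and
    preserves orientation and circulation. *)
Lemma circulation_diff_close p1 p2 p3 q1 q2 q3 (g X : R) :
  0 <= g <= 100^-1 -> 0 < tri_det p1 p2 p3 * tri_det q1 q2 q3 ->
  depth_le g p1 p2 p3 q1 -> depth_le g p1 p2 p3 q2 -> depth_le g p1 p2 p3 q3 ->
  depth_le g q1 q2 q3 p1 -> depth_le g q1 q2 q3 p2 -> depth_le g q1 q2 q3 p3 ->
  small_sides p1 p2 p3 -> small_sides q1 q2 q3 ->
  9 * g * `|tri_det p1 p2 p3| <= X -> 9 * g * `|tri_det q1 q2 q3| <= X ->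
  `|circulation p1 p2 p3 - circulation q1 q2 q3| <= 24 * K * X `^ (al / 2).
Proof.
move=> g01 DD P1 P2 P3 Q1 Q2 Q3 sP sQ X1 X2.
have D2 : tri_det q1 q2 q3 != 0.
  by apply/negP => /eqP e; rewrite e mulr0 ltxx in DD.
case: (coef_max p1 D2) => h.
- exact: (@circulation_diff_aligned p1 p2 p3 q1 q2 q3 g).
- rewrite (circulation_rot A q1); rewrite (tri_det_rot q1) in DD X2.
  by apply: (@circulation_diff_aligned p1 p2 p3 q2 q3 q1 g) => //;
    do ?exact: depth_le_rot; exact: small_sides_rot.
- rewrite (circulation_rot A q1) (circulation_rot A q2).
  rewrite (tri_det_rot q1) (tri_det_rot q2) in DD X2.
  by apply: (@circulation_diff_aligned p1 p2 p3 q3 q1 q2 g) => //;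
    do ?[do 2 apply: depth_le_rot => //]; do 2 apply: small_sides_rot.
Qed.

(** Take g = 20 d / D1 for the smaller determinant D1. If D1 >= 2000 d, then g <= 1/100 and D2 <= 5
    D1. Otherwise D2 <= 4 (2000 + 1) d = 8004 d. *)
Lemma min_max_arith (D1 D2 d : R) : 0 < D1 -> 0 < D2 -> 0 <= d ->
  D1 <= 4 * (D2 + d) -> D2 <= 4 * (D1 + d) ->
  (exists g, [/\ 0 <= g <= 100^-1, 20 * d <= g * D1, 20 * d <= g * D2,
     9 * g * D1 <= 8004 * d & 9 * g * D2 <= 8004 * d]) \/
  D1 <= 8004 * d /\ D2 <= 8004 * d.
Proof.
move=> D10 D20 d0.
wlog D12 : D1 D2 D10 D20 / D1 <= D2.
  move=> th h1 h2; have [h|h] := leP D1 D2; first exact: th.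
  have [[g [? ? ? ? ?]]|[? ?]] := th D2 D1 D20 D10 (ltW h) h2 h1.
    by left; exists g.
  by right.
move=> h1 h2.
have [h|h] := leP (2000 * d) D1; last by right; lra.
left; exists (20 * d / D1).
have gD : 20 * d / D1 * D1 = 20 * d by rewrite divfK // gt_eqF.
have g0 : 0 <= 20 * d / D1 by rewrite divr_ge0 ?mulr_ge0 // ltW.
split.
- by rewrite g0 ler_pdivrMr //; lra.
- by rewrite gD.
- by rewrite -[leLHS]gD ler_wpM2l.
- by rewrite -mulrA gD; lra.
- have : 20 * d / D1 * D2 <= 20 * d / D1 * (5 * D1) by rewrite ler_wpM2l //; lra.
  rewrite [leRHS]mulrCA gD -mulrA; lra.
Qed.

Lemma circulation_diff_symdiff p1 p2 p3 q1 q2 q3 (d : R) :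
  0 < tri_det p1 p2 p3 * tri_det q1 q2 q3 ->
  small_sides p1 p2 p3 -> small_sides q1 q2 q3 -> 0 <= d ->
  (leb2 ((otri p1 p2 p3 `\` otri q1 q2 q3) `|`
         (otri q1 q2 q3 `\` otri p1 p2 p3)) <= d%:E)%E ->
  `|circulation p1 p2 p3 - circulation q1 q2 q3|
    <= 24 * K * (8004 * d) `^ (al / 2).
Proof.
move=> DD sP sQ d0 hd.
have [D1 D2] : tri_det p1 p2 p3 != 0 /\ tri_det q1 q2 q3 != 0.
  by apply/andP; rewrite -negb_or -mulf_eq0 gt_eqF.
have hd' := hd; rewrite setUC in hd'.
have D10 : 0 < `|tri_det p1 p2 p3| by rewrite normr_gt0.
have D20 : 0 < `|tri_det q1 q2 q3| by rewrite normr_gt0.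
have m1 := symdiff_ge_tri_det D1 D2 hd.
have m2 := symdiff_ge_tri_det D2 D1 hd'.
have [[g [g01 g1 g2 g3 g4]]|[l1 l2]] := min_max_arith D10 D20 d0 m1 m2.
  have g01' : 0 <= g < 1.
    case/andP: g01 => -> /= h; apply: le_lt_trans h _.
    by rewrite invf_lt1 // ltr1n.
  have [v1 v2 v3] := ctri_vertex p1 p2 p3; have [w1 w2 w3] := ctri_vertex q1 q2 q3.
  apply: (@circulation_diff_close p1 p2 p3 q1 q2 q3 g) => //.
  - exact: depth_of_symdiff D1 D2 w1 hd g01' g1.
  - exact: depth_of_symdiff D1 D2 w2 hd g01' g1.
  - exact: depth_of_symdiff D1 D2 w3 hd g01' g1.
  - exact: depth_of_symdiff D2 D1 v1 hd' g01' g2.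
  - exact: depth_of_symdiff D2 D1 v2 hd' g01' g2.
  - exact: depth_of_symdiff D2 D1 v3 hd' g01' g2.
(* Both triangles are small compared with d: there is nothing to match, and each circulation is
   bounded separately. *)
have one x y z : small_sides x y z -> `|tri_det x y z| <= 8004 * d ->
    `|circulation x y z| <= K * (8004 * d) `^ (al / 2).
  move=> [s1 s2 s3] h; apply: le_trans (hT s1 s2 s3) _.
  by rewrite ler_wpM2l // powR_le.
apply: le_trans (ler_normB _ _) _.
apply: le_trans (lerD (one _ _ _ sP l1) (one _ _ _ sQ l2)) _.
have : 0 <= K * (8004 * d) `^ (al / 2) by rewrite mulr_ge0 ?powR_ge0.
by move: (_ `^ _) => y; clear hd hd'; lra.
Qed.

End WithBound.

End SymmetricBound.

(** * Symmetric differences on the torus *)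

Section TorusSymmetric.
Variable R : realType.
Local Notation pt := (pt R).
Implicit Types p q r z : pt.

Lemma otri_near p q r z (L : R) : 0 < L -> enorm (psub q p) <= L ->
  enorm (psub r p) <= L -> otri p q r z -> enorm (psub z p) < L.
Proof.
move=> L0 qp rp [a [b [c [a0 [b0 [c0 [s ->]]]]]]].
have -> : psub (bary p q r a b c) p =
    padd (pscale b (psub q p)) (pscale c (psub r p)).
  have -> : a = 1 - b - c by lra.
  by rewrite /bary/psub/padd/pscale/=; congr pair; ring.
apply: le_lt_trans (enorm_add _ _) _; rewrite !enorm_scale !gtr0_norm //.
have := ler_wpM2l (ltW b0) qp; have := ler_wpM2l (ltW c0) rp.
have : (b + c) * L < 1 * L by rewrite ltr_pM2r //; lra.
lra.
Qed.

Lemma tproj_otri_shift p q r (k1 k2 : int) :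
  let k : pt := (k1%:~R, k2%:~R) in
  tproj (otri (padd p k) (padd q k) (padd r k)) = tproj (otri p q r).
Proof.
have sub (u v w : pt) (m1 m2 : int) : tproj (otri u v w) `<=`
    tproj (otri (padd u (m1%:~R, m2%:~R)) (padd v (m1%:~R, m2%:~R))
      (padd w (m1%:~R, m2%:~R))).
  move=> y [yT [i [j [a [b [c [a0 [b0 [c0 [s [e1 e2]]]]]]]]]]]; split => //.
  exists (i + m1), (j + m2), a, b, c; do !split => //.
  have aE : a = 1 - b - c by lra.
  rewrite !intrD !addrA e1 e2 aE /bary/padd/pscale/=; congr pair; ring.
move=> k; apply/seteqP; split; last exact: sub.
have back u : padd (padd u k) ((- k1)%:~R, (- k2)%:~R) = u.
  by case: u => ? ?; rewrite /padd/= !mulrNz !addrK.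
by move=> y /(sub _ _ _ (- k1) (- k2)); rewrite !back.
Qed.

(** If a torus point has lifts in both P and Q, these differ in each coordinate by an integer of
    modulus less than 1/4 + 1/2 + 1/4 = 1, hence coincide. *)
Lemma tproj_symdiff (P Q : set pt) (p q : pt) :
  (forall z, P z -> enorm (psub z p) < 4^-1) ->
  (forall z, Q z -> enorm (psub z q) < 4^-1) ->
  `|q.1 - p.1| <= 2^-1 -> `|q.2 - p.2| <= 2^-1 ->
  tproj ((P `\` Q) `|` (Q `\` P)) `<=`
  (tproj P `\` tproj Q) `|` (tproj Q `\` tproj P).
Proof.
move=> hP hQ h1 h2.
have coord (a b x y : R) (i j : int) : `|b - a| <= 2^-1 ->
    `|x + i%:~R - a| < 4^-1 -> `|y + j%:~R - b| < 4^-1 -> x = y -> i = j.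
  move=> ba xi yj xy; apply/eqP; rewrite -subr_eq0; apply/eqP.
  apply: (@int_small_eq0 R); rewrite intrB xy in xi *.
  move: ba xi yj; rewrite ler_norml !ltr_norml => /andP[? ?] /andP[? ?] /andP[? ?].
  by apply/andP; split; lra.
have eqZ y i1 i2 j1 j2 : P (y.1 + i1%:~R, y.2 + i2%:~R) ->
    Q (y.1 + j1%:~R, y.2 + j2%:~R) -> i1 = j1 /\ i2 = j2.
  move=> /hP lp /hQ lq; split.
    by apply: coord h1 (le_lt_trans (enorm_coord1 _) lp)
      (le_lt_trans (enorm_coord1 _) lq) _.
  by apply: coord h2 (le_lt_trans (enorm_coord2 _) lp)
    (le_lt_trans (enorm_coord2 _) lq) _.
move=> y [yT [i1 [i2 [[Py nQ]|[Qy nP]]]]]; [left|right].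
  split; first by split => //; exists i1, i2.
  move=> [_ [j1 [j2 Qy]]]; apply: nQ.
  by have [-> ->] := eqZ _ _ _ _ _ Py Qy.
split; first by split => //; exists i1, i2.
move=> [_ [j1 [j2 Py]]]; apply: nP.
by have [<- <-] := eqZ _ _ _ _ _ Py Qy.
Qed.

Lemma near_in_box (P : set pt) (p : pt) :
  (forall z, P z -> enorm (psub z p) < 4^-1) ->
  `|p.1| <= 1 -> `|p.2| <= 1 -> in_box P.
Proof.
move=> hP p1 p2 z /hP h.
have coord (x a : R) : `|a| <= 1 -> `|x - a| < 4^-1 -> `|x| < 3 / 2.
  move=> a1 xa; rewrite -(subrK a x); apply: le_lt_trans (ler_normD _ _) _; lra.
split.
  exact: coord p1 (le_lt_trans (enorm_coord1 _) h).
exact: coord p2 (le_lt_trans (enorm_coord2 _) h).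
Qed.

Lemma tri_dist_fin (l1 l2 l3 m1 m2 m3 : seg R) :
  let D := (tri_interior l1 l2 l3 `\` tri_interior m1 m2 m3) `|`
           (tri_interior m1 m2 m3 `\` tri_interior l1 l2 l3) in
  (fine (leb2 D))%:E = leb2 D.
Proof.
move=> D; rewrite fineK // ge0_fin_numE ?leb2_ge0 //.
apply: (@le_lt_trans _ _ (leb2 (@in_T R))); last first.
  by apply: le_lt_trans (leb2_T_le1 R) _; exact: ltry.
by apply: leb2_mono => z [] [[zT _] _].
Qed.

End TorusSymmetric.

(** * The symmetric norm on the torus *)

Lemma powR_le_scale2 (R : realType) (e c c' x : R) : 0 <= e <= 1 -> 1 <= c ->
  1 <= c' -> 0 <= x -> (c * (c' * x)) `^ e <= c * c' * x `^ e.
Proof.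
move=> e01 c1 c1' x0; have c0 : 0 <= c by lra.
have c0' : 0 <= c' by lra.
by apply: powR_le_scale; rewrite ?mulr_ge0 ?mulr_ege1 // mulrA.
Qed.

Section SymmetricNorm.
Variables (R : realType) (E : normedModType R) (A : seg R -> E).
Local Notation pt := (pt R).
Hypothesis hA : additive_on_joins A.
Variable al : R.
Hypothesis al01 : 0 <= al <= 1.
Local Notation circulation := (circulation A).

Let alh : 0 <= al / 2 <= 1. Proof. by case/andP: al01 => h1 h2; lra. Qed.

Lemma circulation_shift (p q r : pt) (k1 k2 : int) :
  let k : pt := (k1%:~R, k2%:~R) in
  circulation (padd p k) (padd q k) (padd r k) = circulation p q r.
Proof.
move=> k.
have sub u v : psub (padd u k) (padd v k) = psub u v.
  by rewrite /psub/padd/=; congr pair; ring.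
by rewrite /circulation /incr !tredDZ !sub.
Qed.

Lemma symm_norm_bound_of (K : R) : 0 <= K -> tri_bound A al K ->
  symm_norm_bound A al (2000 * 1000 * K).
Proof.
move=> K0 hT l1 l2 l3 m1 m2 m3 tl tm.
have [X1 [X2 X3]] : in_X l1 /\ in_X l2 /\ in_X l3 by case: tl.
have [Y1 [Y2 Y3]] : in_X m1 /\ in_X m2 /\ in_X m3 by case: tm.
have aL := tri_det_le_area l3 X1 X2; have aM := tri_det_le_area m3 Y1 Y2.
have sL := is_triangle_sides tl; have sM := is_triangle_sides tm.
rewrite /= in sL sM.
rewrite (A_bdry_lift A tl) (A_bdry_lift A tm).
have areaL := tri_area_ge0 l1 l2 l3; have areaM := tri_area_ge0 m1 m2 m3.
rewrite /tri_dist /tri_orient.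
have fin := tri_dist_fin l1 l2 l3 m1 m2 m3; rewrite /= !tri_interiorE in fin.
rewrite !tri_interiorE.
have [T1 _] := X1; have [U1 _] := Y1.
have Dl : det2 l1.2 l2.2 =
    tri_det l1.1 (padd l1.1 l1.2) (padd (padd l1.1 l1.2) l2.2).
  by rewrite /tri_det/det2/psub/padd/=; ring.
have Dm : det2 m1.2 m2.2 =
    tri_det m1.1 (padd m1.1 m1.2) (padd (padd m1.1 m1.2) m2.2).
  by rewrite /tri_det/det2/psub/padd/=; ring.
rewrite {}Dl {}Dm in aL aM *.
move: (tri_area l1 l2 l3) (tri_area m1 m2 m3) areaL areaM aL aM => SL SM SL0 SM0.
move: l1.1 m1.1 T1 U1 (padd l1.1 l1.2) (padd m1.1 m1.2)
  (padd (padd l1.1 l1.2) l2.2) (padd (padd m1.1 m1.2) m2.2) sL sM fin.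
clear l1 l2 l3 m1 m2 m3 tl tm X1 X2 X3 Y1 Y2 Y3.
move=> p1 q1 pT qT p2 q2 p3 q3 sP sQ fin aL aM.
have [eqs|neqs] := eqVneq (Num.sg (tri_det p1 p2 p3)) (Num.sg (tri_det q1 q2 q3));
  last first.
  (* With different orientations the distance is the sum of the areas, so the triangle bound for
     each circulation suffices. *)
  have one x y z S : small_sides x y z -> `|tri_det x y z| <= 36 * S -> 0 <= S ->
      S <= SL + SM ->
      `|circulation x y z| <= K * (36 * (SL + SM) `^ (al / 2)).
    move=> [s1 s2 s3] h S0 S1; apply: le_trans (hT _ _ _ s1 s2 s3) _.
    rewrite ler_wpM2l //; apply: powR_le_scale => //.
    - by rewrite ler1n.
    - by rewrite addr_ge0.
    - by apply: le_trans h _; rewrite ler_pM2l.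
  move=> _; apply: le_trans (ler_normB _ _) _.
  have e1 := one p1 p2 p3 SL sP aL SL0 (ltac:(by rewrite lerDl)).
  have e2 := one q1 q2 q3 SM sQ aM SM0 (ltac:(by rewrite lerDr)).
  apply: le_trans (lerD e1 e2) _.
  have : 0 <= K * (SL + SM) `^ (al / 2) by rewrite mulr_ge0 ?powR_ge0.
  move: (_ `^ _) => y {one e1 e2 fin}; lra.
set dist := fine _ in fin *; move=> dist0.
have [D1|D1] := eqVneq (tri_det p1 p2 p3) 0.
  have D2 : tri_det q1 q2 q3 = 0.
    by apply/eqP; rewrite -sgr_eq0 -eqs D1 sgr0.
  have [s1 s2 s3] := sP; have [t1 t2 t3] := sQ.
  rewrite (circulation_collinear hA D1) // (circulation_collinear hA D2) //.
  by rewrite subrr normr0 mulr_ge0 ?powR_ge0 ?mulr_ge0 ?ler0n.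
have D2 : tri_det q1 q2 q3 != 0 by rewrite -sgr_eq0 -eqs sgr_eq0.
have [k1 [k2 kE]] := tredE (psub q1 p1).
(* The lattice translate of Q whose first vertex is nearest to p1, as [tproj_symdiff] requires. *)
pose k : pt := (k1%:~R, k2%:~R); pose sh z := padd z k.
have shsub u v : psub (sh u) (sh v) = psub u v.
  by rewrite /sh /psub/padd/=; congr pair; ring.
have detsh : tri_det (sh q1) (sh q2) (sh q3) = tri_det q1 q2 q3.
  by rewrite /tri_det !shsub.
have ssh : small_sides (sh q1) (sh q2) (sh q3) by rewrite /small_sides !shsub.
have DD : 0 < tri_det p1 p2 p3 * tri_det (sh q1) (sh q2) (sh q3).
  by rewrite -sgr_gt0 sgrM detsh eqs -sgrM -expr2 sgr_gt0 exprn_even_gt0.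
have q1d : sh q1 = padd p1 (tred (psub q1 p1)).
  by rewrite kE /sh /k /padd/psub/=; congr pair; ring.
have [d1 d2] := tred_in_T (psub q1 p1).
have norm_half (x : R) : - 2^-1 <= x < 2^-1 -> `|x| <= 2^-1.
  by move=> /andP[? ?]; rewrite ler_norml; apply/andP; split; lra.
have qp1 : `|(sh q1).1 - p1.1| <= 2^-1.
  by rewrite q1d /padd/= addrAC subrr add0r norm_half.
have qp2 : `|(sh q1).2 - p1.2| <= 2^-1.
  by rewrite q1d /padd/= addrAC subrr add0r norm_half.
have quarter : 0 < 4^-1 :> R by rewrite invr_gt0.
have nearP z : otri p1 p2 p3 z -> enorm (psub z p1) < 4^-1.
  by case: sP => s1 _ s3; apply: otri_near => //; rewrite enorm_sub_sym.
have nearQ z : otri (sh q1) (sh q2) (sh q3) z -> enorm (psub z (sh q1)) < 4^-1.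
  by case: ssh => s1 _ s3; apply: otri_near => //; rewrite enorm_sub_sym.
have one1 (x y : R) : `|x| <= 2^-1 -> `|y - x| <= 2^-1 -> `|y| <= 1.
  move=> hx hy; rewrite -(subrK x y); apply: le_trans (ler_normD _ _) _; lra.
have [pT1 pT2] := pT.
have p1le : `|p1.1| <= 2^-1 by exact: norm_half.
have p2le : `|p1.2| <= 2^-1 by exact: norm_half.
have boxP : in_box (otri p1 p2 p3) by apply: near_in_box nearP _ _; lra.
have boxQ : in_box (otri (sh q1) (sh q2) (sh q3)).
  by apply: near_in_box nearQ _ _; [exact: one1 p1le qp1|exact: one1 p2le qp2].
set Z := (otri p1 p2 p3 `\` otri (sh q1) (sh q2) (sh q3)) `|`
         (otri (sh q1) (sh q2) (sh q3) `\` otri p1 p2 p3).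
have mP : measurable (otri p1 p2 p3) by exact: measurable_otri.
have mQ : measurable (otri (sh q1) (sh q2) (sh q3)).
  by apply: measurable_otri; rewrite detsh.
have mZ : measurable Z by apply: measurableU; exact: measurableD.
have boxZ : in_box Z by move=> z [] [] => [/boxP|/boxQ].
have hZ : (leb2 (tproj Z) <= dist%:E)%E.
  rewrite fin; apply: leb2_mono => y /(tproj_symdiff nearP nearQ qp1 qp2).
  by rewrite (tproj_otri_shift q1 q2 q3 k1 k2).
have hZ9 := leb2_le_tproj mZ boxZ hZ.
have d90 : 0 <= 9 * dist by rewrite mulr_ge0 // ltW.
have := circulation_diff_symdiff hA al01 K0 hT DD sP ssh d90 hZ9.
rewrite (circulation_shift q1 q2 q3 k1 k2) => h; apply: le_trans h _.
(* 24 * 8004 * 9 = 1728864, below the announced 2000 * 1000. *)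
have pw : (8004 * (9 * dist)) `^ (al / 2) <= 8004 * 9 * dist `^ (al / 2).
  apply: powR_le_scale2 alh _ _ (ltW dist0); by rewrite ler1n.
have K24 : 0 <= 24 * K by rewrite mulr_ge0.
apply: le_trans (ler_wpM2l K24 pw) _.
have : 0 <= K * dist `^ (al / 2) by rewrite mulr_ge0 ?powR_ge0.
by move: (_ `^ _) => y {fin hZ hZ9 pw}; lra.
Qed.

End SymmetricNorm.

(** * From suprema to pointwise bounds and back *)

Section Suprema.
Variables (R : realType) (E : normedModType R) (A : seg R -> E).
Local Notation pt := (pt R).
Hypothesis hA : additive_on_joins A.
Variable al : R.
Hypothesis al01 : 0 <= al <= 1.

Let al0 : 0 <= al. Proof. by case/andP: al01. Qed.

(** Compare a segment with the null segment at its initial point, where A vanishes. The pair is far,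
    because the smaller length is 0, so [rho] is just the length. *)
Lemma gr_norm_le_holder : (gr_norm A al <= holder_norm A al)%E.
Proof.
apply: ge_ereal_sup => _ [l [lX [l0 ->]]]; apply: ereal_sup_ubound.
have oX : in_X (l.1, (0, 0) : pt).
  by case: lX => lT _; split => //=; rewrite enorm0 invr_ge0.
have o0 : seg_len (l.1, (0, 0) : pt) = 0 by exact: enorm0.
have A0 : A (l.1, (0, 0)) = 0.
  by case: lX => lT _; rewrite -(incr_self hA l.1) /incr psub_self tred_id.
have f : far l (l.1, (0, 0)).
  rewrite /far o0 min_r ?enorm_ge0 // mulr0 lt_max; apply/orP; right.
  have -> : seg_f (l.1, (0, 0) : pt) = tred l.1.
    by rewrite /seg_f /padd /= !addr0; case: (l.1).
  rewrite /seg_f tdist_tred_small /=.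
  - by rewrite psub_padd.
  - rewrite addrAC subrr add0r; apply: le_trans (enorm_coord1 _) _.
    by case: lX => _ h; apply: le_trans h _; lra.
  - rewrite addrAC subrr add0r; apply: le_trans (enorm_coord2 _) _.
    by case: lX => _ h; apply: le_trans h _; lra.
have rE : rho l (l.1, (0, 0)) = seg_len l.
  by rewrite /rho; case: asboolP => // _; rewrite o0 addr0.
exists l, (l.1, (0, 0)); split => //; split => //; split; first by rewrite rE.
by rewrite rE A0 subr0.
Qed.

(** The supremum of the empty set is -oo, so an explicit member is needed; likewise for the other
    norms. *)
Lemma gr_norm_ge0 : (0 <= gr_norm A al)%E.
Proof.
pose v : pt := (8^-1, 0).
have nv : enorm v = 8^-1 by apply: enormE => //=; ring.
apply: le_trans (ereal_sup_ubound _); last first.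
  exists ((0, 0), v); split; last by split; [rewrite /seg_len /= nv|].
  by split; [split => /=; lra|rewrite /= nv; lra].
by rewrite lee_fin divr_ge0 // powR_ge0.
Qed.

Lemma gr_bound_of_norm (K : R) : gr_norm A al = K%:E -> gr_bound A al K.
Proof.
move=> hK p q qp.
have K0 : 0 <= K by rewrite -lee_fin -hK gr_norm_ge0.
have [/eqP e|n0] := boolP (enorm (psub q p) == 0).
  have -> := psub_eq0 (enorm_eq0 e).
  by rewrite (incr_self hA) normr0 mulr_ge0 // powR_ge0.
have e0 : 0 < enorm (psub q p) by rewrite lt_def n0 enorm_ge0.
rewrite -ler_pdivrMr ?powR_gt0 // -lee_fin -hK; apply: ereal_sup_ubound.
by exists (tred p, psub q p); split; [exact: incr_in_X|].
Qed.

Lemma holder_bound_of_norm (K : R) : holder_norm A al = K%:E -> holder_bound A al K.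
Proof.
move=> hK l l' lX lX' r0.
rewrite -ler_pdivrMr ?powR_gt0 // -lee_fin -hK; apply: ereal_sup_ubound.
by exists l, l'.
Qed.

Lemma holder_norm_le (K : R) : holder_bound A al K -> (holder_norm A al <= K%:E)%E.
Proof.
move=> hK; apply: ge_ereal_sup => _ [l [l' [lX [lX' [r0 ->]]]]].
by rewrite lee_fin ler_pdivrMr ?powR_gt0 // hK.
Qed.

Lemma vee_bound_of_norm (K : R) : vee_norm A al = K%:E -> vee_bound A al K.
Proof.
move=> hK l l' lX lX' ll' v; have [S0 _ _] := vee_rho_le lX lX' ll' v.
rewrite -ler_pdivrMr ?powR_gt0 // -lee_fin -hK; apply: ereal_sup_ubound.
by exists l, l'.
Qed.

Lemma vee_norm_le (K : R) : vee_bound A al K -> (vee_norm A al <= K%:E)%E.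
Proof.
move=> hK; apply: ge_ereal_sup => _ [l [l' [lX [lX' [ll' [v ->]]]]]].
have [S0 _ _] := vee_rho_le lX lX' ll' v.
by rewrite lee_fin ler_pdivrMr ?powR_gt0 // hK.
Qed.

(* The rotation angle comes from the Pythagorean triple (9, 40, 41). *)
Lemma vee_norm_ge0 : (0 <= vee_norm A al)%E.
Proof.
pose v : pt := (8^-1, 0); pose w : pt := (8^-1 * (40 / 41), 8^-1 * (9 / 41)).
have nv : enorm v = 8^-1 by apply: enormE => //=; ring.
have nw : enorm w = 8^-1 by apply: enormE => //=; field.
have oT : in_T ((0, 0) : pt) by split => /=; lra.
apply: le_trans (ereal_sup_ubound _); last first.
  exists ((0, 0), v), ((0, 0), w); split; first by split => //=; rewrite nv; lra.
  split; first by split => //=; rewrite nw; lra.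
  split; first by move=> -[_]; lra.
  split; last by [].
  split; last by rewrite /seg_len /= nv nw.
  rewrite /far /seg_len /= nv nw minxx /seg_i /= tdist_self /seg_f.
  apply/negP; rewrite -leNgt ge_max; apply/andP; split; first by lra.
  apply: le_trans (tdist_tred_le _ _) _; rewrite enorm_le /=; lra.
by rewrite lee_fin divr_ge0 // powR_ge0.
Qed.

Lemma tri_norm_bound_of_norm (K : R) : tri_norm A al = K%:E -> tri_norm_bound A al K.
Proof.
move=> hK l1 l2 l3 t a0.
rewrite -ler_pdivrMr ?powR_gt0 // -lee_fin -hK; apply: ereal_sup_ubound.
by exists l1, l2, l3.
Qed.

Lemma tri_norm_le (K : R) : tri_norm_bound A al K -> (tri_norm A al <= K%:E)%E.
Proof.
move=> hK; apply: ge_ereal_sup => _ [l1 [l2 [l3 [t [a0 ->]]]]].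
by rewrite lee_fin ler_pdivrMr ?powR_gt0 // hK.
Qed.

Lemma symm_norm_bound_of_norm (K : R) :
  symm_norm A al = K%:E -> symm_norm_bound A al K.
Proof.
move=> hK l1 l2 l3 m1 m2 m3 tl tm d0.
rewrite -ler_pdivrMr ?powR_gt0 // -lee_fin -hK; apply: ereal_sup_ubound.
by exists l1, l2, l3, m1, m2, m3.
Qed.

Lemma symm_norm_le (K : R) : symm_norm_bound A al K -> (symm_norm A al <= K%:E)%E.
Proof.
move=> hK; apply: ge_ereal_sup.
move=> _ [l1 [l2 [l3 [m1 [m2 [m3 [tl [tm [d0 ->]]]]]]]]].
by rewrite lee_fin ler_pdivrMr ?powR_gt0 // hK.
Qed.

Lemma tri_example : exists p q r : pt, [/\
  is_triangle (tri_seg p q) (tri_seg q r) (tri_seg r p),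
  is_triangle (tri_seg p r) (tri_seg r q) (tri_seg q p),
  0 < tri_area (tri_seg p q) (tri_seg q r) (tri_seg r p) & tri_det p q r != 0].
Proof.
pose p : pt := (0, 0); pose q : pt := (8^-1, 0); pose r : pt := (0, 8^-1).
have D0 : tri_det p q r != 0.
  rewrite /tri_det/det2/psub/= (_ : _ - _ = 64^-1); last by field.
  by rewrite invr_eq0 pnatr_eq0.
have D0' : tri_det p r q != 0.
  have -> : tri_det p r q = - tri_det p q r by rewrite /tri_det/det2; ring.
  by rewrite oppr_eq0.
have [s1 s2 s3] : [/\ enorm (psub q p) <= 4^-1, enorm (psub r q) <= 4^-1 &
    enorm (psub p r) <= 4^-1] by split; rewrite enorm_le /=; lra.
have [t1 t2 t3] : [/\ enorm (psub p q) <= 4^-1, enorm (psub q r) <= 4^-1 &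
    enorm (psub r p) <= 4^-1] by split; rewrite enorm_sub_sym.
exists p, q, r; split => //.
- exact: is_triangle_lift.
- exact: is_triangle_lift.
have := tri_det_le_area (tri_seg r p) (incr_in_X s1) (incr_in_X s2).
rewrite tri_seg_det => h.
have : 0 < `|tri_det p q r| by rewrite normr_gt0.
by move=> /lt_le_trans /(_ h); rewrite pmulr_rgt0.
Qed.

Lemma tri_norm_ge0 : (0 <= tri_norm A al)%E.
Proof.
have [p [q [r [t _ a0 _]]]] := tri_example.
apply: le_trans (ereal_sup_ubound _); last first.
  by exists (tri_seg p q), (tri_seg q r), (tri_seg r p).
by rewrite lee_fin divr_ge0 // powR_ge0.
Qed.

Lemma symm_norm_ge0 : (0 <= symm_norm A al)%E.
Proof.
have [p [q [r [t t' a0 D0]]]] := tri_example.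
apply: le_trans (ereal_sup_ubound _); last first.
  exists (tri_seg p q), (tri_seg q r), (tri_seg r p),
    (tri_seg p r), (tri_seg r q), (tri_seg q p); split => //; split => //.
  split; last by [].
  by rewrite tri_dist_rev // ltr_wpDr // tri_area_ge0.
by rewrite lee_fin divr_ge0 // powR_ge0.
Qed.

End Suprema.

(** * Assembly of the equivalences *)

(** Reduction to finite norms. If G or V is infinite, so is their sum, and the lower bound is
    trivial; if H is infinite, so is C H; if H is finite, so is G <= H. The 1 in 1 + c pays for
    G. *)
Lemma ereal_equiv_bounds (R : realType) (H G V : \bar R) (c C : R) :
  (0 <= G)%E -> (0 <= V)%E -> (G <= H)%E -> 0 < C -> 1 + c <= C ->
  (forall K, 0 <= K -> H = K%:E -> (V <= (c * K)%:E)%E) ->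
  (forall KG KV, 0 <= KG -> 0 <= KV -> G = KG%:E -> V = KV%:E ->
     (H <= (C * (KG + KV))%:E)%E) ->
  ((C^-1)%:E * H <= G + V <= C%:E * H)%E.
Proof.
move=> G0 V0 GH C0 cC up low; apply/andP; split.
  rewrite lee_pdivrMl //.
  case: G G0 GH low => [KG| |] // G0 _ low; last first.
    by rewrite addye ?gt0_muley ?lte_fin ?leey // gt_eqF // (lt_le_trans _ V0).
  case: V V0 {up} low => [KV| |] // V0 low; last first.
    by rewrite addey // gt0_muley ?lte_fin ?leey.
  by rewrite -EFinD -EFinM; apply: low.
have H0 : (0 <= H)%E := le_trans G0 GH.
case: H H0 GH up {low} => [K| |] // K0 GK up; last first.
  by rewrite gt0_muley ?lte_fin ?leey.
rewrite lee_fin in K0.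
apply: le_trans (leeD GK (up _ K0 erefl)) _.
rewrite -EFinD -EFinM lee_fin.
have -> : K + c * K = (1 + c) * K by ring.
by rewrite ler_wpM2r.
Qed.

Unset Implicit Arguments.

Theorem theorem3p11 (R : realType) (E : completeNormedModType R) :
  exists C : R, 1 <= C /\
  forall (a : R) (A : seg R -> E), 0 <= a <= 1 -> Omega A ->
    [/\ ((C^-1)%:E * holder_norm A a <= gr_norm A a + vee_norm A a
          <= C%:E * holder_norm A a)%E,
        ((C^-1)%:E * holder_norm A a <= gr_norm A a + tri_norm A a
          <= C%:E * holder_norm A a)%E
      & ((C^-1)%:E * holder_norm A a <= gr_norm A a + symm_norm A a
          <= C%:E * holder_norm A a)%E].
Proof.
pose N : R := 2000 * 1000.
have N1 : 1 <= N by rewrite /N; apply: mulr_ege1; rewrite ler1n.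
(* The largest requirement is 1 + 80 N, from the upper bound for the symmetric norm. All lower
   bounds need less than 1000. *)
exists (80 * N + 4000); split; first by lra.
move=> a A a01 [hA _].
have G0 := gr_norm_ge0 A a; have GH := gr_norm_le_holder hA a.
have C0 : 0 < 80 * N + 4000 by lra.
have lower (KG K : R) : 0 <= KG -> 0 <= K -> gr_norm A a = KG%:E ->
    corner_bound A a K -> (holder_norm A a <= (2 * KG + 12 * K)%:E)%E.
  move=> KG0 K0 hG hC; apply: holder_norm_le.
  exact: (holder_bound_of_corner hA a01 KG0 K0 (gr_bound_of_norm hA hG) hC).
have lower_tri (KG K : R) : 0 <= KG -> 0 <= K -> gr_norm A a = KG%:E ->
    tri_bound A a K -> (holder_norm A a <= (26 * KG + 12 * K)%:E)%E.
  move=> KG0 K0 hG hT.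
  have -> : 26 * KG + 12 * K = 2 * KG + 12 * (2 * KG + K) by ring.
  apply: lower => //; first by lra.
  exact: (corner_bound_of_tri hA a01 KG0 K0 (gr_bound_of_norm hA hG) hT).
(* The Hölder norm reaches the triangle bound through the vee and corner bounds: 4 (17 + 3) = 80. *)
have upper (K : R) : 0 <= K -> holder_norm A a = K%:E ->
    exists2 K', 0 <= K' <= 80 * K & tri_bound A a K'.
  move=> K0 hK.
  have [KG hG] : exists KG : R, gr_norm A a = KG%:E.
    by move: G0 GH; rewrite hK; case: (gr_norm A a) => // KG _ _; exists KG.
  have KG0 : 0 <= KG by rewrite -lee_fin -hG.
  have KGK : KG <= K by rewrite -lee_fin -hG -hK.
  have hV := vee_bound_of_holder a01 K0 (holder_bound_of_norm hK).
  have K30 : 0 <= 3 * K by lra.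
  have hC := corner_bound_of_vee hA a01 KG0 K30 (gr_bound_of_norm hA hG) hV.
  have KC0 : 0 <= 17 * KG + 3 * K by lra.
  exists (4 * (17 * KG + 3 * K)); first by apply/andP; split; lra.
  exact: tri_bound_of_corner.
have NKC (x : R) : 0 <= x -> 1000 * x <= (80 * N + 4000) * x.
  by move=> x0; rewrite ler_wpM2r //; lra.
have weaken (x y z : R) : 0 <= y + z -> x <= 1000 * (y + z) ->
    (x%:E <= ((80 * N + 4000) * (y + z))%:E)%E.
  by move=> yz h; rewrite lee_fin; exact: le_trans h (NKC _ yz).
split.
- apply: (@ereal_equiv_bounds _ _ _ _ 3) => //.
  + exact: vee_norm_ge0.
  + by lra.
  + move=> K K0 hK; apply: vee_norm_le.
    exact: vee_bound_of_holder (holder_bound_of_norm hK).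
  + move=> KG KV KG0 KV0 hG hV.
    have h := corner_bound_of_vee hA a01 KG0 KV0 (gr_bound_of_norm hA hG)
      (vee_bound_of_norm hV).
    apply: le_trans (lower KG (17 * KG + KV) KG0 _ hG h) _; first by lra.
    by apply: weaken; lra.
- apply: (@ereal_equiv_bounds _ _ _ _ (36 * 80)) => //.
  + exact: tri_norm_ge0.
  + by lra.
  + move=> K K0 hK; have [K' /andP[K'0 K'K] hT] := upper K K0 hK.
    apply: le_trans (tri_norm_le (tri_norm_bound_of a01 K'0 hT)) _.
    by rewrite lee_fin -mulrA ler_pM2l.
  + move=> KG KT KG0 KT0 hG hT.
    have h := tri_bound_of_tri_norm hA a01 KT0 (tri_norm_bound_of_norm hT).
    apply: le_trans (lower_tri KG (9 * KT) KG0 _ hG h) _; first by lra.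
    by apply: weaken; lra.
- apply: (@ereal_equiv_bounds _ _ _ _ (N * 80)) => //.
  + exact: symm_norm_ge0.
  + by lra.
  + move=> K K0 hK; have [K' /andP[K'0 K'K] hT] := upper K K0 hK.
    apply: le_trans (symm_norm_le (symm_norm_bound_of hA a01 K'0 hT)) _.
    by rewrite -/N lee_fin -mulrA ler_wpM2l //; lra.
  + move=> KG KS KG0 KS0 hG hS.
    have h := tri_bound_of_symm_norm hA a01 KS0 (symm_norm_bound_of_norm hS).
    apply: le_trans (lower_tri KG (18 * KS) KG0 _ hG h) _; first by lra.
    by apply: weaken; lra.
Qed.
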